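(* The problem of deciding, given a finite set $\Sigma$ of disjunctive embedded dependencies, whether $\Sigma$ is preserved under direct products is \textsc{RE}-complete; the problem of deciding whether $\Sigma$ is preserved under direct products in the finite is \textsc{coRE}-complete.
   Context: Signatures are relational (constant and relation symbols). A disjunctive embedded dependency (DED) is a sentence $\forall\vec{x}(\phi(\vec{x})\rightarrow\exists\vec{y}(\psi_1\vee\cdots\vee\psi_n))$ with $n\ge1$, $\phi,\psi_i$ conjunctions of atomic formulas (equalities allowed), such that every universal variable occurring in the head occurs in some relational atom of the body. The direct product $\mathcal{A}\times\mathcal{B}$ has domain $A\times B$, constants $\langle c^{\mathcal A},c^{\mathcal B}\rangle$, and $(\langle a_1,b_1\rangle,\dots,\langle a_k,b_k\rangle)\in R^{\mathcal{A}\times\mathcal{B}}$ iff $(a_1,\dots,a_k)\in R^{\mathcal A}$ and $(b_1,\dots,b_k)\in R^{\mathcal B}$. $\Sigma$ is preserved under direct products [in the finite] if for all [finite] models $\mathcal{A},\mathcal{B}$ of $\Sigma$, $\mathcal{A}\times\mathcal{B}$ is a model of $\Sigma$. \textsc{RE}/\textsc{coRE}: recursively enumerable problems and their complements. *)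

(* Defs.v *)
From Stdlib Require List.
From mathcomp Require Import all_boot.
Set Implicit Arguments. Unset Strict Implicit. Unset Printing Implicit Defensive.

(* Syntax.  Relation symbols, constant symbols and variables are nats.     *)
(* A relation symbol is interpreted as a set of tuples (lists); tuples of  *)
(* different lengths never interact, so a symbol name used with arity k    *)
(* is effectively the symbol (name, k).                                    *)
(* term : inl x = variable x, inr c = constant symbol c.                   *)
Definition term := (nat + nat)%type.
(* atom : inl (R, ts) = relational atom R(ts); inr (t1, t2) = t1 = t2.     *)
Definition atom := ((nat * seq term) + (term * term))%type.
(* ded : (ys, body, heads) encodes
     forall xs, (/\ body) -> exists ys, \/_{psi in heads} (/\ psi)
   where xs are all the remaining (free) variables. *)
Definition ded := (seq nat * seq atom * seq (seq atom))%type.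

Definition ded_exvars (d : ded) : seq nat := d.1.1.
Definition ded_body (d : ded) : seq atom := d.1.2.
Definition ded_heads (d : ded) : seq (seq atom) := d.2.

Definition tvars (t : term) : seq nat := if t is inl x then [:: x] else [::].
Definition avars (a : atom) : seq nat :=
  match a with
  | inl (_, ts) => flatten (map tvars ts)
  | inr (t1, t2) => tvars t1 ++ tvars t2
  end.
Definition relvars (phi : seq atom) : seq nat :=
  flatten (map (fun a => if a is inl (_, ts) then flatten (map tvars ts) else [::]) phi).

Definition wf_ded (d : ded) : Prop :=
  [/\ ded_heads d != [::],
      (forall a x, a \in ded_body d -> x \in avars a -> x \notin ded_exvars d) &
      (forall psi a x, psi \in ded_heads d -> a \in psi -> x \in avars a ->
          x \notin ded_exvars d -> x \in relvars (ded_body d))].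

Record structure := Structure {
  carrier :> Type;
  inhabitant : carrier;
  sconst : nat -> carrier;
  srel : nat -> seq carrier -> Prop }.

Definition finite_structure (S : structure) : Prop :=
  exists (n : nat) (f : 'I_n -> S), forall x : S, exists i, f i = x.

Definition teval (S : structure) (v : nat -> S) (t : term) : S :=
  match t with inl x => v x | inr c => @sconst S c end.

Definition holds (S : structure) (v : nat -> S) (a : atom) : Prop :=
  match a with
  | inl (R, ts) => @srel S R (map (teval v) ts)
  | inr (t1, t2) => teval v t1 = teval v t2
  end.

Definition sat_ded (S : structure) (d : ded) : Prop :=
  forall v : nat -> S,
    (forall a, a \in ded_body d -> holds v a) ->
    exists2 psi, psi \in ded_heads d &
      exists v' : nat -> S,
        (forall z, z \notin ded_exvars d -> v' z = v z) /\
        (forall a, a \in psi -> holds v' a).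

Definition models (S : structure) (Sigma : seq ded) : Prop :=
  forall d, d \in Sigma -> sat_ded S d.

Definition prod_structure (A B : structure) : structure :=
  {| carrier := (carrier A * carrier B)%type;
     inhabitant := (inhabitant A, inhabitant B);
     sconst c := (@sconst A c, @sconst B c);
     srel R s := @srel A R (map fst s) /\ @srel B R (map snd s) |}.

Definition preserved_products (Sigma : seq ded) : Prop :=
  forall A B : structure, models A Sigma -> models B Sigma ->
    models (prod_structure A B) Sigma.

Definition preserved_products_fin (Sigma : seq ded) : Prop :=
  forall A B : structure, finite_structure A -> finite_structure B ->
    models A Sigma -> models B Sigma -> models (prod_structure A B) Sigma.

Inductive prf : Type :=
  | PZero
  | PSucc
  | PProj of nat
  | PComp of prf & seq prf
  | PRec of prf & prf
  | PMu of prf.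

Inductive peval : prf -> seq nat -> nat -> Prop :=
  | ev_zero v : peval PZero v 0
  | ev_succ v : peval PSucc v (head 0 v).+1
  | ev_proj i v : peval (PProj i) v (nth 0 v i)
  | ev_comp f gs v ys z :
      List.Forall2 (fun g y => peval g v y) gs ys ->
      peval f ys z -> peval (PComp f gs) v z
  | ev_rec0 f g v y : peval f v y -> peval (PRec f g) (0 :: v) y
  | ev_recS f g n v y z :
      peval (PRec f g) (n :: v) y -> peval g (n :: y :: v) z ->
      peval (PRec f g) (n.+1 :: v) z
  | ev_mu f v n :
      peval f (n :: v) 0 ->
      (forall m, m < n -> exists k, peval f (m :: v) k.+1) ->
      peval (PMu f) v n.

Definition RE (P : nat -> Prop) : Prop :=
  exists c : prf, forall n, P n <-> exists y, peval c [:: n] y.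
Definition coRE (P : nat -> Prop) : Prop := RE (fun n => ~ P n).

Definition computable (f : nat -> nat) : Prop :=
  exists c : prf, forall n, peval c [:: n] (f n).

Definition m_reduces (P Q : nat -> Prop) : Prop :=
  exists f, computable f /\ forall n, P n <-> Q (f n).

Definition RE_complete (Q : nat -> Prop) : Prop :=
  RE Q /\ forall P, RE P -> m_reduces P Q.
Definition coRE_complete (Q : nat -> Prop) : Prop :=
  coRE Q /\ forall P, coRE P -> m_reduces P Q.

(* The decision problems, with inputs (finite sets of DEDs, as lists)       *)
(* encoded by the canonical injection pickle : seq ded -> nat.  Codes not   *)
(* encoding a finite set of well-formed DEDs are "no" instances.            *)
Definition problem (Pres : seq ded -> Prop) (n : nat) : Prop :=
  exists Sigma : seq ded, pickle Sigma = n /\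
    (forall d, d \in Sigma -> wf_ded d) /\ Pres Sigma.

Definition PRESERVATION := problem preserved_products.
Definition FIN_PRESERVATION := problem preserved_products_fin.

(* Main.v *)
(** For the upper bounds, fix [Sigma] and [d] in it.  That the product of two models of
    [Sigma] violates [d] amounts to the satisfiability of a set of propositional clauses
    over Herbrand names (Skolem witnesses included) with equality, the facts being
    tagged by the factor they hold in.  By compactness [Sigma] is preserved iff, for
    every [d], finitely many ground clauses are unsatisfiable, which can be searched
    for.  In the finite, a pair of finite structures witnessing non-preservation can be
    searched for directly.

    For the lower bounds, a program [c] is turned into rules defining the graphs of its
    subprograms on numerals.  The sentence [P \/ Q], for nullary [P] and [Q], is not
    preserved by the product of a model of [P] only and a model of [Q] only.  On the
    other hand, if every model satisfies [P /\ Q], preservation is ensured by making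
    [P /\ Q] collapse every relation [R] to the single tuple [(c0, ..., c0)].  So it is
    enough to make [P /\ Q] a consequence of the rules exactly when [c] halts on [n]
    (arbitrary models), respectively when it does not halt (finite models).
    - Arbitrary models: there are all numerals, the rules are read bottom-up, and the
      existence of a value of [c] on [n] implies [P /\ Q].
    - Finite models: a value of [c] on [n] is asserted to exist, and the rules are read
      top-down: every fact is justified by others, unless [P /\ Q].  The successor is
      contained in a strict order and every number is zero or a successor, so that in
      a finite model the justifications are genuine computations; conversely, a
      halting computation lives in [{0, .., B}] for some [B]. *)

From Stdlib Require Import ClassicalEpsilon FunctionalExtensionality.
Require Import Defs.
From mathcomp Require Import all_boot.
Set Implicit Arguments. Unset Strict Implicit. Unset Printing Implicit Defensive.

(** * Recursive functions of fixed arity *)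

(** A head disjunct fails in a product when, for every pair of witness tuples, one of the two
    factors refutes it. This is a universal condition on names, which calls for no Skolem function,
    and it is the only place where the two factors interact.

    In the reductions the case of one factor with both [P] and [Q] and one factor without needs no
    analysis: either all models concerned have both, or two standard models that differ only in
    which of [P] and [Q] holds refute preservation.

    Dependencies cannot force the numerals of an arbitrary model to be standard. There the rules
    only have to derive the genuine values, and spurious ones do no harm. A value that is asserted
    to exist must on the contrary be genuine; the well-foundedness of the successor that this takes
    comes from finiteness.

    For the reductions to be computable, all dependencies but one are independent of the input,
    which occurs in the remaining one as the length of a chain of successors. *)

Definition raw k (f : seq nat -> nat) :=
  exists c, forall v, size v = k -> peval c v (f v).

Lemma raw_ext k f g : (forall v, size v = k -> f v = g v) -> raw k f -> raw k g.
Proof. by move=> e [c cP]; exists c => v sv; rewrite -e //; apply: cP. Qed.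

Lemma raw_proj k i : raw k (fun v => nth 0 v i).
Proof. by exists (PProj i) => v _; constructor. Qed.

Lemma raw_comp k f (gs : seq (seq nat -> nat)) :
  raw (size gs) f -> List.Forall (raw k) gs ->
  raw k (fun v => f [seq g v | g <- gs]).
Proof.
move=> [c cP] rgs.
suff [cs csP] : exists cs, forall v, size v = k ->
    List.Forall2 (fun d y => peval d v y) cs [seq g v | g <- gs].
  exists (PComp c cs) => v sv; apply: ev_comp (csP v sv) _.
  by apply: cP; rewrite size_map.
elim: rgs => {f c cP gs} [|g gs [c cP] _ [cs csP]]; first by exists [::] => v _; constructor.
by exists (c :: cs) => v sv; constructor; [exact: cP | exact: csP].
Qed.

Lemma raw_zero k : raw k (fun _ => 0).
Proof. by exists PZero => v _; constructor. Qed.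

Lemma raw_succ k f : raw k f -> raw k (fun v => (f v).+1).
Proof.
move=> rf; apply: (@raw_comp k (fun w => (head 0 w).+1) [:: f]).
  by exists PSucc => v _; constructor.
by constructor.
Qed.

Lemma raw_const k n : raw k (fun _ => n).
Proof. by elim: n => [|n /raw_succ]; first exact: raw_zero. Qed.

Lemma raw_app1 k h f : raw 1 (fun v => h (nth 0 v 0)) -> raw k f ->
  raw k (fun v => h (f v)).
Proof. by move=> rh rf; apply: (raw_comp (gs := [:: f]) rh); constructor. Qed.

Lemma raw_app2 k h f g : raw 2 (fun v => h (nth 0 v 0) (nth 0 v 1)) ->
  raw k f -> raw k g -> raw k (fun v => h (f v) (g v)).
Proof.
by move=> rh rf rg; apply: (raw_comp (gs := [:: f; g]) rh); do !constructor.
Qed.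

Lemma raw_rec k b s n : raw k b -> raw k.+2 s -> raw k n ->
  raw k (fun v => nat_rect (fun _ => nat) (b v) (fun i acc => s [:: i, acc & v]) (n v)).
Proof.
move=> [cb bP] [cs sP] rn.
pose F w := nat_rect (fun _ => nat) (b (behead w))
  (fun i acc => s [:: i, acc & behead w]) (head 0 w).
have rF : raw k.+1 F.
  exists (PRec cb cs) => -[|m v] //= [sv]; rewrite /F /=.
  elim: m => [|m IH] /=; first by constructor; apply: bP.
  by apply: ev_recS IH _; apply: sP; rewrite /= sv.
(* The program passes the recursion argument followed by a copy of the whole input, rebuilt from [k]
   projections; hence the fixed length in [raw]. *)
pose gs := n :: [seq (fun v => nth 0 v i) | i <- iota 0 k].
have : raw k (fun v => F [seq g v | g <- gs]).
  apply: raw_comp; first by rewrite /= size_map size_iota.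
  constructor=> //; elim: (iota 0 k) => [|i s' IH] /=; constructor=> //.
  exact: raw_proj.
apply: raw_ext => v sv; rewrite /F /= -map_comp.
suff -> : [seq ((fun g => g v) \o (fun i v0 => nth 0 v0 i)) i | i <- iota 0 k] = v by [].
by apply: (@eq_from_nth _ 0) => [|i]; rewrite size_map size_iota // => ik;
  rewrite (nth_map 0) ?size_iota // nth_iota.
Qed.

Lemma raw_mu k t m : raw k.+1 t ->
  (forall v, size v = k -> t (m v :: v) = 0) ->
  (forall v i, size v = k -> i < m v -> t (i :: v) != 0) -> raw k m.
Proof.
move=> [c cP] t0 tS; exists (PMu c) => v sv; constructor.
  by rewrite -(t0 v sv); apply: cP; rewrite /= sv.
move=> i /(tS v i sv); have := cP (i :: v); rewrite /= sv => /(_ erefl).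
by case: (t _) => // j pj _; exists j.
Qed.

(** * Arithmetic and operations on codes of lists *)

Lemma raw_add : raw 2 (fun v => nth 0 v 0 + nth 0 v 1).
Proof.
have := @raw_rec 2 (nth 0 ^~ 1) _ (nth 0 ^~ 0) (@raw_proj _ _) (raw_succ (@raw_proj 4 1)) (@raw_proj _ _).
by apply: raw_ext => v _ /=; elim: (nth 0 v 0) => //= n ->.
Qed.

Lemma raw_pred : raw 1 (fun v => (nth 0 v 0).-1).
Proof.
have := @raw_rec 1 (fun _ => 0) (nth 0 ^~ 0) (nth 0 ^~ 0) (@raw_zero _) (@raw_proj _ _) (@raw_proj _ _).
by apply: raw_ext => v _ /=; case: (nth 0 v 0).
Qed.

Lemma raw_sub : raw 2 (fun v => nth 0 v 0 - nth 0 v 1).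
Proof.
have := @raw_rec 2 (nth 0 ^~ 0) _ (nth 0 ^~ 1) (@raw_proj _ _)
  (raw_app1 raw_pred (@raw_proj 4 1)) (@raw_proj _ _).
by apply: raw_ext => v _ /=; elim: (nth 0 v 1) => /= [|n ->]; rewrite ?subn0 ?subnS.
Qed.

Lemma raw_mul : raw 2 (fun v => nth 0 v 0 * nth 0 v 1).
Proof.
have := @raw_rec 2 (fun _ => 0) _ (nth 0 ^~ 0) (@raw_zero _)
  (raw_app2 raw_add (@raw_proj 4 3) (@raw_proj 4 1)) (@raw_proj _ _).
by apply: raw_ext => -[|a [|b []]] //= _; elim: a => //= n ->; rewrite mulSn.
Qed.

Lemma raw_exp2 : raw 1 (fun v => 2 ^ nth 0 v 0).
Proof.
have := @raw_rec 1 (fun _ => 1) _ (nth 0 ^~ 0) (@raw_const _ _)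
  (raw_app2 raw_add (@raw_proj 3 1) (@raw_proj 3 1)) (@raw_proj _ _).
by apply: raw_ext => v _ /=; elim: (nth 0 v 0) => //= n ->; rewrite expnS mul2n addnn.
Qed.

Lemma raw_isz k f : raw k f -> raw k (fun v => f v == 0).
Proof.
apply: (@raw_app1 k (fun x => x == 0)).
have := raw_app2 raw_sub (@raw_const 1 1) (@raw_proj 1 0).
by apply: raw_ext => v _; case: (nth 0 v 0) => //= n; rewrite subSS sub0n.
Qed.

Lemma raw_eq : raw 2 (fun v => nth 0 v 0 == nth 0 v 1).
Proof.
have := raw_isz (raw_app2 raw_add
  (raw_app2 raw_sub (@raw_proj 2 0) (@raw_proj 2 1))
  (raw_app2 raw_sub (@raw_proj 2 1) (@raw_proj 2 0))).
by apply: raw_ext => v _; rewrite addn_eq0 !subn_eq0 -eqn_leq.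
Qed.

Lemma raw_odd k f : raw k f -> raw k (fun v => odd (f v)).
Proof.
apply: (@raw_app1 k (fun x => odd x)).
have := @raw_rec 1 (fun _ => 0) _ (nth 0 ^~ 0) (@raw_const _ _)
  (raw_isz (@raw_proj 3 1)) (@raw_proj _ _).
by apply: raw_ext => v _ /=; elim: (nth 0 v 0) => //= n ->; case: (odd n).
Qed.

Lemma raw_half : raw 1 (fun v => (nth 0 v 0)./2).
Proof.
have := @raw_rec 1 (fun _ => 0) _ (nth 0 ^~ 0) (@raw_const _ _)
  (raw_app2 raw_add (raw_odd (@raw_proj 3 0)) (@raw_proj 3 1)) (@raw_proj _ _).
apply: raw_ext => v _ /=; elim: (nth 0 v 0) => //= n ->.
by rewrite uphalf_half.
Qed.

(* [CodeSeq.code (a :: s) = 2 ^ a * (code s).*2.+1]: the head is the 2-adic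
   valuation, and the tail the half of the odd part. *)
Definition code_hd n := head 0 (CodeSeq.decode n).
Definition code_tl n := CodeSeq.code (behead (CodeSeq.decode n)).

Lemma codeP n : exists s, n = CodeSeq.code s.
Proof. by exists (CodeSeq.decode n); rewrite CodeSeq.decodeK. Qed.

Lemma iter_half_exp i m : i <= m -> forall q, iter i half (2 ^ m * q) = 2 ^ (m - i) * q.
Proof.
elim: i => [|i IH] im q; first by rewrite subn0.
by rewrite iterS IH ?(ltnW im) // -(subnSK im) expnS -mulnA mul2n doubleK.
Qed.

Lemma raw_iter_half : raw 2 (fun v => iter (nth 0 v 0) half (nth 0 v 1)).
Proof.
have := @raw_rec 2 (nth 0 ^~ 1) _ (nth 0 ^~ 0) (@raw_proj _ _)
  (raw_app1 raw_half (@raw_proj 4 1)) (@raw_proj _ _).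
by apply: raw_ext => v _ /=; elim: (nth 0 v 0) => //= n ->.
Qed.

(** The head is the least [i] such that halving [i] times gives an odd number. The conjunct
    [nth 0 w 1 != 0] stops the search at once on [0], the code of the empty list, with the default
    head [0]. *)
Lemma raw_hd : raw 1 (fun v => code_hd (nth 0 v 0)).
Proof.
apply: (@raw_mu 1 (fun w => (nth 0 w 1 != 0) && ~~ odd (iter (nth 0 w 0) half (nth 0 w 1)) : nat)).
- have := raw_app2 raw_mul
    (raw_isz (raw_isz (@raw_proj 2 1)))
    (raw_isz (raw_odd raw_iter_half)).
  by apply: raw_ext => v _; rewrite mulnb !eqb0.
- move=> [|n []] //= _; have [s ->] := codeP n; rewrite /code_hd CodeSeq.codeK.
  by case: s => //= a s; rewrite iter_half_exp // subnn mul1n /= odd_double andbF.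
- move=> [|n []] //= i _; have [s ->] := codeP n; rewrite /code_hd CodeSeq.codeK.
  case: s => //= a s ia; rewrite iter_half_exp 1?ltnW // muln_eq0 expn_eq0 /=.
  by rewrite -(subnSK ia) expnS -mulnA oddM.
Qed.

Lemma raw_tl : raw 1 (fun v => code_tl (nth 0 v 0)).
Proof.
have := raw_app1 raw_half (@raw_app2 _ (fun i n => iter i half n) _ _ raw_iter_half raw_hd (@raw_proj 1 0)).
apply: raw_ext => -[|n []] //= _; have [s ->] := codeP n.
rewrite /code_hd /code_tl CodeSeq.codeK; case: s => //= a s.
by rewrite iter_half_exp // subnn mul1n /= uphalf_double.
Qed.

Definition code_cons a n := CodeSeq.code (a :: CodeSeq.decode n).

Lemma raw_cons : raw 2 (fun v => code_cons (nth 0 v 0) (nth 0 v 1)).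
Proof.
have := raw_app2 raw_mul (raw_app1 raw_exp2 (@raw_proj 2 0))
  (raw_succ (raw_app2 raw_add (@raw_proj 2 1) (@raw_proj 2 1))).
by apply: raw_ext => v _; rewrite /code_cons /= CodeSeq.decodeK addnn.
Qed.

(** The size is the least number of tails after which the code is [0], which codes the empty list
    only. *)
Lemma raw_size : raw 1 (fun v => size (CodeSeq.decode (nth 0 v 0))).
Proof.
have rdrop : raw 2 (fun v => iter (nth 0 v 0) code_tl (nth 0 v 1)).
  have := @raw_rec 2 (nth 0 ^~ 1) _ (nth 0 ^~ 0) (@raw_proj _ _)
    (raw_app1 raw_tl (@raw_proj 4 1)) (@raw_proj _ _).
  by apply: raw_ext => v _ /=; elim: (nth 0 v 0) => //= n ->.
have iterE i n : iter i code_tl n = CodeSeq.code (drop i (CodeSeq.decode n)).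
  elim: i => [|i IH] /=; first by rewrite drop0 CodeSeq.decodeK.
  by rewrite IH /code_tl CodeSeq.codeK -drop1 drop_drop add1n.
apply: (raw_mu rdrop) => -[|n []] //= => [_|i _ lt].
  by rewrite iterE drop_size.
rewrite iterE; case E: (drop _ _) => [|a s] /=.
  by have := size_drop i (CodeSeq.decode n); rewrite E /= => /esym/eqP;
    rewrite subn_eq0 leqNgt lt.
by rewrite muln_eq0 expn_eq0.
Qed.

Lemma raw_nth : raw 2 (fun v => nth 0 (CodeSeq.decode (nth 0 v 0)) (nth 0 v 1)).
Proof.
have := raw_app1 raw_hd (@raw_rec 2 (nth 0 ^~ 0) _ (nth 0 ^~ 1) (@raw_proj _ _)
    (raw_app1 raw_tl (@raw_proj 4 1)) (@raw_proj _ _)).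
apply: raw_ext => v _ /=; set n := nth 0 v 0; set i := nth 0 v 1.
have -> : nat_rect (fun _ => nat) n (fun _ acc => code_tl acc) i
  = CodeSeq.code (drop i (CodeSeq.decode n)).
  elim: i => [|i IH] /=; first by rewrite drop0 CodeSeq.decodeK.
  by rewrite IH /code_tl CodeSeq.codeK -drop1 drop_drop add1n.
by rewrite /code_hd CodeSeq.codeK -nth0 nth_drop addn0.
Qed.

(** * Computable functions between countable types *)

(* The function [g] on codes has to be total also outside of the codes of [X]: this
   allows both branches of a case analysis to be evaluated. *)
Definition Cmp (X T : countType) (f : X -> T) :=
  exists g : nat -> nat, raw 1 (fun v => g (nth 0 v 0)) /\
    forall x, g (pickle x) = pickle (f x).

Lemma pickle_pair (A B : countType) (a : A) (b : B) :
  pickle (a, b) = code_cons (pickle a) (code_cons (pickle b) 0).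
Proof. by rewrite /code_cons CodeSeq.codeK. Qed.

Lemma pickle_cons (A : countType) (a : A) s :
  pickle (a :: s) = code_cons (pickle a) (pickle s).
Proof. by rewrite /code_cons CodeSeq.codeK. Qed.

Lemma code_consK1 a n : code_hd (code_cons a n) = a.
Proof. by rewrite /code_hd CodeSeq.codeK. Qed.

Lemma code_consK2 a n : code_tl (code_cons a n) = n.
Proof. by rewrite /code_tl CodeSeq.codeK /= CodeSeq.decodeK. Qed.

Lemma pickle_fst (A B : countType) (p : A * B) : code_hd (pickle p) = pickle p.1.
Proof. by case: p => a b; rewrite pickle_pair code_consK1. Qed.

Lemma pickle_snd (A B : countType) (p : A * B) :
  code_hd (code_tl (pickle p)) = pickle p.2.
Proof. by case: p => a b; rewrite pickle_pair code_consK2 code_consK1. Qed.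

Lemma pickle_bool (b : bool) : pickle b = b.
Proof. by []. Qed.

Lemma pickle_inl (A B : countType) (a : A) :
  pickle (inl a : A + B) = code_cons (code_cons (pickle a) 0) (code_cons 0 0).
Proof. by rewrite /code_cons !CodeSeq.codeK. Qed.

Lemma pickle_inr (A B : countType) (b : B) :
  pickle (inr b : A + B) = code_cons 0 (code_cons (code_cons (pickle b) 0) 0).
Proof. by rewrite /code_cons !CodeSeq.codeK. Qed.

Lemma raw_pair k f g : raw k f -> raw k g ->
  raw k (fun v => code_cons (f v) (code_cons (g v) 0)).
Proof.
move=> rf rg; apply: raw_app2 raw_cons rf _.
exact: raw_app2 raw_cons rg (raw_zero _).
Qed.

Lemma Cmp_ext (X T : countType) (f g : X -> T) : f =1 g -> Cmp f -> Cmp g.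
Proof. by move=> e [c [rc cE]]; exists c; split=> // x; rewrite cE e. Qed.

Lemma Cmp_id (X : countType) : Cmp (fun x : X => x).
Proof. by exists id; split=> //; apply: raw_proj. Qed.

Lemma Cmp_const (X T : countType) (t : T) : Cmp (fun _ : X => t).
Proof. by exists (fun _ => pickle t); split=> //; apply: raw_const. Qed.

Lemma Cmp_comp (X Y T : countType) (g : Y -> T) (f : X -> Y) :
  Cmp g -> Cmp f -> Cmp (fun x => g (f x)).
Proof.
move=> [cg [rg gE]] [cf [rf fE]]; exists (fun n => cg (cf n)); split.
  exact: raw_app1 rg rf.
by move=> x; rewrite fE gE.
Qed.

Section Combinators.
Variables (X A B : countType).

Lemma Cmp_pair (f : X -> A) (g : X -> B) :
  Cmp f -> Cmp g -> Cmp (fun x => (f x, g x)).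
Proof.
move=> [cf [rf fE]] [cg [rg gE]].
exists (fun n => code_cons (cf n) (code_cons (cg n) 0)); split.
  exact: raw_pair.
by move=> x; rewrite pickle_pair fE gE.
Qed.

Lemma Cmp_fst (f : X -> A * B) : Cmp f -> Cmp (fun x => (f x).1).
Proof.
apply: Cmp_comp; exists code_hd; split; [exact: raw_hd | exact: pickle_fst].
Qed.

Lemma Cmp_snd (f : X -> A * B) : Cmp f -> Cmp (fun x => (f x).2).
Proof.
apply: Cmp_comp; exists (fun n => code_hd (code_tl n)).
by split; [exact: raw_app1 raw_hd raw_tl | exact: pickle_snd].
Qed.

Lemma Cmp_inl (f : X -> A) : Cmp f -> Cmp (fun x => inl (f x) : A + B).
Proof.
apply: Cmp_comp; exists (fun n => code_cons (code_cons n 0) (code_cons 0 0)).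
split=> [|a]; last by rewrite pickle_inl.
apply: raw_app2 raw_cons _ (raw_const _ _).
exact: raw_app2 raw_cons (raw_proj _ _) (raw_const _ _).
Qed.

Lemma Cmp_inr (f : X -> B) : Cmp f -> Cmp (fun x => inr (f x) : A + B).
Proof.
apply: Cmp_comp; exists (fun n => code_cons 0 (code_cons (code_cons n 0) 0)).
split=> [|a]; last by rewrite pickle_inr.
apply: raw_pair (raw_const _ _) _.
exact: raw_app2 raw_cons (raw_proj _ _) (raw_const _ _).
Qed.

Lemma Cmp_succ (f : X -> nat) : Cmp f -> Cmp (fun x => (f x).+1).
Proof.
by move=> [c [rc cE]]; exists (fun n => (c n).+1); split;
  [exact: raw_succ | move=> x; rewrite cE].
Qed.

Lemma Cmp_eq (f g : X -> A) : Cmp f -> Cmp g -> Cmp (fun x => f x == g x).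
Proof.
move=> [cf [rf fE]] [cg [rg gE]]; exists (fun n => cf n == cg n); split.
  exact: (@raw_app2 _ (fun m n => m == n) _ _ raw_eq rf rg).
move=> x; rewrite pickle_bool fE gE; congr nat_of_bool.
exact: (inj_eq (pcan_inj pickleK)).
Qed.

Lemma Cmp_nat_rect (b : X -> A) (s : X -> nat -> A -> A) (n : X -> nat) :
  Cmp b -> Cmp (fun p : X * (nat * A) => s p.1 p.2.1 p.2.2) -> Cmp n ->
  Cmp (fun x => nat_rect (fun _ => A) (b x) (s x) (n x)).
Proof.
move=> [cb [rb bE]] [cs [rs sE]] [cn [rn nE]].
pose S v := cs (code_cons (nth 0 v 2) (code_cons
  (code_cons (nth 0 v 0) (code_cons (nth 0 v 1) 0)) 0)).
exists (fun m => nat_rect (fun _ => nat) (cb m)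
  (fun i acc => S [:: i; acc; m]) (cn m)); split.
  apply: (raw_ext _ (@raw_rec 1 _ S _ rb _ rn)) => [[|m []] //|].
  by apply: raw_app1 rs _; apply: raw_pair; rewrite ?raw_pair //;
    do ?apply: raw_pair; apply: raw_proj.
move=> x; rewrite bE nE /=; have -> : pickle (n x) = n x by [].
elim: (n x) => //= i ->; set acc := nat_rect _ _ _ _.
by rewrite -(sE (x, (i, acc))) !pickle_pair.
Qed.

Lemma Cmp_foldr (h : X -> A -> B -> B) (b : X -> B) (l : X -> seq A) :
  Cmp (fun p : X * (A * B) => h p.1 p.2.1 p.2.2) -> Cmp b -> Cmp l ->
  Cmp (fun x => foldr (h x) (b x) (l x)).
Proof.
move=> [ch [rh hE]] [cb [rb bE]] [cl [rl lE]].
pose L v := cl (nth 0 v 2).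
(* [foldr] starts from the last entry while the recursion counts upwards: its step [i] consumes the
   entry at index [size - i.+1]. *)
pose S v := ch (code_cons (nth 0 v 2) (code_cons (code_cons
   (nth 0 (CodeSeq.decode (L v)) (size (CodeSeq.decode (L v)) - (nth 0 v 0).+1))
   (code_cons (nth 0 v 1) 0)) 0)).
have rsz k f : raw k f -> raw k (fun v => size (CodeSeq.decode (f v))).
  by apply: (@raw_app1 k (fun n => size (CodeSeq.decode n))); apply: raw_size.
exists (fun m => nat_rect (fun _ => nat) (cb m)
  (fun i acc => S [:: i; acc; m]) (size (CodeSeq.decode (cl m)))); split.
  apply: (raw_ext _ (@raw_rec 1 _ S _ rb _ (rsz _ _ rl))) => [[|m []] //|].
  have rL : raw 3 L by apply: raw_app1 rl (raw_proj _ _).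
  apply: raw_app1 rh _; apply: raw_pair; first exact: raw_proj.
  apply: raw_pair; last exact: raw_proj.
  apply: (@raw_app2 _ (fun n i => nth 0 (CodeSeq.decode n) i) _ _ raw_nth rL _).
  exact: raw_app2 raw_sub (rsz _ _ rL) (raw_succ (raw_proj _ _)).
move=> x; rewrite bE; set m := pickle x.
have dE : CodeSeq.decode (cl m) = map pickle (l x).
  by rewrite lE CodeSeq.codeK.
rewrite dE size_map -[in RHS](drop0 (l x)) -(subnn (size (l x))).
(* After [i] steps the accumulator is the fold over the last [i] entries. *)
elim: {1 3 5}(size (l x)) (leqnn (size (l x))) => [|i IH] im /=.
  by rewrite subn0 drop_size.
rewrite IH 1?ltnW // /S /L /= dE size_map.
have lt : size (l x) - i.+1 < size (l x) by rewrite ltn_subrL /=; apply: leq_ltn_trans im.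
case E: (l x) lt im => [|a0 s] //; rewrite -E => lt im.
rewrite (nth_map a0) // (drop_nth a0 lt) /= subnSK //.
set acc := foldr _ _ _; set a := nth _ _ _.
by rewrite -(hE (x, (a, acc))) !pickle_pair.
Qed.

Lemma Cmp_cons (f : X -> A) (s : X -> seq A) :
  Cmp f -> Cmp s -> Cmp (fun x => f x :: s x).
Proof.
move=> [cf [rf fE]] [cg [rg gE]]; exists (fun n => code_cons (cf n) (cg n)).
by split=> [|x]; [exact: raw_app2 raw_cons rf rg | rewrite pickle_cons fE gE].
Qed.

Lemma Cmp_behead (s : X -> seq A) : Cmp s -> Cmp (fun x => behead (s x)).
Proof.
apply: Cmp_comp; exists code_tl; split; first exact: raw_tl.
by move=> [|a t] //; rewrite pickle_cons code_consK2.
Qed.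

Lemma Cmp_if (b : X -> bool) (f g : X -> A) : Cmp b -> Cmp f -> Cmp g ->
  Cmp (fun x => if b x then f x else g x).
Proof.
move=> [cb [rb bE]] [cf [rf fE]] [cg [rg gE]].
exists (fun n => cb n * cf n + (1 - cb n) * cg n); split; last first.
  by move=> x; rewrite bE fE gE; case: (b x); rewrite ?mul1n ?mul0n ?addn0.
apply: raw_app2 raw_add _ _; first exact: raw_app2 raw_mul rb rf.
apply: raw_app2 raw_mul _ rg; exact: raw_app2 raw_sub (raw_const _ _) rb.
Qed.

Lemma Cmp_pickle (f : X -> A) : Cmp f -> Cmp (fun x => pickle (f x)).
Proof. by case=> c [rc cE]; exists c; split. Qed.

End Combinators.

Lemma Cmp_sum (X A B C : countType) (f : X -> A -> C) (g : X -> B -> C) (s : X -> A + B) :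
  Cmp (fun p : X * A => f p.1 p.2) -> Cmp (fun p : X * B => g p.1 p.2) -> Cmp s ->
  Cmp (fun x => match s x with inl a => f x a | inr b => g x b end).
Proof.
move=> [cf [rf fE]] [cg [rg gE]] [cs [rs sE]].
pose F n := cf (code_cons n (code_cons (code_hd (code_hd (cs n))) 0)).
pose G n := cg (code_cons n (code_cons (code_hd (code_hd (code_tl (cs n)))) 0)).
(* An element of a sum is coded as a pair of lists of length at most one, the first of which is
   nonempty exactly for [inl]. Its code is [0] when it is empty, so the test recognises [inr]. *)
exists (fun n => (code_hd (cs n) == 0) * G n + (1 - (code_hd (cs n) == 0)) * F n).
have rsh := raw_app1 raw_hd rs.
split.
  apply: raw_app2 raw_add _ _; apply: raw_app2 raw_mul _ _.
  - exact: raw_isz.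
  - apply: raw_app1 rg _; apply: raw_pair; first exact: raw_proj.
    exact: raw_app1 raw_hd (raw_app1 raw_hd (raw_app1 raw_tl rs)).
  - exact: raw_app2 raw_sub (raw_const _ _) (raw_isz rsh).
  - apply: raw_app1 rf _; apply: raw_pair; first exact: raw_proj.
    exact: raw_app1 raw_hd rsh.
move=> x; rewrite /F /G sE; case: (s x) => [a|b].
  have /negbTE -> : code_hd (pickle (inl a : A + B)) != 0.
    by rewrite pickle_inl code_consK1 /code_cons /= muln_eq0 expn_eq0.
  by rewrite mul0n mul1n pickle_inl !code_consK1 -pickle_pair fE.
by rewrite pickle_inr !code_consK1 eqxx mul1n addn0 code_consK2 !code_consK1 -pickle_pair gE.
Qed.

Create HintDb cmp.
#[local] Hint Extern 0 (Cmp (fun x => x)) => apply: Cmp_id : cmp.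
#[local] Hint Extern 0 (Cmp (fun _ => _)) => apply: Cmp_const : cmp.
(* [apply:] leaves goals on eta-reduced functions, on which no pattern below matches. *)
#[local] Hint Extern 2 (@Cmp ?X ?T ?f) =>
  (lazymatch f with (fun _ => _) => fail | _ => change (@Cmp X T (fun x => f x)) end) : cmp.
#[local] Hint Extern 1 (Cmp (fun x => fst _)) => apply: Cmp_fst : cmp.
#[local] Hint Extern 1 (Cmp (fun x => snd _)) => apply: Cmp_snd : cmp.
#[local] Hint Extern 1 (Cmp (fun x => (_, _))) => apply: Cmp_pair : cmp.
#[local] Hint Extern 1 (Cmp (fun x => inl _)) => apply: Cmp_inl : cmp.
#[local] Hint Extern 1 (Cmp (fun x => inr _)) => apply: Cmp_inr : cmp.
#[local] Hint Extern 1 (Cmp (fun x => S _)) => apply: Cmp_succ : cmp.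
#[local] Hint Extern 1 (Cmp (fun x => _ == _)) => apply: Cmp_eq : cmp.
#[local] Hint Extern 1 (Cmp (fun x => _ :: _)) => apply: Cmp_cons : cmp.
#[local] Hint Extern 1 (Cmp (fun x => nat_rect _ _ _ _)) => apply: Cmp_nat_rect : cmp.
#[local] Hint Extern 1 (Cmp (fun x => foldr _ _ _)) => apply: Cmp_foldr : cmp.
#[local] Hint Extern 1 (Cmp (fun x => behead _)) => apply: Cmp_behead : cmp.
#[local] Hint Extern 1 (Cmp (fun x => if _ then _ else _)) => apply: Cmp_if : cmp.
#[local] Hint Extern 1 (Cmp (fun x => pickle _)) => apply: Cmp_pickle : cmp.
#[local] Hint Extern 1 (Cmp (fun x => match _ with inl _ => _ | inr _ => _ end)) => apply: Cmp_sum : cmp.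
Ltac cmp := cbv beta; solve [auto 200 with nocore cmp].

Section Derived.
Variables (X A B : countType).

Lemma Cmp_neg (b : X -> bool) : Cmp b -> Cmp (fun x => ~~ b x).
Proof.
by move=> cb; apply: (@Cmp_ext _ _ (fun x => if b x then false else true)); [move=> x; case: (b x) | cmp].
Qed.

Lemma Cmp_and (b c : X -> bool) : Cmp b -> Cmp c -> Cmp (fun x => b x && c x).
Proof. by move=> cb cc; rewrite /andb; cmp. Qed.

Lemma Cmp_or (b c : X -> bool) : Cmp b -> Cmp c -> Cmp (fun x => b x || c x).
Proof. by move=> cb cc; rewrite /orb; cmp. Qed.

Lemma Cmp_implb (b c : X -> bool) : Cmp b -> Cmp c -> Cmp (fun x => b x ==> c x).
Proof. by move=> cb cc; rewrite /implb; cmp. Qed.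

Lemma Cmp_map (f : X -> A -> B) (s : X -> seq A) :
  Cmp (fun p : X * A => f p.1 p.2) -> Cmp s -> Cmp (fun x => [seq f x a | a <- s x]).
Proof.
move=> cf cs; apply: (@Cmp_ext _ _ (fun x => foldr (fun a t => f x a :: t) [::] (s x))).
  by move=> x; elim: (s x) => //= a t ->.
have c : Cmp (fun p : X * (A * seq B) => f p.1 p.2.1).
  by apply: (@Cmp_comp _ _ _ _ (fun p : X * (A * seq B) => (p.1, p.2.1)) cf); cmp.
cmp.
Qed.

Lemma Cmp_has (a : X -> A -> bool) (s : X -> seq A) :
  Cmp (fun p : X * A => a p.1 p.2) -> Cmp s -> Cmp (fun x => has (a x) (s x)).
Proof.
move=> cf cs; apply: (@Cmp_ext _ _ (fun x => foldr (fun y t => if a x y then true else t) false (s x))).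
  by move=> x; elim: (s x) => //= y t ->.
have c : Cmp (fun p : X * (A * bool) => a p.1 p.2.1).
  by apply: (@Cmp_comp _ _ _ _ (fun p : X * (A * bool) => (p.1, p.2.1)) cf); cmp.
cmp.
Qed.

Lemma Cmp_all (a : X -> A -> bool) (s : X -> seq A) :
  Cmp (fun p : X * A => a p.1 p.2) -> Cmp s -> Cmp (fun x => all (a x) (s x)).
Proof.
move=> cf cs; apply: (@Cmp_ext _ _ (fun x => foldr (fun y t => if a x y then t else false) true (s x))).
  by move=> x; elim: (s x) => //= y t ->.
have c : Cmp (fun p : X * (A * bool) => a p.1 p.2.1).
  by apply: (@Cmp_comp _ _ _ _ (fun p : X * (A * bool) => (p.1, p.2.1)) cf); cmp.
cmp.
Qed.

Lemma Cmp_cat (s t : X -> seq A) : Cmp s -> Cmp t -> Cmp (fun x => s x ++ t x).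
Proof.
move=> cs ct; apply: (@Cmp_ext _ _ (fun x => foldr (fun y t => y :: t) (t x) (s x))).
  by move=> x; elim: (s x) => //= y u ->.
cmp.
Qed.

End Derived.
#[local] Hint Extern 1 (Cmp (fun x => ~~ _)) => apply: Cmp_neg : cmp.
#[local] Hint Extern 1 (Cmp (fun x => _ && _)) => apply: Cmp_and : cmp.
#[local] Hint Extern 1 (Cmp (fun x => _ || _)) => apply: Cmp_or : cmp.
#[local] Hint Extern 1 (Cmp (fun x => _ ==> _)) => apply: Cmp_implb : cmp.
#[local] Hint Extern 1 (Cmp (fun x => map _ _)) => apply: Cmp_map : cmp.
#[local] Hint Extern 1 (Cmp (fun x => has _ _)) => apply: Cmp_has : cmp.
#[local] Hint Extern 1 (Cmp (fun x => all _ _)) => apply: Cmp_all : cmp.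
#[local] Hint Extern 1 (Cmp (fun x => _ ++ _)) => apply: Cmp_cat : cmp.

Section DerivedSeq.
Variables (X A : countType).

Lemma Cmp_flatten (s : X -> seq (seq A)) : Cmp s -> Cmp (fun x => flatten (s x)).
Proof.
move=> cs; apply: (@Cmp_foldr _ _ _ (fun _ t u => t ++ u)) => //; last exact: Cmp_const.
by apply: Cmp_cat; cmp.
Qed.

Lemma Cmp_mem (f : X -> A) (s : X -> seq A) :
  Cmp f -> Cmp s -> Cmp (fun x => f x \in s x).
Proof.
move=> cf cs; apply: (@Cmp_ext _ _ (fun x => has (fun y => y == f x) (s x))).
  by move=> x; rewrite has_pred1.
apply: Cmp_has => //; apply: Cmp_eq; first by cmp.
by apply: (Cmp_comp cf); cmp.
Qed.

Lemma Cmp_head (d : X -> A) (s : X -> seq A) :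
  Cmp d -> Cmp s -> Cmp (fun x => head (d x) (s x)).
Proof.
move=> cd cs; apply: (@Cmp_ext _ _ (fun x => foldr (fun y _ => y) (d x) (s x))).
  by move=> x; case: (s x).
cmp.
Qed.

Lemma Cmp_nth (d : X -> A) (s : X -> seq A) (i : X -> nat) :
  Cmp d -> Cmp s -> Cmp i -> Cmp (fun x => nth (d x) (s x) (i x)).
Proof.
move=> cd cs ci; apply: (@Cmp_ext _ _ (fun x =>
    head (d x) (nat_rect (fun _ => seq A) (s x) (fun _ t => behead t) (i x)))).
  move=> x; have -> : nat_rect (fun _ => seq A) (s x) (fun _ t => behead t) (i x) = drop (i x) (s x).
    by elim: (i x) => [|n /= ->]; rewrite ?drop0 // -drop1 drop_drop add1n.
  by rewrite -nth0 nth_drop addn0.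
by apply: Cmp_head => //; cmp.
Qed.

Lemma Cmp_iota (n : X -> nat) : Cmp n -> Cmp (fun x => iota 0 (n x)).
Proof.
move=> cn; apply: (@Cmp_ext _ _ (fun x =>
    nat_rect (fun _ => seq nat) [::] (fun i t => t ++ [:: i]) (n x))).
  by move=> x; elim: (n x) => //= i ->; rewrite -(iotaD 0 i 1) addn1.
apply: Cmp_nat_rect => //; [exact: Cmp_const | apply: Cmp_cat; cmp].
Qed.

End DerivedSeq.
#[local] Hint Extern 1 (Cmp (fun x => flatten _)) => apply: Cmp_flatten : cmp.
#[local] Hint Extern 1 (Cmp (fun x => head _ _)) => apply: Cmp_head : cmp.
#[local] Hint Extern 1 (Cmp (fun x => nth _ _ _)) => apply: Cmp_nth : cmp.
#[local] Hint Extern 1 (Cmp (fun x => iota 0 _)) => apply: Cmp_iota : cmp.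
#[local] Hint Extern 1 (Cmp (fun x => _ \in _)) => apply: Cmp_mem : cmp.

(** * Evaluation is deterministic *)

Section PevalInd.
Variable P : prf -> seq nat -> nat -> Prop.
Hypothesis Pzero : forall v, P PZero v 0.
Hypothesis Psucc : forall v, P PSucc v (head 0 v).+1.
Hypothesis Pproj : forall i v, P (PProj i) v (nth 0 v i).
Hypothesis Pcomp : forall f gs v ys z,
  List.Forall2 (fun g y => peval g v y /\ P g v y) gs ys ->
  peval f ys z -> P f ys z -> P (PComp f gs) v z.
Hypothesis Prec0 : forall f g v y, peval f v y -> P f v y -> P (PRec f g) (0 :: v) y.
Hypothesis PrecS : forall f g n v y z,
  peval (PRec f g) (n :: v) y -> P (PRec f g) (n :: v) y ->
  peval g (n :: y :: v) z -> P g (n :: y :: v) z -> P (PRec f g) (n.+1 :: v) z.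
Hypothesis Pmu : forall f v n, peval f (n :: v) 0 -> P f (n :: v) 0 ->
  (forall m, m < n -> exists k, peval f (m :: v) k.+1 /\ P f (m :: v) k.+1) ->
  P (PMu f) v n.

(** Induction that also yields hypotheses for the derivations nested in [List.Forall2] and under the
    existential quantifier of [ev_mu]. *)
Fixpoint peval_nested_ind c v z (e : peval c v z) {struct e} : P c v z.
Proof.
case: e => {c v z}.
- exact: Pzero.
- exact: Psucc.
- exact: Pproj.
- move=> f gs v ys z es ef; apply: (Pcomp _ ef); last exact: peval_nested_ind.
  elim: es => [|g y gs' ys' eg _ IH]; first by constructor.
  by constructor; [split; [exact: eg | exact: peval_nested_ind] | exact: IH].
- by move=> f g v y ef; apply: Prec0 => //; apply: peval_nested_ind.
- by move=> f g n v y z e1 e2; apply: (PrecS e1 _ e2); apply: peval_nested_ind.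
- move=> f v n e0 eS; apply: (Pmu e0); first exact: peval_nested_ind.
  by move=> m /eS [k ek]; exists k; split; [exact: ek | exact: peval_nested_ind].
Qed.
End PevalInd.

Lemma peval_mu_inv f v z : peval (PMu f) v z ->
  peval f (z :: v) 0 /\ forall m, m < z -> exists k, peval f (m :: v) k.+1.
Proof. by move=> e; inversion e. Qed.

Lemma peval_fun c v y z : peval c v y -> peval c v z -> y = z.
Proof.
move=> e; elim/peval_nested_ind: c v y / e z => [v z e|v z e|i v z e|f gs v ys y es _ IHf z e|f g v y _ IH z e|f g n v y z _ IHy _ IHz t e|f v n _ IH0 IHS z e].
- by inversion e.
- by inversion e.
- by inversion e.
- inversion e; subst; apply: IHf; suff -> : ys = ys0 by [].
  elim: es ys0 H1 {e H4} => [|g y' gs' ys' [_ IHg] _ IH] w ew; inversion ew; subst=> //.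
  by rewrite (IHg _ H1) (IH _ H3).
- by inversion e; subst; apply: IH.
- inversion e; subst; apply: IHz; match goal with H : peval (PRec f g) _ _ |- _ => by rewrite (IHy _ H) end.
(* Were the two minima distinct, [f] would be positive at the smaller one because of the larger one,
   and [0] there by its own minimality. *)
- have [z0 zS] := peval_mu_inv e; case: (ltngtP n z) => // [/zS [k /IH0] //|].
  by case/IHS=> k [_ /(_ _ z0)].
Qed.

(** * Decoding and unbounded search *)

Definition decodable (T : countType) :=
  exists2 d : nat -> T, cancel pickle d & Cmp d.

Lemma decodable_nat : decodable nat.
Proof. by exists id => //; apply: Cmp_id. Qed.

Lemma decodable_bool : decodable bool.
Proof. by exists (fun n => n == 1); [case | cmp]. Qed.

Lemma Cmp_decode (X : countType) (f : X -> nat) : Cmp f -> Cmp (fun x => CodeSeq.decode (f x)).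
Proof.
case=> c [rc cE]; exists c; split=> // x; rewrite cE.
rewrite [RHS](_ : _ = CodeSeq.code (map id (CodeSeq.decode (f x)))) //.
by rewrite map_id CodeSeq.decodeK.
Qed.
#[local] Hint Extern 1 (Cmp (fun x => CodeSeq.decode _)) => apply: Cmp_decode : cmp.

Lemma decodable_prod (A B : countType) : decodable A -> decodable B -> decodable (A * B)%type.
Proof.
move=> [d dK cd] [e eK ce].
exists (fun n => (d (nth 0 (CodeSeq.decode n) 0), e (nth 0 (CodeSeq.decode n) 1))).
  by move=> [a b]; rewrite pickle_pair /code_cons !CodeSeq.codeK /= dK eK.
by apply: Cmp_pair; [apply: (Cmp_comp cd) | apply: (Cmp_comp ce)]; cmp.
Qed.

Lemma decodable_seq (A : countType) : decodable A -> decodable (seq A).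
Proof.
move=> [d dK cd]; exists (fun n => map d (CodeSeq.decode n)).
  by move=> s; rewrite CodeSeq.codeK -map_comp map_id_in // => a _; apply: dK.
apply: (@Cmp_map _ _ _ (fun _ => d)); last by cmp.
by apply: (Cmp_comp cd); cmp.
Qed.

Lemma decodable_sum (A B : countType) : decodable A -> decodable B -> decodable (A + B)%type.
Proof.
move=> [d dK cd] [e eK ce].
pose l n i := CodeSeq.decode (nth 0 (CodeSeq.decode n) i).
exists (fun n => if l n 0 == [::] then inr (e (head 0 (l n 1))) else inl (d (head 0 (l n 0)))).
  move=> [a|b]; first by rewrite pickle_inl /l /code_cons !CodeSeq.codeK /= dK.
  by rewrite pickle_inr /l /code_cons !CodeSeq.codeK /= eK.
have cl i : Cmp (fun n => l n i) by rewrite /l; cmp.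
apply: Cmp_if; first by cmp.
  by apply: Cmp_inr; apply: (Cmp_comp ce); cmp.
by apply: Cmp_inl; apply: (Cmp_comp cd); cmp.
Qed.

(** A witness is searched for among all numbers, so the decoder is total: a number that codes
    nothing is still decoded to some element, and any element that passes the test is a witness.
    Determinism turns a value of the search program into a success of the test. *)
Lemma RE_exists (X : countType) (D : nat * X -> bool) :
  decodable X -> Cmp D -> RE (fun n => exists x, D (n, x)).
Proof.
move=> [d dK cd] cD.
have [c [rc cE]] : Cmp (fun q : nat * nat => ~~ D (q.1, d q.2)).
  apply: Cmp_neg; apply: (Cmp_comp cD); apply: Cmp_pair; first by cmp.
  by apply: (Cmp_comp cd); cmp.
have [p pP] := raw_app1 rc (raw_pair (@raw_proj 2 1) (@raw_proj 2 0)).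
have ev m n : peval p [:: m; n] (~~ D (n, d m)).
  by have := pP [:: m; n] erefl; rewrite /= -(pickle_pair n m) cE.
exists (PMu p) => n; split=> [[x Dx]|[y ey]]; last first.
  exists (d y); have [ey0 _] := peval_mu_inv ey.
  by have := peval_fun (ev y n) ey0; case: (D _).
have ex : exists m, D (n, d m) by exists (pickle x); rewrite dK.
case: (ex_minnP ex) => m Dm min; exists m; constructor.
  by have := ev m n; rewrite Dm.
move=> i im; exists 0; have := ev i n; case E: (D _) => //=.
by have := min _ E; rewrite leqNgt im.
Qed.

(** * Syntax and its codes *)

Definition asb (P : Prop) : bool := if excluded_middle_informative P then true else false.
Lemma asbP P : reflect P (asb P).
Proof. by rewrite /asb; case: excluded_middle_informative; constructor. Qed.

(* Every part of a datum has a code smaller than that of the datum, so that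
   [pickle Sigma] bounds all symbols, arities and variables of [Sigma]. *)
Lemma ltn_code_cons a n : (a < code_cons a n) /\ (n < code_cons a n).
Proof.
rewrite /code_cons /= CodeSeq.decodeK; split.
  by apply: leq_trans (ltn_expl a (ltnSn 1)) _; rewrite leq_pmulr.
apply: leq_trans (_ : _ <= n.*2.+1) _; first by rewrite ltnS -addnn leq_addr.
by rewrite leq_pmull ?expn_gt0.
Qed.

Lemma ltn_pickle_cons (T : countType) (x : T) s :
  (pickle x < pickle (x :: s)) /\ (pickle s < pickle (x :: s)).
Proof. by rewrite pickle_cons; apply: ltn_code_cons. Qed.

Lemma ltn_pickle_mem (T : countType) (x : T) (s : seq T) : x \in s -> pickle x < pickle s.
Proof.
elim: s => //= y s IH; have [l1 l2] := ltn_pickle_cons y s.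
by rewrite inE => /predU1P [-> //|/IH] /ltn_trans; apply.
Qed.

Lemma leq_size_pickle (T : countType) (s : seq T) : size s <= pickle s.
Proof.
by elim: s => //= y s IH; have [_] := ltn_pickle_cons y s; apply: leq_ltn_trans.
Qed.

Lemma ltn_pickle_pair (A B : countType) (p : A * B) :
  (pickle p.1 < pickle p) /\ (pickle p.2 < pickle p).
Proof.
case: p => a b; rewrite pickle_pair.
have [l1 l2] := ltn_code_cons (pickle a) (code_cons (pickle b) 0).
by have [l3 _] := ltn_code_cons (pickle b) 0; split=> //; apply: ltn_trans l2.
Qed.

Lemma ltn_pickle_inl (A B : countType) (a : A) : pickle a < pickle (inl a : A + B).
Proof.
rewrite pickle_inl; apply: ltn_trans (ltn_code_cons _ _).1.
exact: (ltn_code_cons _ _).1.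
Qed.

Lemma ltn_pickle_inr (A B : countType) (b : B) : pickle b < pickle (inr b : A + B).
Proof.
rewrite pickle_inr; apply: ltn_trans (ltn_code_cons _ _).2.
apply: ltn_trans (ltn_code_cons _ _).1; exact: (ltn_code_cons _ _).1.
Qed.

Definition aterms (a : atom) : seq term :=
  match a with inl p => p.2 | inr p => [:: p.1; p.2] end.

Lemma avarsE a : avars a = flatten (map tvars (aterms a)).
Proof. by case: a => [[R ts]|[t1 t2]] //=; rewrite cats0. Qed.

Lemma mem_avars x a : (x \in avars a) = (inl x \in aterms a).
Proof.
rewrite avarsE; apply/flatten_mapP/idP => [[[y|c] // ty]|xa].
  by rewrite inE => /eqP ->.
by exists (inl x); rewrite ?inE.
Qed.

Lemma ltn_pickle_aterms t a : t \in aterms a -> pickle t < pickle a.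
Proof.
case: a => [p|p] /=.
  move=> /ltn_pickle_mem /ltn_trans; apply.
  exact: ltn_trans (ltn_pickle_pair p).2 (ltn_pickle_inl _ _).
have [l1 l2] := ltn_pickle_pair p; have l3 := ltn_pickle_inr (nat * seq term)%type p.
by rewrite !inE => /orP [] /eqP ->; [apply: ltn_trans l1 _ | apply: ltn_trans l2 _].
Qed.

Definition ded_atoms (d : ded) : seq atom := ded_body d ++ flatten (ded_heads d).

Lemma ltn_pickle_atom a d : a \in ded_atoms d -> pickle a < pickle d.
Proof.
have [l1 l2] := ltn_pickle_pair d; have [_ l3] := ltn_pickle_pair d.1.
rewrite mem_cat => /orP [/ltn_pickle_mem /ltn_trans|/flattenP [psi pd]].
  by apply; apply: ltn_trans l1.
by move=> /ltn_pickle_mem /ltn_trans; apply; apply: ltn_trans l2; apply: ltn_pickle_mem.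
Qed.

Lemma ltn_pickle_var (Sigma : seq ded) d a x : d \in Sigma -> a \in ded_atoms d ->
  x \in avars a -> x < pickle Sigma.
Proof.
rewrite mem_avars => /(@ltn_pickle_mem _ d) l1 /ltn_pickle_atom l2 /ltn_pickle_aterms l3.
have l4 : x < pickle (inl x : term) := ltn_pickle_inl _ _.
by do ![exact: l1 | apply: ltn_trans l2 _ | apply: ltn_trans l3 _ | apply: ltn_trans l4 _].
Qed.

Lemma ltn_pickle_const (Sigma : seq ded) d a c : d \in Sigma -> a \in ded_atoms d ->
  inr c \in aterms a -> c < pickle Sigma.
Proof.
move=> /(@ltn_pickle_mem _ d) l1 /ltn_pickle_atom l2 /ltn_pickle_aterms l3.
have l4 : c < pickle (inr c : term) := ltn_pickle_inr _ _.
by do ![exact: l1 | apply: ltn_trans l2 _ | apply: ltn_trans l3 _ | apply: ltn_trans l4 _].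
Qed.

Lemma ltn_pickle_rel (Sigma : seq ded) d R ts : d \in Sigma -> inl (R, ts) \in ded_atoms d ->
  (R < pickle Sigma) /\ (size ts < pickle Sigma).
Proof.
move=> /(@ltn_pickle_mem _ d) l1 /ltn_pickle_atom l2.
have l3 := ltn_pickle_inl (term * term)%type (R, ts).
have [l4 l5] := ltn_pickle_pair (R, ts); have l6 := leq_size_pickle ts.
have l := ltn_trans l3 (ltn_trans l2 l1).
by split; [apply: ltn_trans l4 l | apply: leq_ltn_trans l6 (ltn_trans l5 l)].
Qed.

Lemma body_ded_atoms d a : a \in ded_body d -> a \in ded_atoms d.
Proof. by rewrite mem_cat => ->. Qed.

Lemma head_ded_atoms d psi a : psi \in ded_heads d -> a \in psi -> a \in ded_atoms d.
Proof.
by move=> pd ap; rewrite mem_cat; apply/orP; right; apply/flattenP; exists psi.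
Qed.

Lemma holds_ext (S : structure) (v w : nat -> S) a :
  (forall x, x \in avars a -> v x = w x) -> holds v a <-> holds w a.
Proof.
move=> e; have te t : t \in aterms a -> teval v t = teval w t.
  by case: t => //= x ta; apply: e; rewrite mem_avars.
case: a te {e} => [[R ts]|[t1 t2]] te /=.
  by suff -> : map (teval v) ts = map (teval w) ts by []; apply/eq_in_map.
by rewrite (te t1) ?(te t2) ?inE ?eqxx ?orbT.
Qed.

Lemma holds_prod (A B : structure) (v : nat -> prod_structure A B) a :
  holds v a <-> holds (S := A) (fun x => (v x).1) a /\ holds (S := B) (fun x => (v x).2) a.
Proof.
have t1 t : (teval v t).1 = teval (S := A) (fun x => (v x).1) t by case: t.
have t2 t : (teval v t).2 = teval (S := B) (fun x => (v x).2) t by case: t.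
case: a => [[R ts]|[s t]] /=.
  rewrite -!map_comp; have -> : map (fst \o teval v) ts = map (teval (S := A) (fun x => (v x).1)) ts.
    exact: eq_map.
  by have -> : map (snd \o teval v) ts = map (teval (S := B) (fun x => (v x).2)) ts by exact: eq_map.
rewrite -!t1 -!t2; split=> [-> //|].
by case: (teval v s) (teval v t) => [? ?] [? ?] /= [-> ->].
Qed.

Definition wfb (d : ded) : bool :=
  [&& ~~ (ded_heads d == [::]),
      all (fun a => all (fun x => ~~ (x \in ded_exvars d)) (avars a)) (ded_body d) &
      all (fun psi => all (fun a => all (fun x => (x \in ded_exvars d)
        || (x \in relvars (ded_body d))) (avars a)) psi) (ded_heads d)].

Lemma wfP d : reflect (wf_ded d) (wfb d).
Proof.
apply: (iffP and3P) => [[h1 /allP h2 /allP h3]|[h1 h2 h3]]; split=> //.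
- by move=> a x /h2 /allP h /h.
- by move=> psi a x /h3 /allP h /h /allP h' /h' /orP [-> //|].
- by apply/allP => a ab; apply/allP => x; apply: h2.
- apply/allP => psi pd; apply/allP => a ap; apply/allP => x xa.
  by case E: (x \in ded_exvars d) => //=; apply: h3 pd ap xa _; rewrite ?E.
Qed.

Lemma Cmp_aterms (X : countType) (a : X -> atom) : Cmp a -> Cmp (fun x => aterms (a x)).
Proof. by move=> ca; rewrite /aterms; apply: Cmp_sum; cmp. Qed.
#[local] Hint Extern 1 (Cmp (fun x => aterms _)) => apply: Cmp_aterms : cmp.

Lemma Cmp_avars (X : countType) (a : X -> atom) : Cmp a -> Cmp (fun x => avars (a x)).
Proof.
move=> ca; apply: (Cmp_ext (f := fun x => flatten (map tvars (aterms (a x))))).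
  by move=> x; rewrite avarsE.
cmp.
Qed.
#[local] Hint Extern 1 (Cmp (fun x => avars _)) => apply: Cmp_avars : cmp.

Lemma Cmp_relvars (X : countType) (s : X -> seq atom) : Cmp s -> Cmp (fun x => relvars (s x)).
Proof.
move=> cs; apply: (Cmp_ext (f := fun x => flatten (map (fun a : atom =>
   match a with inl p => flatten (map tvars p.2) | inr _ => [::] end) (s x)))).
  by move=> x; congr flatten; apply: eq_map => -[[]|[]].
apply: Cmp_flatten; apply: Cmp_map => //; apply: Cmp_sum; cmp.
Qed.
#[local] Hint Extern 1 (Cmp (fun x => relvars _)) => apply: Cmp_relvars : cmp.

Lemma Cmp_exvars (X : countType) (d : X -> ded) : Cmp d -> Cmp (fun x => ded_exvars (d x)).
Proof. by rewrite /ded_exvars => cd; cmp. Qed.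
Lemma Cmp_body (X : countType) (d : X -> ded) : Cmp d -> Cmp (fun x => ded_body (d x)).
Proof. by rewrite /ded_body => cd; cmp. Qed.
Lemma Cmp_heads (X : countType) (d : X -> ded) : Cmp d -> Cmp (fun x => ded_heads (d x)).
Proof. by rewrite /ded_heads => cd; cmp. Qed.
#[local] Hint Extern 1 (Cmp (fun x => ded_exvars _)) => apply: Cmp_exvars : cmp.
#[local] Hint Extern 1 (Cmp (fun x => ded_body _)) => apply: Cmp_body : cmp.
#[local] Hint Extern 1 (Cmp (fun x => ded_heads _)) => apply: Cmp_heads : cmp.

Lemma Cmp_wfb (X : countType) (d : X -> ded) : Cmp d -> Cmp (fun x => wfb (d x)).
Proof.
by apply: Cmp_comp; rewrite /wfb; cmp.
Qed.
#[local] Hint Extern 1 (Cmp (fun x => wfb _)) => apply: Cmp_wfb : cmp.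

(** * Non-preservation in the finite is recursively enumerable *)

Definition asgs (T : Type) (dom : seq T) (m : nat) : seq (seq T) :=
  nat_rect (fun _ => seq (seq T)) [:: [::]]
    (fun _ ss => flatten [seq [seq a :: s | s <- ss] | a <- dom]) m.

Lemma mem_asgs (T : eqType) (dom : seq T) m s :
  (s \in asgs dom m) = (size s == m) && all (fun x => x \in dom) s.
Proof.
elim: m s => [|m IH] [|a s] //=.
- apply/flatten_mapP => -[b _ /mapP [t _]] //.
- rewrite eqSS; apply/flatten_mapP/and3P => [[b bd /mapP [t]]|[sm ad sd]].
    by rewrite IH => /andP [st td] [-> ->].
  by exists a => //; apply: map_f; rewrite IH sm.
Qed.

Lemma Cmp_asgs (X T : countType) (dom : X -> seq T) (m : X -> nat) :
  Cmp dom -> Cmp m -> Cmp (fun x => asgs (dom x) (m x)).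
Proof.
move=> cd cm; rewrite /asgs; apply: Cmp_nat_rect; [cmp| |by []].
apply: Cmp_flatten; apply: Cmp_map; last by apply: (Cmp_comp cd); cmp.
cmp.
Qed.
#[local] Hint Extern 1 (Cmp (fun x => asgs _ _)) => apply: Cmp_asgs : cmp.

(** Model checking with lists of length [m] over [dom] as assignments. The type [T] of names is left
    open so that single structures, with [T = nat], and products, with pairs, are treated alike. *)
Definition satb (T : eqType) (t0 : T) (dom : seq T) (hold : seq T -> atom -> bool)
    (m : nat) (d : ded) : bool :=
  all (fun h => all (hold h) (ded_body d) ==>
    has (fun psi => has (fun h' =>
        all (fun z => (z \in ded_exvars d) || (nth t0 h' z == nth t0 h z)) (iota 0 m)
        && all (hold h') psi) (asgs dom m)) (ded_heads d)) (asgs dom m).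

Lemma Cmp_satb (X T : countType) (t0 : T) (dom : X -> seq T)
    (hold : X -> seq T -> atom -> bool) (m : X -> nat) (d : X -> ded) :
  Cmp dom -> Cmp (fun p : X * (seq T * atom) => hold p.1 p.2.1 p.2.2) -> Cmp m -> Cmp d ->
  Cmp (fun x => satb t0 (dom x) (hold x) (m x) (d x)).
Proof.
move=> cdom chold cm cd; rewrite /satb.
have H (Y : countType) (x : Y -> X) h a : Cmp x -> Cmp h -> Cmp a ->
    Cmp (fun y => hold (x y) (h y) (a y)).
  by move=> cx ch ca; apply: (Cmp_comp chold (f := fun y => (x y, (h y, a y)))); cmp.
have D1 (Y : countType) (x : Y -> X) : Cmp x -> Cmp (fun y => d (x y)) by apply: Cmp_comp.
have D2 (Y : countType) (x : Y -> X) : Cmp x -> Cmp (fun y => dom (x y)) by apply: Cmp_comp.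
have D3 (Y : countType) (x : Y -> X) : Cmp x -> Cmp (fun y => m (x y)) by apply: Cmp_comp.
apply: Cmp_all; last by cmp.
apply: Cmp_implb.
  by apply: Cmp_all; [apply: H; cmp | apply: Cmp_body; apply: D1; cmp].
apply: Cmp_has; last by apply: Cmp_heads; apply: D1; cmp.
apply: Cmp_has; last by apply: Cmp_asgs; [apply: D2 | apply: D3]; cmp.
apply: Cmp_and; last by apply: Cmp_all; [apply: H; cmp | cmp].
apply: Cmp_all; last by apply: Cmp_iota; apply: D3; cmp.
apply: Cmp_or; last by cmp.
by apply: Cmp_mem; [cmp | apply: Cmp_exvars; apply: D1; cmp].
Qed.

Lemma nth_asgs_mem (T : eqType) t0 (dom : seq T) m h x :
  t0 \in dom -> h \in asgs dom m -> nth t0 h x \in dom.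
Proof.
move=> d0; rewrite mem_asgs => /andP [_ /allP hd].
case: (ltnP x (size h)) => [lt|ge]; last by rewrite nth_default.
exact/hd/mem_nth.
Qed.

(** The map [e] names the elements of [S] by members of [dom]. A name for every element is enough,
    as [hold] already interprets equations in [S]. *)
Lemma satbP (S : structure) (T : eqType) (t0 : T) (e : T -> S)
    (dom : seq T) (hold : seq T -> atom -> bool) m d :
  t0 \in dom -> (forall x : S, exists2 t, t \in dom & e t = x) ->
  (forall a x, a \in ded_atoms d -> x \in avars a -> x < m) ->
  (forall h a, h \in asgs dom m -> a \in ded_atoms d ->
     hold h a <-> holds (fun x => e (nth t0 h x)) a) ->
  satb t0 dom hold m d <-> sat_ded S d.
Proof.
move=> d0 esurj bd holdP.
have [pre preP] : exists pre : S -> T, forall x, pre x \in dom /\ e (pre x) = x.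
  exists (fun x => sval (constructive_indefinite_description _
    (let: ex_intro2 t td et := esurj x in ex_intro _ t (conj td et)))) => x.
  by case: constructive_indefinite_description.
have mk v : mkseq (pre \o v) m \in asgs dom m.
  rewrite mem_asgs size_mkseq eqxx; apply/allP => t /mapP [x _ ->].
  exact: (preP _).1.
have mkE v x : x < m -> e (nth t0 (mkseq (pre \o v) m) x) = v x.
  by move=> xm; rewrite nth_mkseq //; apply: (preP _).2.
split=> [/allP sat v body|sat].
- have /sat /implyP imp := mk v; set h := mkseq _ _ in imp.
  have /imp : all (hold h) (ded_body d).
    apply/allP => a ab; have ad := body_ded_atoms ab.
    apply/(holdP _ _ (mk v) ad)/(holds_ext (w := v)); last exact: body.
    by move=> x xa; apply/mkE/(bd _ _ ad xa).
  move=> /hasP [psi pd /hasP [h' h'm /andP [/allP agr /allP hpsi]]]; exists psi => //.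
  (* From position [m] on, [h'] only returns the default, so it is followed on the existential
     variables alone. *)
  exists (fun z => if z \in ded_exvars d then e (nth t0 h' z) else v z).
  split=> [z /negbTE -> //|a ap]; have ad := head_ded_atoms pd ap.
  apply/(holds_ext (w := fun x => e (nth t0 h' x))); last first.
    by apply/(holdP _ _ h'm ad)/hpsi.
  move=> x xa; case: ifP => // xe; have xm := bd _ _ ad xa.
  have := agr x; rewrite mem_iota /= xe => /(_ xm) /eqP ->.
  by rewrite mkE.
- apply/allP => h hm; apply/implyP => /allP body.
  have [|psi pd [v' [agr hpsi]]] := sat (fun x => e (nth t0 h x)).
    by move=> a ab; apply/(holdP _ _ hm (body_ded_atoms ab))/body.
  apply/hasP; exists psi => //.
  (* The other positions keep the very names of [h], since [satb] compares names and not the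
     elements they denote. *)
  pose h' := mkseq (fun z => if z \in ded_exvars d then pre (v' z) else nth t0 h z) m.
  have h'm : h' \in asgs dom m.
    rewrite mem_asgs size_mkseq eqxx; apply/allP => t /mapP [x _ ->].
    by case: ifP => _; [apply: (preP _).1 | apply: nth_asgs_mem hm].
  apply/hasP; exists h' => //; apply/andP; split; apply/allP.
    move=> z; rewrite mem_iota /= => zm.
    by case E: (z \in ded_exvars d) => //=; rewrite nth_mkseq // E.
  move=> a ap; have ad := head_ded_atoms pd ap; apply/(holdP _ _ h'm ad).
  apply/(holds_ext (w := v')); last exact: hpsi.
  move=> x xa; have xm := bd _ _ ad xa; rewrite nth_mkseq //.
  by case: ifP => [_|/negbT /agr //]; rewrite (preP _).2.
Qed.

(* A finite structure on [0..N] is coded by [N], the list of the values of the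
   constants, and the list of its relational facts. *)
Definition fcode := (nat * seq nat * seq (nat * seq nat))%type.

Definition ftm (A : fcode) (h : seq nat) (t : term) : nat :=
  match t with inl x => nth 0 h x | inr c => nth 0 A.1.2 c end.

Definition fhold (A : fcode) (h : seq nat) (a : atom) : bool :=
  match a with
  | inl p => (p.1, [seq ftm A h t | t <- p.2]) \in A.2
  | inr p => ftm A h p.1 == ftm A h p.2
  end.

Definition fdom (A : fcode) : seq nat := iota 0 A.1.1.+1.

Definition fwf (A : fcode) : bool := all (fun c => c \in fdom A) A.1.2.

Definition fmodels (A : fcode) (m : nat) (Sigma : seq ded) : bool :=
  all (fun d => satb 0 (fdom A) (fhold A) m d) Sigma.

Definition pdom (A B : fcode) : seq (nat * nat) :=
  flatten [seq [seq (a, b) | b <- fdom B] | a <- fdom A].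

Definition phold (A B : fcode) (h : seq (nat * nat)) (a : atom) : bool :=
  fhold A [seq q.1 | q <- h] a && fhold B [seq q.2 | q <- h] a.

(** The complement of the problem contains the numbers that code no set of well-formed dependencies,
    for which any certificate will do. For the other numbers the certificate is a pair of coded
    models whose product violates a dependency. *)
Definition fcheck (p : nat * (fcode * fcode)) (m : nat) (Sigma : seq ded) : bool :=
  [|| ~~ (pickle Sigma == p.1), ~~ all wfb Sigma |
    [&& fwf p.2.1, fwf p.2.2, fmodels p.2.1 m Sigma, fmodels p.2.2 m Sigma &
        has (fun d => ~~ satb (0, 0) (pdom p.2.1 p.2.2) (phold p.2.1 p.2.2) m d) Sigma]].

Lemma Cmp_ftm (X : countType) (A : X -> fcode) (h : X -> seq nat) (t : X -> term) :
  Cmp A -> Cmp h -> Cmp t -> Cmp (fun x => ftm (A x) (h x) (t x)).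
Proof.
move=> cA ch ct; rewrite /ftm; apply: Cmp_sum => //; apply: Cmp_nth; try cmp.
  by apply: (Cmp_comp ch); cmp.
by apply: (@Cmp_comp _ _ _ (fun a : fcode => a.1.2)); [cmp | apply: (Cmp_comp cA); cmp].
Qed.

Lemma Cmp_fhold (X : countType) (A : X -> fcode) (h : X -> seq nat) (a : X -> atom) :
  Cmp A -> Cmp h -> Cmp a -> Cmp (fun x => fhold (A x) (h x) (a x)).
Proof.
move=> cA ch ca.
apply: (@Cmp_comp _ _ _ (fun p : fcode * seq nat * atom => fhold p.1.1 p.1.2 p.2)
  (fun x => ((A x, h x), a x))); last by cmp.
rewrite /fhold; apply: Cmp_sum; last by cmp.
  by apply: Cmp_mem; [apply: Cmp_pair; [|apply: Cmp_map; [apply: Cmp_ftm|]]|]; cmp.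
by apply: Cmp_eq; apply: Cmp_ftm; cmp.
Qed.
#[local] Hint Extern 1 (Cmp (fun x => fhold _ _ _)) => apply: Cmp_fhold : cmp.

Lemma Cmp_fmodels (X : countType) (A : X -> fcode) (m : X -> nat) (S : X -> seq ded) :
  Cmp A -> Cmp m -> Cmp S -> Cmp (fun x => fmodels (A x) (m x) (S x)).
Proof.
move=> cA cm cS.
apply: (@Cmp_comp _ _ _ (fun p : fcode * nat * seq ded => fmodels p.1.1 p.1.2 p.2)
  (fun x => ((A x, m x), S x))); last by cmp.
rewrite /fmodels; apply: Cmp_all; last by cmp.
by rewrite /fdom; apply: Cmp_satb; cmp.
Qed.
#[local] Hint Extern 1 (Cmp (fun x => fmodels _ _ _)) => apply: Cmp_fmodels : cmp.

Lemma Cmp_fcheck (X : countType) (p : X -> nat * (fcode * fcode)) (m : X -> nat)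
    (S : X -> seq ded) :
  Cmp p -> Cmp m -> Cmp S -> Cmp (fun x => fcheck (p x) (m x) (S x)).
Proof.
move=> cp cm cS.
apply: (@Cmp_comp _ _ _
  (fun p : (nat * (fcode * fcode)) * nat * seq ded => fcheck p.1.1 p.1.2 p.2)
  (fun x => ((p x, m x), S x))); last by cmp.
rewrite /fcheck /fwf /pdom /fdom /phold.
do 2!(apply: Cmp_or; first by cmp); do 4!(apply: Cmp_and; first by cmp).
by apply: Cmp_has; [apply: Cmp_neg; apply: Cmp_satb|]; cmp.
Qed.

Definition fstruct (A : fcode) : structure :=
  {| carrier := 'I_A.1.1.+1;
     inhabitant := ord0;
     sconst c := inord (nth 0 A.1.2 c);
     srel R s := (R, map val s) \in A.2 |}.

Lemma mem_fdom A x : (x \in fdom A) = (x < A.1.1.+1).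
Proof. by rewrite mem_iota add0n. Qed.

Lemma fholdP A (h : seq nat) (v : nat -> fstruct A) a : fwf A ->
  (forall x, val (v x) = nth 0 h x) -> fhold A h a <-> holds v a.
Proof.
move=> /allP wA hv.
have te t : val (teval v t) = ftm A h t.
  case: t => [x|c] /=; first exact: hv.
  rewrite inordK //; case: (ltnP c (size A.1.2)) => [lt|ge]; last by rewrite nth_default.
  by rewrite -mem_fdom; apply/wA/mem_nth.
case: a => [[R ts]|[s t]] /=.
  suff -> : map val (map (teval v) ts) = map (ftm A h) ts by [].
  by rewrite -map_comp; apply: eq_map.
by rewrite -!te; split=> [/eqP /val_inj|->].
Qed.

Lemma fdom0 A : 0 \in fdom A. Proof. by rewrite mem_fdom. Qed.

Lemma fdom_surj A (x : fstruct A) : exists2 t, t \in fdom A & inord t = x.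
Proof. by exists (val x); rewrite ?mem_fdom ?ltn_ord ?inord_val. Qed.

Lemma finite_fstruct A : finite_structure (fstruct A).
Proof. by exists A.1.1.+1, id => x; exists x. Qed.

Lemma nth_map0 (T T' : Type) (f : T -> T') t0 s i : nth (f t0) (map f s) i = f (nth t0 s i).
Proof.
by case: (ltnP i (size s)) => lt; [rewrite (nth_map t0) | rewrite !nth_default ?size_map].
Qed.

Definition symbols_below (m : nat) (a : atom) : Prop :=
  (forall c, inr c \in aterms a -> c < m) /\
  (forall R ts, a = inl (R, ts) -> R < m /\ size ts < m).

(** A structure interprets infinitely many symbols, while its code lists finitely many facts: they
    can only be required to agree on atoms whose symbols and arities are below [m]. *)
Definition represents (A : fcode) (S : structure) (m : nat) (e : nat -> S) : Prop :=
  (forall x : S, exists2 t, t \in fdom A & e t = x) /\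
  forall h a, (forall x, nth 0 h x \in fdom A) -> symbols_below m a ->
    fhold A h a <-> holds (fun x => e (nth 0 h x)) a.

Lemma represents_fstruct A m : fwf A -> represents A m (inord : nat -> fstruct A).
Proof.
move=> wA; split=> [|h a hd _]; first exact: fdom_surj.
by apply: fholdP => // x; rewrite /= inordK // -mem_fdom.
Qed.

Lemma symbols_below_pickle (Sigma : seq ded) d a : d \in Sigma -> a \in ded_atoms d ->
  symbols_below (pickle Sigma) a.
Proof.
move=> dS ad; split=> [c|R ts e]; first exact: ltn_pickle_const dS ad.
by apply: ltn_pickle_rel dS _; rewrite -e.
Qed.

Lemma fmodelsP A (S : structure) Sigma (e : nat -> S) : represents A (pickle Sigma) e ->
  fmodels A (pickle Sigma) Sigma <-> models S Sigma.
Proof.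
move=> [esurj eP].
have H d : d \in Sigma -> satb 0 (fdom A) (fhold A) (pickle Sigma) d <-> sat_ded S d.
  move=> dS; apply: (satbP (e := e)) => //.
    by move=> a x; apply: ltn_pickle_var.
  move=> h a hm ad; apply: eP; last exact: symbols_below_pickle ad.
  by move=> x; apply: nth_asgs_mem (fdom0 A) hm.
by split=> [/allP h d dS|h]; [apply/H/h | apply/allP => d dS; apply/H/h].
Qed.

Lemma mem_pdom A B (q : nat * nat) :
  (q \in pdom A B) = (q.1 \in fdom A) && (q.2 \in fdom B).
Proof.
apply/flatten_mapP/andP => [[a ad /mapP [b bd ->]] //|[q1 q2]].
by exists q.1 => //; apply/mapP; exists q.2 => //; case: (q).
Qed.

Lemma satb_prodP A B (S S' : structure) (e : nat -> S) (e' : nat -> S') (Sigma : seq ded) d :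
  represents A (pickle Sigma) e -> represents B (pickle Sigma) e' -> d \in Sigma ->
  satb (0, 0) (pdom A B) (phold A B) (pickle Sigma) d <->
  sat_ded (prod_structure S S') d.
Proof.
move=> [surj1 eP1] [surj2 eP2] dS.
have p0 : (0, 0) \in pdom A B by rewrite mem_pdom !fdom0.
apply: (satbP (e := fun q => (e q.1, e' q.2) : prod_structure S S')) => //.
- move=> [x y]; have [[s sA <-] [t tB <-]] := (surj1 x, surj2 y).
  by exists (s, t); rewrite // mem_pdom sA.
- by move=> a x; apply: ltn_pickle_var.
- move=> h a hm ad; have sa := symbols_below_pickle dS ad.
  have hd x : nth (0, 0) h x \in pdom A B by apply: nth_asgs_mem hm.
  have hA x : nth 0 [seq q.1 | q <- h] x \in fdom A.
    by rewrite (nth_map0 fst (0, 0)); have := hd x; rewrite mem_pdom => /andP [].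
  have hB x : nth 0 [seq q.2 | q <- h] x \in fdom B.
    by rewrite (nth_map0 snd (0, 0)); have := hd x; rewrite mem_pdom => /andP [].
  have h1 : holds (fun x => e (nth 0 [seq q.1 | q <- h] x)) a <->
      holds (fun x => e (nth (0, 0) h x).1) a.
    by apply: holds_ext => x _; rewrite (nth_map0 fst (0, 0)).
  have h2 : holds (fun x => e' (nth 0 [seq q.2 | q <- h] x)) a <->
      holds (fun x => e' (nth (0, 0) h x).2) a.
    by apply: holds_ext => x _; rewrite (nth_map0 snd (0, 0)).
  rewrite holds_prod /= -h1 -h2 -(eP1 _ _ hA sa) -(eP2 _ _ hB sa).
  by split=> [/andP|/andP].
Qed.

(** The enumeration of a finite structure may repeat elements, while [fhold] decides equations by
    comparing indices. Redundant indices are removed one at a time. *)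
Lemma finite_indexed (S : structure) : finite_structure S ->
  exists N (e : nat -> S), (forall x, exists2 i, i < N.+1 & e i = x) /\
    (forall i j, i < N.+1 -> j < N.+1 -> e i = e j -> i = j).
Proof.
move=> [n [f fs]]; elim: n f fs => [f fs|n IH f fs].
  by have [[]] := fs (inhabitant S).
case: (excluded_middle_informative (exists i j, i <> j /\ f i = f j)) => [[i [j [ij fij]]]|inj].
  apply: (IH (fun k => f (lift j k))) => x; have [k <-] := fs x.
  case: (unliftP j k) => [k' ->|->]; first by exists k'.
  case: (unliftP j i) => [i' ei|/esym]; last by move=> /esym.
  by exists i'; rewrite -ei.
exists n, (fun i => f (inord i)); split=> [x|i j ilt jlt eij].
  by have [i <-] := fs x; exists (nat_of_ord i); rewrite ?inord_val.
case: (eqVneq (inord i : 'I_n.+1) (inord j)) => [|/eqP ne].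
  by move/(congr1 val); rewrite /= !inordK.
by case: inj; exists (inord i), (inord j).
Qed.

Lemma finite_represented (S : structure) m : finite_structure S ->
  exists A (e : nat -> S), fwf A /\ represents A m e.
Proof.
move=> /finite_indexed [N [e [esurj einj]]].
have [pre preP] : exists pre : S -> nat, forall x, pre x < N.+1 /\ e (pre x) = x.
  exists (fun x => sval (constructive_indefinite_description _
    (let: ex_intro2 t td et := esurj x in ex_intro _ t (conj td et)))) => x.
  by case: constructive_indefinite_description.
pose cs := mkseq (fun c => pre (sconst S c)) m.
pose tuples := flatten [seq asgs (iota 0 N.+1) k | k <- iota 0 m].
pose rs := [seq p <- [seq (R, s) | R <- iota 0 m, s <- tuples] | asb (srel p.1 (map e p.2))].
pose A : fcode := (N, cs, rs); exists A, e; split.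
  by apply/allP => t /mapP [c _ ->]; rewrite mem_fdom; apply: (preP _).1.
split=> [x|h a hd [bc bR]].
  by have [i iN <-] := esurj x; exists i; rewrite ?mem_fdom.
have tm t : t \in aterms a -> ftm A h t \in fdom A /\
    e (ftm A h t) = teval (fun x => e (nth 0 h x)) t.
  case: t => [x|c] ta /=; first by split.
  by rewrite nth_mkseq ?bc // mem_fdom; apply: preP.
case: a bR {bc} tm => [[R ts]|[s t]] /= bR tm.
- have [Rm szm] := bR _ _ erefl; rewrite mem_filter /=.
  have -> : map (teval (fun x => e (nth 0 h x))) ts = map e (map (ftm A h) ts).
    by rewrite -map_comp; apply/eq_in_map => t /tm [_ <-].
  split=> [/andP [/asbP //]|h1]; apply/andP; split; first exact/asbP.
  apply/allpairsP; exists (R, map (ftm A h) ts); split; rewrite ?mem_iota //=.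
  apply/flatten_mapP; exists (size ts); rewrite ?mem_iota // mem_asgs size_map eqxx /=.
  by apply/allP => _ /mapP [t /tm [td _] ->].
- have [ss es] := tm s (mem_head _ _).
  have [tt et] : ftm A h t \in fdom A /\ e (ftm A h t) = teval (fun x => e (nth 0 h x)) t.
    by apply: tm; rewrite !inE eqxx orbT.
  rewrite -es -et; split=> [/eqP -> //|/einj E]; apply/eqP/E.
    by move: ss; rewrite mem_fdom.
  by move: tt; rewrite mem_fdom.
Qed.

Lemma decodable_ded : decodable (seq ded).
Proof.
by do ![exact: decodable_nat | apply: decodable_seq | apply: decodable_prod | apply: decodable_sum].
Qed.

Lemma problemE (dec : nat -> seq ded) Pres n : cancel pickle dec ->
  problem Pres n <-> [/\ pickle (dec n) = n, all wfb (dec n) & Pres (dec n)].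
Proof.
move=> dK; split=> [[Sigma [<- [wS PS]]]|[pn /allP wS PS]].
  by rewrite dK; split=> //; apply/allP => d /wS /wfP.
by exists (dec n); split=> //; split=> // d /wS /wfP.
Qed.

Theorem coRE_FIN_PRESERVATION : coRE FIN_PRESERVATION.
Proof.
have [dec dK cdec] := decodable_ded.
pose D (q : nat * (fcode * fcode)) := fcheck q (pickle (dec q.1)) (dec q.1).
have cD : Cmp D.
  have cd1 (X : countType) : Cmp (fun q : nat * X => dec q.1) by apply: (Cmp_comp cdec); cmp.
  by apply: Cmp_fcheck; [cmp | apply: Cmp_pickle; apply: cd1 | apply: cd1].
have dX : decodable (fcode * fcode)%type.
  by do ![exact: decodable_nat | apply: decodable_seq | apply: decodable_prod].
have [c cP] := RE_exists dX cD; exists c => n; rewrite -cP.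
rewrite /FIN_PRESERVATION (problemE _ _ dK) /D /fcheck /=; set Sigma := dec n.
split=> [npres|[[A B] /=]].
- case E1: (pickle Sigma == n); last by exists ((0, [::], [::]), (0, [::], [::])).
  case E2: (all wfb Sigma); last by exists ((0, [::], [::]), (0, [::], [::])).
  apply: NNPP => nex; apply: npres; split; [exact/eqP | by [] |].
  move=> S S' fS fS' mS mS' d dS; apply: NNPP => nd; apply: nex.
  have [A [e [wA eP]]] := finite_represented (pickle Sigma) fS.
  have [B [e' [wB eP']]] := finite_represented (pickle Sigma) fS'.
  exists (A, B); rewrite /= wA wB /=; apply/and3P; split; first exact/(fmodelsP eP).
    exact/(fmodelsP eP').
  by apply/hasP; exists d => //; apply/negP => /(satb_prodP eP eP' dS).
- move=> /or3P [/negP ne|/negP nw|/and5P [wA wB mA mB /hasP [d dS /negP nd]]] [/eqP pn w pres] //.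
  have eA := represents_fstruct (pickle Sigma) wA.
  have eB := represents_fstruct (pickle Sigma) wB.
  apply/nd/(satb_prodP eA eB dS)/pres => //; first exact: finite_fstruct.
  - exact: finite_fstruct.
  - exact/(fmodelsP eA).
  - exact/(fmodelsP eB).
Qed.

(** * Preservation is recursively enumerable *)

Section Propositional.
Variable F : countType.

Definition clause := (seq F * seq (seq F))%type.

Definition csat (W : F -> bool) (c : clause) : bool := all W c.1 ==> has (all W) c.2.

Definition cfacts (c : clause) : seq F := c.1 ++ flatten c.2.

Lemma eq_csat (W W' : F -> bool) c : {in cfacts c, W =1 W'} -> csat W c = csat W' c.
Proof.
move=> e; rewrite /csat; congr (_ ==> _).
  by apply: eq_in_all => f fc; apply: e; rewrite mem_cat fc.
apply: eq_in_has => psi pc; apply: eq_in_all => f fp; apply: e.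
by rewrite mem_cat; apply/orP; right; apply/flattenP; exists psi.
Qed.

Definition sublists (s : seq F) : seq (seq F) :=
  foldr (fun f acc => acc ++ [seq f :: t | t <- acc]) [:: [::]] s.

Lemma filter_sublists (p : pred F) s : filter p s \in sublists s.
Proof.
elim: s => //= f s IH; rewrite mem_cat; case: (p f); last by rewrite IH.
by rewrite map_f ?orbT.
Qed.

(** Only the facts that occur in [L] matter, and a truth assignment to these is a sublist of their
    list. *)
Definition unsat (L : seq clause) : bool :=
  ~~ has (fun T => all (csat (fun f => f \in T)) L) (sublists (flatten (map cfacts L))).

Lemma unsatP (L : seq clause) : reflect (exists W, all (csat W) L) (~~ unsat L).
Proof.
rewrite negbK; apply: (iffP hasP) => [[T _ TL]|[W WL]]; first by eexists; exact: TL.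
set s := flatten _; exists (filter W s); first exact: filter_sublists.
rewrite (eq_in_all (a2 := csat W)) // => c cL; apply: eq_csat => f fc.
by rewrite mem_filter andbC; suff -> : f \in s by []; apply/flatten_mapP; exists c.
Qed.

(** The truth values of the facts are fixed in the order of their codes, in such a way that every
    finite list of clauses remains satisfiable by an extension of the values fixed so far. *)
Lemma compactness (CS : clause -> Prop) :
  (forall L : seq clause, (forall c, c \in L -> CS c) -> exists W, all (csat W) L) ->
  exists W, forall c, CS c -> csat W c.
Proof.
move=> fin.
pose agree k (W W' : F -> bool) := forall f, pickle f < k -> W' f = W f.
pose ok k W := forall L : seq clause, (forall c, c \in L -> CS c) ->
  exists2 W', agree k W W' & all (csat W') L.
pose ext (k : nat) (W : F -> bool) (b : bool) := fun f : F => if pickle f == k then b else W f.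
have okS k W : ok k W -> ok k.+1 (ext k W true) \/ ok k.+1 (ext k W false).
  move=> okW; apply: NNPP => /not_or_and [n1 n2].
  have [L1 Lh1] := not_all_ex_not _ _ n1; have [L1c L1n] := imply_to_and _ _ Lh1.
  have [L2 Lh2] := not_all_ex_not _ _ n2; have [L2c L2n] := imply_to_and _ _ Lh2.
  (* If both values failed, each because of a finite list, the concatenation of the two lists would
     have no solution extending [W]. *)
  have [c|W' ag] := okW (L1 ++ L2); first by rewrite mem_cat => /orP [/L1c|/L2c].
  rewrite all_cat => /andP [s1 s2].
  (* The number [k] need not be the code of a fact, in which case either value will do. *)
  have [b ab] : exists b, agree k.+1 (ext k W b) W'.
    case: (excluded_middle_informative (exists f : F, pickle f = k)) => [[f0 e0]|nex].
      exists (W' f0) => f; rewrite ltnS leq_eqVlt /ext => /orP [/eqP e|lt].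
        by rewrite e eqxx (pcan_inj pickleK (etrans e (esym e0))).
      by rewrite ltn_eqF // ag.
    exists true => f; rewrite ltnS leq_eqVlt /ext => /orP [/eqP e|lt].
      by case: nex; exists f.
    by rewrite ltn_eqF // ag.
  by case: b ab => ab; [apply: L1n | apply: L2n]; exists W'.
pose step k W := ext k W (asb (ok k.+1 (ext k W true))).
pose w k := nat_rect (fun _ => F -> bool) (fun _ => true) step k.
have okw k : ok k (w k).
  elim: k => [L /fin [W sW]|k IH]; first by exists W.
  by rewrite /= /step; case: asbP => // n; case: (okS _ _ IH).
pose W f := w (pickle f).+1 f.
have wE k f : pickle f < k -> w k f = W f.
  elim: k => // k IH; rewrite ltnS leq_eqVlt => /predU1P [e|lt]; first by rewrite /W e.
  by rewrite /= /step /ext ltn_eqF // IH.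
exists W => c cC.
(* A clause mentions finitely many facts, whose values are all fixed at stage [k]. The extension of
   this stage that satisfies the clause agrees with [W] on them. *)
pose k := (\max_(f <- cfacts c) pickle f).+1.
have [c'|W' ag /=] := okw k [:: c]; first by rewrite inE => /eqP ->.
rewrite andbT => cW'; rewrite (eq_csat (W' := W')) // => f fc.
have lt : pickle f < k by rewrite ltnS; apply: leq_bigmax_seq.
by rewrite -(wE k) // ag.
Qed.
End Propositional.

Lemma Cmp_csat (X F : countType) (T : X -> seq F) (c : X -> clause F) :
  Cmp T -> Cmp c -> Cmp (fun x => csat (fun f => f \in T x) (c x)).
Proof.
move=> cT cc; apply: (@Cmp_comp _ _ _ (fun p : seq F * clause F => csat (fun f => f \in p.1) p.2)
  (fun x => (T x, c x))); last by cmp.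
rewrite /csat; cmp.
Qed.

Lemma Cmp_unsat (X F : countType) (L : X -> seq (clause F)) :
  Cmp L -> Cmp (fun x => unsat (L x)).
Proof.
apply: Cmp_comp; rewrite /unsat /sublists /cfacts; apply: Cmp_neg.
apply: Cmp_has; last by cmp.
by apply: Cmp_all; [apply: Cmp_csat; cmp | cmp].
Qed.
#[local] Hint Extern 1 (Cmp (fun x => unsat _)) => apply: Cmp_unsat : cmp.

(** * Ground clauses over Herbrand names *)

Definition gfact := (bool * ((nat * seq nat) + (nat * nat)))%type.

(* Herbrand names: a term [t] of the violated dependency is named [nm t], and the
   Skolem witness of variable [y] of the [i]-th dependency under the assignment [h]
   of names is named [sk i y h]. *)
Definition hname := (term + (nat * nat * seq nat))%type.
Definition nm (t : term) : nat := pickle (inl t : hname).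
Definition sk (i y : nat) (h : seq nat) : nat := pickle (inr (i, y, h) : hname).

Definition gat (b : bool) (tau : term -> nat) (a : atom) : gfact :=
  (b, match a with
      | inl p => inl (p.1, [seq tau t | t <- p.2])
      | inr p => inr (tau p.1, tau p.2)
      end).

Definition tau_chase (i : nat) (exs : seq nat) (h : seq nat) (t : term) : nat :=
  match t with
  | inl x => if x \in exs then sk i x h else nth 0 h x
  | inr c => nm (inr c)
  end.

(** The universal variables of the violated dependency name themselves, while its existential
    variables take arbitrary names, listed by [h]: its heads have to fail for every choice of
    witnesses. *)
Definition tau_head (exs : seq nat) (h : seq nat) (t : term) : nat :=
  match t with
  | inl x => if x \in exs then nth 0 h x else nm (inl x)
  | inr c => nm (inr c)
  end.

(** A valid dependency, the default for indices beyond the end of [Sigma]. *)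
Definition ded0 : ded := ([::], [::], [:: [::]]).

Definition inst := (bool * nat * nat * nat * seq (nat * nat))%type.

(* The first component of a fact is [true] for the factor [A], [false] for [B]. *)
Definition ground (Sigma : seq ded) (d : ded) (z : inst) : seq (clause gfact) :=
  let b := z.1.1.1.1 in let i := z.1.1.1.2 in let j := z.1.1.2 in let k := z.1.2 in
  let h1 := [seq p.1 | p <- z.2] in let h2 := [seq p.2 | p <- z.2] in
  let di := nth ded0 Sigma i in
  let tau := tau_chase i (ded_exvars di) h1 in
  [:: ([seq gat b tau a | a <- ded_body di],
       [seq [seq gat b tau a | a <- psi] | psi <- ded_heads di]),
      ([::], [:: [:: (b, inr (i, i))]]),
      ([:: (b, inr (i, j)); (b, inr (i, k))], [:: [:: (b, inr (j, k))]]),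
      ((b, inl (i, h1)) :: [seq (b, inr (p.1, p.2)) | p <- z.2], [:: [:: (b, inl (i, h2))]]),
      ([::], [:: [seq gat b nm a | a <- ded_body d]]) &
      [seq ([seq gat true (tau_head (ded_exvars d) h1) a | a <- psi] ++
            [seq gat false (tau_head (ded_exvars d) h2) a | a <- psi], [::])
      | psi <- ded_heads d]].

Lemma Cmp_gat (X : countType) (b : X -> bool) (tau : X -> term -> nat) (a : X -> atom) :
  Cmp b -> Cmp (fun p : X * term => tau p.1 p.2) -> Cmp a ->
  Cmp (fun x => gat (b x) (tau x) (a x)).
Proof.
move=> cb ct ca.
have ct' (Y : countType) (x : Y -> X) t : Cmp x -> Cmp t -> Cmp (fun y => tau (x y) (t y)).
  by move=> cx cu; apply: (Cmp_comp ct (f := fun y => (x y, t y))); cmp.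
rewrite /gat; apply: Cmp_pair => //; apply: Cmp_sum => //.
  apply: Cmp_inl; apply: Cmp_pair; first by cmp.
  by apply: Cmp_map; [apply: ct' | ]; cmp.
by apply: Cmp_inr; apply: Cmp_pair; apply: ct'; cmp.
Qed.

Lemma Cmp_nm (X : countType) (t : X -> term) : Cmp t -> Cmp (fun x => nm (t x)).
Proof. by rewrite /nm => ct; cmp. Qed.
#[local] Hint Extern 1 (Cmp (fun x => nm _)) => apply: Cmp_nm : cmp.

Lemma Cmp_tau_chase (X : countType) (i : X -> nat) (exs h : X -> seq nat) (t : X -> term) :
  Cmp i -> Cmp exs -> Cmp h -> Cmp t -> Cmp (fun x => tau_chase (i x) (exs x) (h x) (t x)).
Proof.
move=> ci ce ch ct.
apply: (@Cmp_comp _ _ _ (fun p : nat * seq nat * (seq nat * term) =>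
  tau_chase p.1.1 p.1.2 p.2.1 p.2.2) (fun x => ((i x, exs x), (h x, t x)))); last by cmp.
by rewrite /tau_chase /sk; apply: Cmp_sum; cmp.
Qed.
#[local] Hint Extern 1 (Cmp (fun x => tau_chase _ _ _ _)) => apply: Cmp_tau_chase : cmp.

Lemma Cmp_tau_head (X : countType) (exs h : X -> seq nat) (t : X -> term) :
  Cmp exs -> Cmp h -> Cmp t -> Cmp (fun x => tau_head (exs x) (h x) (t x)).
Proof.
move=> ce ch ct.
apply: (@Cmp_comp _ _ _ (fun p : seq nat * (seq nat * term) =>
  tau_head p.1 p.2.1 p.2.2) (fun x => (exs x, (h x, t x)))); last by cmp.
by rewrite /tau_head; apply: Cmp_sum; cmp.
Qed.
#[local] Hint Extern 1 (Cmp (fun x => tau_head _ _ _)) => apply: Cmp_tau_head : cmp.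
#[local] Hint Extern 1 (Cmp (fun x => gat _ _ _)) => apply: Cmp_gat : cmp.

Lemma Cmp_ground (X : countType) (S : X -> seq ded) (d : X -> ded) (z : X -> inst) :
  Cmp S -> Cmp d -> Cmp z -> Cmp (fun x => ground (S x) (d x) (z x)).
Proof.
move=> cS cd cz.
apply: (@Cmp_comp _ _ _ (fun p : seq ded * (ded * inst) => ground p.1 p.2.1 p.2.2)
  (fun x => (S x, (d x, z x)))); last by cmp.
rewrite /ground.
do 5!(apply: Cmp_cons; first by cmp).
cmp.
Qed.

Definition names (W : gfact -> bool) (b : bool) (S : structure) (ev : nat -> S) : Prop :=
  (forall R s, W (b, inl (R, s)) <-> srel R (map ev s)) /\
  (forall m n, W (b, inr (m, n)) <-> ev m = ev n).

Lemma gatP W b (S : structure) (ev : nat -> S) tau u a : names W b ev ->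
  (forall t, t \in aterms a -> ev (tau t) = teval u t) ->
  W (gat b tau a) <-> holds u a.
Proof.
move=> [n1 n2]; case: a => [[R ts]|[s t]] /= e.
  rewrite n1 -map_comp; suff -> : map (ev \o tau) ts = map (teval u) ts by [].
  exact/eq_in_map.
by rewrite n2 !e ?inE ?eqxx ?orbT.
Qed.

Lemma all_gatP W b (S : structure) (ev : nat -> S) tau u (psi : seq atom) : names W b ev ->
  (forall a t, a \in psi -> t \in aterms a -> ev (tau t) = teval u t) ->
  all W [seq gat b tau a | a <- psi] <-> (forall a, a \in psi -> holds u a).
Proof.
move=> nW e; rewrite all_map; split=> [/allP h a ap|h].
  by apply/(gatP (tau := tau) nW) => [t|]; [apply: e | apply: h].
by apply/allP => a ap; apply/(gatP (u := u) nW) => [t|]; [apply: e | apply: h].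
Qed.

(** A head is a disjunction, yet one Skolem function per variable serves all disjuncts: for each
    assignment, a true disjunct and its witnesses are chosen together. *)
Lemma skolem_functions (S : structure) Sigma : models S Sigma ->
  exists SK : nat -> nat -> (nat -> S) -> S, forall i u, i < size Sigma ->
    (forall a, a \in ded_body (nth ded0 Sigma i) -> holds u a) ->
    exists2 psi, psi \in ded_heads (nth ded0 Sigma i) & forall a, a \in psi ->
      holds (fun x => if x \in ded_exvars (nth ded0 Sigma i) then SK i x u else u x) a.
Proof.
move=> mS.
have ex i u : exists v' : nat -> S, i < size Sigma ->
    (forall a, a \in ded_body (nth ded0 Sigma i) -> holds u a) ->
    exists2 psi, psi \in ded_heads (nth ded0 Sigma i) & forall a, a \in psi ->
      holds (fun x => if x \in ded_exvars (nth ded0 Sigma i) then v' x else u x) a.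
  case: (excluded_middle_informative (i < size Sigma /\
      forall a, a \in ded_body (nth ded0 Sigma i) -> holds u a)) => [[iS body]|n].
    have [psi pd [v' [agr hpsi]]] := mS _ (mem_nth ded0 iS) u body.
    exists v' => _ _; exists psi => // a /hpsi; apply: (holds_ext _).2 => x _.
    by case: ifP => // /negbT /agr.
  by exists u => iS body; case: n.
exists (fun i x u => sval (constructive_indefinite_description _ (ex i u)) x) => i u.
by case: constructive_indefinite_description.
Qed.

Lemma nth_ltn_sk i y h x : nth 0 h x < sk i y h.
Proof.
have l1 := ltn_pickle_inr term (i, y, h).
have [_ l2] := ltn_pickle_pair (i, y, h).
have l : pickle h < sk i y h by apply: ltn_trans l2 l1.
case: (ltnP x (size h)) => [lt|ge]; last by rewrite nth_default //; apply: leq_ltn_trans l.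
by apply: ltn_trans l; apply: (@ltn_pickle_mem nat); apply: mem_nth.
Qed.

(** The recursion through Skolem names is well founded because [sk i y h] exceeds every entry of
    [h], the default [0] included. The fuel [k] of [evf] makes it structural. *)
Lemma name_evaluation (S : structure) (v : nat -> S) (SK : nat -> nat -> (nat -> S) -> S) :
  exists ev : nat -> S, (forall t, ev (nm t) = teval v t) /\
    forall i y h, ev (sk i y h) = SK i y (fun x => ev (nth 0 h x)).
Proof.
pose evf := fix evf (k n : nat) : S :=
  if k is k'.+1 then
    match (pickle_inv n : option hname) with
    | Some (inl t) => teval v t
    | Some (inr p) => SK p.1.1 p.1.2 (fun x => evf k' (nth 0 p.2 x))
    | None => inhabitant S
    end
  else inhabitant S.
have evfE k k' n : n < k -> n < k' -> evf k n = evf k' n.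
  elim: k k' n => // k IH [|k'] // n nk nk' /=.
  have /= := @pickle_invK hname n; case: pickle_inv => [[t|[[i y] h]]|] //= e.
  congr SK; apply: functional_extensionality => x.
  have lt : nth 0 h x < n by rewrite -[n]e; apply: nth_ltn_sk.
  by apply: IH; apply: leq_trans lt _.
have evS k n : evf k.+1 n = match (pickle_inv n : option hname) with
    | Some (inl t) => teval v t
    | Some (inr p) => SK p.1.1 p.1.2 (fun x => evf k (nth 0 p.2 x))
    | None => inhabitant S
    end by [].
exists (fun n => evf n.+1 n); split=> [t|i y h]; rewrite evS pickleK_inv //.
rewrite [LHS]/=; congr SK; apply: functional_extensionality => x; exact: (evfE _ _ _ (nth_ltn_sk i y h x) (ltnSn _)).
Qed.

(** A reflexive and Euclidean relation is an equivalence, so that these two conditions and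
    congruence axiomatise equality. One tuple of parameters instantiates all the schemes at once:
    [i] is in turn an index in [Sigma], a name and a relation symbol. *)
Lemma all_csat_ground W (Sigma : seq ded) d b i j k h :
  let h1 := [seq p.1 | p <- h] in let h2 := [seq p.2 | p <- h] in
  let di := nth ded0 Sigma i in let tau := tau_chase i (ded_exvars di) h1 in
  all (csat W) (ground Sigma d (b, i, j, k, h)) <->
  [/\ (all W [seq gat b tau a | a <- ded_body di] -> exists2 psi, psi \in ded_heads di &
          all W [seq gat b tau a | a <- psi]),
      W (b, inr (i, i)) /\ (W (b, inr (i, j)) -> W (b, inr (i, k)) -> W (b, inr (j, k))),
      (W (b, inl (i, h1)) -> (forall p, p \in h -> W (b, inr p)) -> W (b, inl (i, h2))),
      all W [seq gat b nm a | a <- ded_body d] &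
      forall psi, psi \in ded_heads d ->
        all W [seq gat true (tau_head (ded_exvars d) h1) a | a <- psi] ->
        all W [seq gat false (tau_head (ded_exvars d) h2) a | a <- psi] -> False].
Proof.
have all_cons (T : Type) (p : pred T) x s : all p (x :: s) = p x && all p s by [].
move=> h1 h2 di tau; rewrite /ground 5!all_cons /csat.
split.
- case/and5P => /implyP c1 /= c2 c3 c4 /andP [c5 c6].
  split.
  + by move=> /c1 /hasP [_ /mapP [psi pd ->] hp]; exists psi.
  + by move: c2 c3; rewrite !andbT !orbF => -> /implyP c3; split=> // w1 w2; apply: c3; rewrite w1.
  + move: c4; rewrite andbT orbF => /implyP c4 w1 w2; apply: c4; rewrite w1 /= all_map.
    by apply/allP => -[m n] /w2.
  + by move: c5; rewrite orbF.
  + move=> psi pd p1 p2; have := allP c6 _ (map_f _ pd).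
    by rewrite /= all_cat p1 p2.
- move=> [c1 [c2 c3] c4 c5 c6]; apply/and5P; split; rewrite /= ?c2 ?c5 //.
  + by apply/implyP => /c1 [psi pd hp]; apply/hasP; exists [seq gat b tau a | a <- psi]; first exact: map_f.
  + by rewrite !andbT orbF; apply/implyP => /andP []; apply: c3.
  + rewrite andbT orbF; apply/implyP => /andP [w1 /allP w2]; apply: c4 => // p ph.
    by apply: w2; apply/mapP; exists p => //; case: (p).
  + apply/allP => _ /mapP [psi pd ->] /=; rewrite all_cat.
    by apply/implyP => /andP [w1 w2]; case: (c6 psi).
Qed.

(** Each fact is evaluated in the factor given by its tag, the Skolem functions of the two factors
    being chosen independently. The head of [d] fails for all pairs of witness tuples, in particular
    for those that have names. *)
Lemma csat_ground (Sigma : seq ded) d (A : bool -> structure)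
    (v : forall b, nat -> A b) :
  (forall d', d' \in Sigma -> wf_ded d') -> wf_ded d ->
  (forall b, models (A b) Sigma) ->
  (forall b a, a \in ded_body d -> holds (v b) a) ->
  ~ (exists2 psi, psi \in ded_heads d & exists v' : forall b, nat -> A b,
      (forall b z, z \notin ded_exvars d -> v' b z = v b z) /\
      (forall b a, a \in psi -> holds (v' b) a)) ->
  exists W, forall z, all (csat W) (ground Sigma d z).
Proof.
move=> wS wd mA body nhead.
have [SK SKP] : exists SK : forall b, nat -> nat -> (nat -> A b) -> A b, forall b i u,
    i < size Sigma -> (forall a, a \in ded_body (nth ded0 Sigma i) -> holds u a) ->
    exists2 psi, psi \in ded_heads (nth ded0 Sigma i) & forall a, a \in psi ->
      holds (fun x => if x \in ded_exvars (nth ded0 Sigma i) then SK b i x u else u x) a.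
  exists (fun b => sval (constructive_indefinite_description _ (skolem_functions (mA b)))) => b.
  by case: constructive_indefinite_description.
have [ev evP] : exists ev : forall b, nat -> A b, forall b,
    (forall t, ev b (nm t) = teval (v b) t) /\
    forall i y h, ev b (sk i y h) = SK b i y (fun x => ev b (nth 0 h x)).
  exists (fun b => sval (constructive_indefinite_description _ (name_evaluation (v b) (SK b)))) => b.
  by case: constructive_indefinite_description.
pose W (f : gfact) := match f.2 with
  | inl p => asb (srel p.1 (map (ev f.1) p.2))
  | inr p => asb (ev f.1 p.1 = ev f.1 p.2) end.
have nW b : names W b (ev b) by split=> [R s|m n]; split; rewrite /W /= => /asbP.
exists W => -[[[[b i] j] k] h]; apply/all_csat_ground; split.
- set di := nth ded0 Sigma i; set h1 := [seq p.1 | p <- h].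
  pose u x := ev b (nth 0 h1 x).
  pose u' x := if x \in ded_exvars di then SK b i x u else u x.
  have tauE (psi : seq atom) a t : a \in psi -> t \in aterms a ->
      ev b (tau_chase i (ded_exvars di) h1 t) = teval u' t.
    case: t => [x|c] _ _; last exact: (evP b).1.
    by rewrite /= /u'; case: ifP => // _; rewrite (evP b).2.
  move/(all_gatP (nW b) (tauE _)) => hb.
  (* Beyond the end of [Sigma] the index selects [ded0], whose head has an empty, hence true,
     disjunct. *)
  case: (ltnP i (size Sigma)) => [iS|ge]; last first.
    by exists [::]; rewrite /di nth_default.
  have diS : di \in Sigma by apply: mem_nth.
  have [|psi pd hpsi] := SKP b i u iS; last first.
    by exists psi => //; apply/(all_gatP (nW b) (tauE _)).
  move=> a ab; apply/(holds_ext (v := u')); last exact: hb.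
  move=> x xa; rewrite /u'; have [_ /(_ a x ab xa) /negbTE] := wS _ diS.
  by move=> ->.
- split; first exact/(nW b).2.
  by move=> /(nW b).2 e1 /(nW b).2 e2; apply/(nW b).2; rewrite -e1.
- move=> /(nW b).1 w1 w2; apply/(nW b).1; move: w1; rewrite -!map_comp.
  suff -> : map (ev b \o fst) h = map (ev b \o snd) h by [].
  by apply/eq_in_map => -[m n] /w2 /(nW b).2.
- apply/(all_gatP (u := v b) (nW b)) => [a t _ _|]; first exact: (evP b).1.
  exact: body.
- set h1 := [seq p.1 | p <- h]; set h2 := [seq p.2 | p <- h] => psi pd w1 w2.
  pose hh (b : bool) := if b then h1 else h2.
  pose v' b x := if x \in ded_exvars d then ev b (nth 0 (hh b) x) else v b x.
  have tauE b' a t : a \in psi -> t \in aterms a ->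
      ev b' (tau_head (ded_exvars d) (hh b') t) = teval (v' b') t.
    case: t => [x|c] _ _; last exact: (evP b').1.
    by rewrite /= /v'; case: ifP => // _; rewrite (evP b').1.
  apply: nhead; exists psi => //; exists v'; split=> [b' z /negbTE zn|b'].
    by rewrite /v' zn.
  apply/(all_gatP (nW b') (tauE b')).
  by case: b' {tauE}.
Qed.

(** * From a valuation of the facts to two models *)

Section Quotient.
Variables (W : gfact -> bool) (b : bool).
Hypothesis Wrefl : forall m, W (b, inr (m, m)).
Hypothesis Weuc : forall m n k, W (b, inr (m, n)) -> W (b, inr (m, k)) -> W (b, inr (n, k)).
Hypothesis Wcongr : forall R h, W (b, inl (R, [seq p.1 | p <- h])) ->
  (forall p, p \in h -> W (b, inr p)) -> W (b, inl (R, [seq p.2 | p <- h])).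

Let Wsym m n : W (b, inr (m, n)) -> W (b, inr (n, m)).
Proof. by move=> mn; apply: Weuc mn (Wrefl _). Qed.

Let Wtrans m n k : W (b, inr (m, n)) -> W (b, inr (n, k)) -> W (b, inr (m, k)).
Proof. by move=> /Wsym; apply: Weuc. Qed.

Let ex_rep n : exists m, W (b, inr (n, m)). Proof. by exists n. Qed.

Definition rep n := ex_minn (ex_rep n).

Let repP n : W (b, inr (n, rep n)).
Proof. by rewrite /rep; case: ex_minnP. Qed.

Let rep_eq m n : W (b, inr (m, n)) <-> rep m = rep n.
Proof.
split=> [mn|e]; last by apply: Wtrans (repP m) _; rewrite e; apply/Wsym/repP.
apply/eqP; rewrite eqn_leq; apply/andP; split; rewrite {1}/rep; case: ex_minnP => k _; apply.
  exact: Wtrans mn (repP n).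
exact: Wtrans (Wsym mn) (repP m).
Qed.

Let rep_idem n : rep (rep n) == rep n.
Proof. by apply/eqP/esym/rep_eq/repP. Qed.

(** Classes are represented by their least members, so that the carrier is a set of names and
    equality of classes is equality of numbers. *)
Definition quot : structure :=
  {| carrier := {n | rep n == n};
     inhabitant := exist _ (rep 0) (rep_idem 0);
     sconst c := exist _ (rep (nm (inr c))) (rep_idem _);
     srel R s := W (b, inl (R, map val s)) |}.

Definition cls n : quot := exist (fun n => rep n == n) (rep n) (rep_idem n).

Lemma cls_val (x : quot) : cls (val x) = x.
Proof. by apply: val_inj; apply/eqP; case: x. Qed.

Lemma names_quot : names W b cls.
Proof.
split=> [R s|m n]; last first.
  rewrite rep_eq; split=> [e|[]] //; exact: val_inj.
rewrite /= -map_comp; split=> w.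
  have := @Wcongr R [seq (n, rep n) | n <- s]; rewrite -!map_comp map_id_in //.
  by apply=> // _ /mapP [n _ ->].
have := @Wcongr R [seq (rep n, n) | n <- s]; rewrite -!map_comp.
rewrite [map (snd \o _) _](@eq_map _ _ _ id) // map_id; apply=> // _ /mapP [n _ ->].
exact/Wsym/repP.
Qed.
End Quotient.

(** The factors are term models: names modulo the equations true in [W]. On the variables below a
    bound, an assignment is a finite list of names, for which the clauses provide the Skolem names
    as witnesses. *)
Lemma models_of_ground (Sigma : seq ded) d W :
  (forall d', d' \in Sigma -> wf_ded d') -> wf_ded d ->
  (forall z, all (csat W) (ground Sigma d z)) ->
  exists A B : structure, [/\ models A Sigma, models B Sigma & ~ sat_ded (prod_structure A B) d].
Proof.
move=> wS wd satW.
have sat b i j k h := (all_csat_ground _ _ _ _ _ _ _ _).1 (satW (b, i, j, k, h)).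
have Wrefl b m : W (b, inr (m, m)) by case: (sat b m 0 0 [::]) => _ [].
have Weuc b m n k : W (b, inr (m, n)) -> W (b, inr (m, k)) -> W (b, inr (n, k)).
  by case: (sat b m n k [::]) => _ [_ e] _ _ _; apply: e.
have Wcongr b R h : W (b, inl (R, [seq p.1 | p <- h])) ->
    (forall p, p \in h -> W (b, inr p)) -> W (b, inl (R, [seq p.2 | p <- h])).
  by case: (sat b R 0 0 h).
pose A b := quot (Wrefl b) (@Weuc b); pose ev b := cls (Wrefl b) (@Weuc b) : nat -> A b.
have nW b : names W b (ev b) by apply: names_quot; apply: Wcongr.
have evK b (x : A b) : ev b (val x) = x by apply: cls_val.
have mA b : models (A b) Sigma.
  move=> d' d'S u body; have [i iS ed'] := nthP ded0 d'S.
  (* The components [0] are padding: the chase clause reads the first components only. *)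
  pose m := pickle Sigma; pose h := mkseq (fun x => (val (u x), 0)) m.
  pose h1 := [seq p.1 | p <- h].
  have hE x : x < m -> ev b (nth 0 h1 x) = u x.
    by move=> xm; rewrite (nth_map (0, 0)) ?size_mkseq // nth_mkseq //; apply: evK.
  pose u' x := if x \in ded_exvars d' then ev b (sk i x h1) else u x.
  have tauE a t : a \in ded_atoms d' -> t \in aterms a ->
      ev b (tau_chase i (ded_exvars d') h1 t) = teval u' t.
    case: t => [x|c] ad ta //; rewrite /= /u'; case: ifP => // _; apply: hE.
    by apply: ltn_pickle_var d'S ad _; rewrite mem_avars.
  have tauB a t : a \in ded_body d' -> t \in aterms a ->
      ev b (tau_chase i (ded_exvars d') h1 t) = teval u' t.
    by move=> /body_ded_atoms; apply: tauE.
  case: (sat b i 0 0 h); rewrite ed' -/h1 => chase _ _ _ _.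
  case: chase => [|psi pd hpsi].
    apply/(all_gatP (nW b) tauB) => a ab; apply: (holds_ext _).1 (body _ ab) => x xa.
    by have [_ /(_ a x ab xa) /negbTE] := wS _ d'S; rewrite /u' => ->.
  exists psi => //; exists u'; split=> [z /negbTE zn|]; first by rewrite /u' zn.
  by apply/(all_gatP (nW b) _) => [a t ap|]; [apply/tauE/(head_ded_atoms pd ap)|].
exists (A true), (A false); split=> // sat_d.
pose v b x := ev b (nm (inl x)).
have vE b t : ev b (nm t) = teval (v b) t by case: t.
have body b a : a \in ded_body d -> holds (v b) a.
  move: a; apply/(all_gatP (nW b) (fun a t _ _ => vE b t)).
  by case: (sat b 0 0 0 [::]).
have [|psi pd [w [agr hpsi]]] := sat_d (fun x => (v true x, v false x)).
  by move=> a ab; apply/holds_prod; split; apply: body.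
pose m := pickle [:: d].
(* Here the first components are names in [A] and the second ones names in [B]: the clause that
   refutes [psi] reads both. *)
pose h := mkseq (fun x => (val (w x).1, val (w x).2)) m.
case: (sat true 0 0 0 h) => _ _ _ _ /(_ psi pd).
have dom a x : a \in psi -> inl x \in aterms a -> x < m.
  by move=> ap xa; apply: (ltn_pickle_var (mem_head d [::]) (head_ded_atoms pd ap)); rewrite mem_avars.
apply.
- apply/(all_gatP (u := fun x => (w x).1) (nW true)) => [a [x|c] ap ta|a ap] //.
    rewrite /=; case: ifP => [_|/negbT /agr -> //].
    by rewrite (nth_map (0, 0)) ?size_mkseq ?(dom a) // nth_mkseq ?(dom a) //; apply: evK.
  by have /holds_prod [] := hpsi a ap.
- apply/(all_gatP (u := fun x => (w x).2) (nW false)) => [a [x|c] ap ta|a ap] //.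
    rewrite /=; case: ifP => [_|/negbT /agr -> //].
    by rewrite (nth_map (0, 0)) ?size_mkseq ?(dom a) // nth_mkseq ?(dom a) //; apply: evK.
  by have /holds_prod [] := hpsi a ap.
Qed.

Lemma common_witness_list (T U : eqType) (P : T -> U -> Prop) (s : seq T) :
  (forall x, x \in s -> exists y, P x y) ->
  exists ys : seq U, forall x, x \in s -> exists2 y, y \in ys & P x y.
Proof.
elim: s => [|x s IH] ex; first by exists [::].
have [y Pxy] := ex x (mem_head _ _).
have [|ys ysP] := IH; first by move=> z zs; apply: ex; rewrite inE zs orbT.
exists (y :: ys) => z; rewrite inE => /predU1P [->|/ysP [u uys Pzu]].
  by exists y; rewrite ?mem_head.
by exists u; rewrite // inE uys orbT.
Qed.

(** A certificate is a pool of lists of instances, in which each dependency [d] finds its own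
    refutation. *)
Definition pcheck (q : nat * seq (seq inst)) (Sigma : seq ded) : bool :=
  [&& pickle Sigma == q.1, all wfb Sigma &
    all (fun d => has (fun L => unsat (flatten [seq ground Sigma d z | z <- L])) q.2) Sigma].

Lemma Cmp_pcheck (X : countType) (q : X -> nat * seq (seq inst)) (S : X -> seq ded) :
  Cmp q -> Cmp S -> Cmp (fun x => pcheck (q x) (S x)).
Proof.
move=> cq cS.
apply: (@Cmp_comp _ _ _ (fun p : (nat * seq (seq inst)) * seq ded => pcheck p.1 p.2)
  (fun x => (q x, S x))); last by cmp.
rewrite /pcheck; apply: Cmp_and; first by cmp.
apply: Cmp_and; first by cmp.
apply: Cmp_all; last by cmp.
apply: Cmp_has; last by cmp.
apply: Cmp_unsat; apply: Cmp_flatten; apply: Cmp_map; last by cmp.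
apply: Cmp_ground; cmp.
Qed.

Lemma preservedP (Sigma : seq ded) : (forall d, d \in Sigma -> wf_ded d) ->
  preserved_products Sigma <->
  forall d, d \in Sigma -> exists L, unsat (flatten [seq ground Sigma d z | z <- L]).
Proof.
move=> wS; split=> [pres d dS|ex S S' mS mS' d dS v body].
- apply: NNPP => nex.
  have [L Lc|W satW] := @compactness gfact (fun c => exists z, c \in ground Sigma d z).
    have [zs zsP] := common_witness_list Lc.
    have /unsatP [W /allP sW] : ~~ unsat (flatten [seq ground Sigma d z | z <- zs]).
      by apply/negP => u; apply: nex; exists zs.
    exists W; apply/allP => c /zsP [z zz cz]; apply: sW.
    by apply/flatten_mapP; exists z.
  have [|S [S' [mS mS']]] := models_of_ground wS (wS d dS) (W := W).
    by move=> z; apply/allP => c cz; apply: satW; exists z.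
  by apply; apply: pres dS.
- apply: NNPP => nsat; have [L u] := ex d dS; suff /negP : ~~ unsat (flatten [seq ground Sigma d z | z <- L]) by [].
  apply/unsatP.
  pose A (b : bool) := if b then S else S'.
  pose w b : nat -> A b := if b as b0 return nat -> A b0 then fun x => (v x).1 else fun x => (v x).2.
  have [b|b a ab|[psi pd [v' [agr hv']]]|W satW] := @csat_ground Sigma d A w wS (wS d dS).
  + by case: b.
  + by have /holds_prod [] := body a ab; case: b.
  + apply: nsat; exists psi => //; exists (fun x => (v' true x, v' false x)); split.
      by move=> z zn; rewrite !agr //= -surjective_pairing.
    by move=> a ap; apply/holds_prod; split; [apply: (hv' true) | apply: (hv' false)].
  + exists W; apply/allP => c /flatten_mapP [z _ cz]; exact: (allP (satW z)).
Qed.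

Theorem RE_PRESERVATION : RE PRESERVATION.
Proof.
have [dec dK cdec] := decodable_ded.
pose D (q : nat * seq (seq inst)) := pcheck q (dec q.1).
have cD : Cmp D.
  apply: Cmp_pcheck; first by cmp.
  by apply: (Cmp_comp cdec); cmp.
have dX : decodable (seq (seq inst)).
  by do ![exact: decodable_nat | exact: decodable_bool | apply: decodable_seq | apply: decodable_prod].
have [c cP] := RE_exists dX cD; exists c => n; rewrite -cP.
rewrite /PRESERVATION (problemE _ _ dK) /D /pcheck /=; set Sigma := dec n.
split=> [[/eqP pn wS]|[Ls /and3P [/eqP pn wS /allP Lh]]].
- have wS' d : d \in Sigma -> wf_ded d by move=> /(allP wS) /wfP.
  move=> /(preservedP wS') /common_witness_list [Ls LsP]; exists Ls.
  by rewrite pn wS; apply/allP => d /LsP [L LL u]; apply/hasP; exists L.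
- have wS' d : d \in Sigma -> wf_ded d by move=> /(allP wS) /wfP.
  split=> //; apply/(preservedP wS') => d /Lh /hasP [L _ u]; by exists L.
Qed.

(** * Rules for the graphs of recursive functions *)

Section PrfInd.
Variable P : prf -> Prop.
Hypotheses (Pzero : P PZero) (Psucc : P PSucc) (Pproj : forall i, P (PProj i)).
Hypothesis Pcomp : forall f gs, P f -> List.Forall P gs -> P (PComp f gs).
Hypothesis Prec : forall f g, P f -> P g -> P (PRec f g).
Hypothesis Pmu : forall f, P f -> P (PMu f).

Fixpoint prf_nested_ind c : P c :=
  match c with
  | PZero => Pzero
  | PSucc => Psucc
  | PProj i => Pproj i
  | PComp f gs => Pcomp (prf_nested_ind f)
      ((fix all_ind gs : List.Forall P gs := match gs with
        | [::] => List.Forall_nil P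
        | g :: gs' => List.Forall_cons g (prf_nested_ind g) (all_ind gs')
        end) gs)
  | PRec f g => Prec (prf_nested_ind f) (prf_nested_ind g)
  | PMu f => Pmu (prf_nested_ind f)
  end.
End PrfInd.

Fixpoint prf_tree (c : prf) : GenTree.tree nat :=
  match c with
  | PZero => GenTree.Leaf 0
  | PSucc => GenTree.Leaf 1
  | PProj i => GenTree.Node 0 [:: GenTree.Leaf i]
  | PComp f gs => GenTree.Node 1 (prf_tree f :: map prf_tree gs)
  | PRec f g => GenTree.Node 2 [:: prf_tree f; prf_tree g]
  | PMu f => GenTree.Node 3 [:: prf_tree f]
  end.

Lemma prf_tree_inj : injective prf_tree.
Proof.
elim/prf_nested_ind => [||i|f gs IHf IHgs|f g IHf IHg|f IHf] [||i'|f' gs'|f' g'|f'] //=.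
- by case=> ->.
- case=> /IHf -> e; congr PComp.
  elim: IHgs gs' e => [|g gs0 IHg _ IH] [|g' gs'] //= [/IHg -> e].
  by rewrite (IH gs').
- by case=> /IHf -> /IHg ->.
- by case=> /IHf ->.
Qed.

Inductive sym := SN | SS | SL | SP | SQ | SE of prf | SM of prf.

(* The codes are kept opaque: computing them is infeasible. *)
Lemma code_exists : {code : sym -> nat | injective code}.
Proof.
exists (fun y => pickle (match y with
  | SN => (0, GenTree.Leaf 0) | SS => (1, GenTree.Leaf 0) | SL => (2, GenTree.Leaf 0)
  | SP => (3, GenTree.Leaf 0) | SQ => (4, GenTree.Leaf 0)
  | SE g => (5, prf_tree g) | SM g => (6, prf_tree g) end : nat * GenTree.tree nat)).
move=> y y' /(pcan_inj pickleK).
by case: y => [||||| g|g]; case: y' => [||||| g'|g'] //= [] /prf_tree_inj ->.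
Qed.

Definition code : sym -> nat := sval code_exists.

Lemma code_inj : injective code.
Proof. exact: svalP code_exists. Qed.

Definition V (i : nat) : term := inl i.
Definition c0 : term := inr 0.
Definition ratom (y : sym) (ts : seq term) : atom := inl (code y, ts).
Definition eqa (s t : term) : atom := inr (s, t).
Definition vars i k : seq term := [seq V j | j <- iota i k].

(* A rule [(R, k, n, cores)] describes [R (x_0, .., x_(k-1))] as the disjunction of
   the conjunctions [core], in which [x_k, .., x_(k+n-1)] are existential.  For
   [R = code (SE g)], [x_0] is the value of [g] on [x_1, .., x_(k-1)]; for
   [R = code (SM f)], [f] is positive on [m, x_1, .., x_(k-1)] for [m < x_0]. *)
Definition rule := (nat * nat * nat * seq (seq atom))%type.

Fixpoint rules (g : prf) (k : nat) : seq rule :=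
  match g with
  | PZero => [:: (code (SE g), k.+1, 0, [:: [:: eqa (V 0) c0]])]
  | PSucc => [:: (code (SE g), k.+1, 0, [:: [:: ratom SS [:: head c0 (vars 1 k); V 0]]])]
  | PProj i => [:: (code (SE g), k.+1, 0, [:: [:: eqa (V 0) (nth c0 (vars 1 k) i)]])]
  | PComp f gs =>
      let m := size gs in
      (code (SE g), k.+1, m,
        [:: rcons [seq ratom (SE p.1) (V p.2 :: vars 1 k) | p <- zip gs (iota k.+1 m)]
                  (ratom (SE f) (V 0 :: vars k.+1 m))])
      :: rules f m ++ flatten [seq rules g' k | g' <- gs]
  | PRec f g' =>
      if k is k'.+1 then
        (code (SE g), k.+1, 2,
          [:: [:: eqa (V 1) c0; ratom (SE f) (V 0 :: vars 2 k')];
              [:: ratom SS [:: V k.+1; V 1];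
                  ratom (SE g) (V k.+2 :: V k.+1 :: vars 2 k');
                  ratom (SE g') (V 0 :: V k.+1 :: V k.+2 :: vars 2 k')]])
        :: rules f k' ++ rules g' k.+1
      else [:: (code (SE g), 1, 0, [::])]
  | PMu f =>
      [:: (code (SE g), k.+1, 0,
            [:: [:: ratom (SE f) (c0 :: V 0 :: vars 1 k); ratom (SM f) (V 0 :: vars 1 k)]]),
          (code (SM f), k.+1, 3,
            [:: [:: eqa (V 0) c0];
                [:: ratom SS [:: V k.+1; V 0];
                    ratom (SM f) (V k.+1 :: vars 1 k);
                    ratom (SE f) (V k.+2 :: V k.+1 :: vars 1 k);
                    ratom SS [:: V k.+3; V k.+2]]])
        & rules f k.+1]
  end.

Definition tbound m (t : term) : bool := match t with inl x => x < m | inr c => c == 0 end.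
Definition abound m (a : atom) : bool := all (tbound m) (aterms a).
Definition rule_ok (r : rule) : bool := all (all (abound (r.1.1.2 + r.1.2))) r.2.

Lemma tbound_vars m i k : i + k <= m -> all (tbound m) (vars i k).
Proof.
move=> ikm; rewrite all_map; apply/allP => j; rewrite mem_iota => /andP [_ jk] /=.
exact: leq_trans jk ikm.
Qed.

Lemma tbound_nth m s i : all (tbound m) s -> tbound m (nth c0 s i).
Proof.
move=> sm; case: (ltnP i (size s)) => [lt|ge]; last by rewrite nth_default.
by apply: (allP sm); apply: mem_nth.
Qed.

Lemma rules_ok g k : all rule_ok (rules g k).
Proof.
elim/prf_nested_ind: g k => [||i|f gs IHf IHgs|f g IHf IHg|f IHf] k.
- by [].
- rewrite /= /rule_ok /abound /= -nth0 tbound_nth //.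
  by rewrite addn0 tbound_vars.
- rewrite /= /rule_ok /abound /= tbound_nth // addn0; exact: tbound_vars.
- rewrite [rules _ _]/=; set m := size gs; set r := (_, _, _, _); rewrite /= all_cat IHf /=.
  apply/andP; split; last first.
    by elim: IHgs => //= g gs' Pg _ IH; rewrite all_cat Pg IH.
  rewrite /rule_ok /= all_rcons andbT /abound /= tbound_vars ?leqnn //=.
  rewrite all_map; have : all (fun j => j < k.+1 + m) (unzip2 (zip gs (iota k.+1 m))).
    by rewrite unzip2_zip ?size_iota //; apply/allP => j; rewrite mem_iota => /andP [].
  rewrite all_map; apply: sub_all => p /= jm.
  by rewrite /abound /= jm tbound_vars // leq_addr.
- case: k => [//|k] /=; rewrite all_cat IHf IHg /rule_ok /abound /= !addn2 !tbound_vars //=.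
    by rewrite !ltnS !leqnn !leqnSn.
  exact: (leqW (leqnSn k.+2)).
- rewrite /= IHf /rule_ok /abound /= !addn0 !addn3 !tbound_vars ?add1n ?leqnn //=.
    by rewrite !ltnS (leqW (leqnSn k)) leqnSn.
  by rewrite ltnS (leqW (leqW (leqnSn k))).
Qed.

(** * Reading rules as dependencies *)

Definition nats (m : nat) : seq atom := [seq ratom SN [:: V i] | i <- iota 0 m].
Definition head_atom (r : rule) : atom := inl (r.1.1.1, vars 0 r.1.1.2).
Definition both : seq atom := [:: ratom SP [::]; ratom SQ [::]].

(** The guards [nats] are what makes the dependency well-formed: in the rule of [PZero], for
    instance, the variables of the head occur in no relational atom of the core. A disjunction on
    the left becomes one dependency per core. *)
Definition bottom_up (r : rule) : seq ded :=
  [seq ([::], nats (r.1.1.2 + r.1.2) ++ core, [:: [:: head_atom r]]) | core <- r.2].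

(* The alternative [both] stands for falsity: it is what makes the rule hold in the
   models that satisfy everything. *)
Definition top_down (r : rule) : ded :=
  (iota r.1.1.2 r.1.2, [:: head_atom r],
   rcons [seq nats (r.1.1.2 + r.1.2) ++ core | core <- r.2] both).

Lemma map_teval_vars (S : structure) (v : nat -> S) i k :
  [seq teval v t | t <- vars i k] = [seq v j | j <- iota i k].
Proof. by rewrite -map_comp. Qed.

Lemma holds_nats (S : structure) (v : nat -> S) m :
  (forall a, a \in nats m -> holds v a) <-> (forall x, x < m -> @srel S (code SN) [:: v x]).
Proof.
split=> [h x xm|h a /mapP [x]]; last by rewrite mem_iota => /andP [_ xm] ->; apply: h.
by apply: (h (ratom SN [:: V x])); apply: (map_f (fun i => ratom SN [:: V i])); rewrite mem_iota.
Qed.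

Lemma bottom_upP (S : structure) (r : rule) :
  (forall d, d \in bottom_up r -> sat_ded S d) <->
  forall v core, core \in r.2 ->
    (forall x, x < r.1.1.2 + r.1.2 -> @srel S (code SN) [:: v x]) ->
    (forall a, a \in core -> holds v a) ->
    @srel S r.1.1.1 [seq v j | j <- iota 0 r.1.1.2].
Proof.
split=> [sat v core cr /holds_nats vN hc|sat _ /mapP [core cr ->] v body].
  have [|_ /predU1P [->|//] [v' [agr]]] := sat _ (map_f _ cr) v.
    by move=> a /=; rewrite mem_cat => /orP [/vN|/hc].
  move=> /(_ _ (mem_head _ _)) /=; rewrite map_teval_vars.
  by have -> : v' = v by apply: functional_extensionality => x; apply: agr.
exists [:: head_atom r]; first exact: mem_head.
exists v; split=> // _ /predU1P [->|//]; rewrite /= map_teval_vars; apply: (sat v core cr).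
  by apply/holds_nats => a an; apply: body; rewrite /= mem_cat an.
by move=> a ac; apply: body; rewrite /= mem_cat ac orbT.
Qed.

Definition has_both (S : structure) : Prop :=
  @srel S (code SP) [::] /\ @srel S (code SQ) [::].

Lemma holds_both (S : structure) (v : nat -> S) :
  (forall a, a \in both -> holds v a) <-> has_both S.
Proof.
split=> [h|[hP hQ] a]; last by rewrite !inE => /orP [] /eqP ->.
by split; [apply: (h (ratom SP [::])) | apply: (h (ratom SQ [::]))]; rewrite !inE eqxx ?orbT.
Qed.

Lemma top_down_elim (S : structure) (r : rule) (v : nat -> S) :
  sat_ded S (top_down r) -> ~ has_both S ->
  @srel S r.1.1.1 [seq v j | j <- iota 0 r.1.1.2] ->
  exists v' : nat -> S, [/\ forall x, x < r.1.1.2 -> v' x = v x,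
    forall x, x < r.1.1.2 + r.1.2 -> @srel S (code SN) [:: v' x] &
    exists2 core, core \in r.2 & forall a, a \in core -> holds v' a].
Proof.
move=> sat nb hv.
have [|psi pd [v' [agr hpsi]]] := sat v.
  by move=> _ /predU1P [->|//]; rewrite /= map_teval_vars.
move: pd; rewrite /= mem_rcons => /predU1P [e|/mapP [core cr e]].
  by case: nb; apply/(holds_both v'); rewrite -e.
exists v'; split.
- by move=> x xr; apply: agr; rewrite mem_iota /= leqNgt xr.
- by apply/holds_nats => a an; apply: hpsi; rewrite e mem_cat an.
- by exists core => // a ac; apply: hpsi; rewrite e mem_cat ac orbT.
Qed.

Lemma top_down_intro (S : structure) (r : rule) :
  (forall v : nat -> S, @srel S r.1.1.1 [seq v j | j <- iota 0 r.1.1.2] ->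
    exists v' : nat -> S, [/\ forall x, x \notin iota r.1.1.2 r.1.2 -> v' x = v x,
      forall x, x < r.1.1.2 + r.1.2 -> @srel S (code SN) [:: v' x] &
      exists2 core, core \in r.2 & forall a, a \in core -> holds v' a]) ->
  sat_ded S (top_down r).
Proof.
move=> H v body; have := body _ (mem_head _ _); rewrite /= map_teval_vars => /H.
case=> v' [agr /holds_nats vN [core cr hc]].
exists (nats (r.1.1.2 + r.1.2) ++ core).
  by rewrite mem_rcons inE; apply/orP; right; apply: map_f.
exists v'; split=> [|a]; first exact: agr.
by rewrite mem_cat => /orP [/vN|/hc].
Qed.

Lemma Forall2_nth (T U : Type) (P : T -> U -> Prop) t0 u0 s t :
  List.Forall2 P s t ->
  size s = size t /\ forall i, i < size s -> P (nth t0 s i) (nth u0 t i).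
Proof.
elim=> // x y s' t' Pxy _ [sz IH]; split=> [|[|i]] //=; first by rewrite sz.
exact: IH.
Qed.

Lemma nth_Forall2 (T U : Type) (P : T -> U -> Prop) t0 u0 s t :
  size s = size t -> (forall i, i < size s -> P (nth t0 s i) (nth u0 t i)) ->
  List.Forall2 P s t.
Proof.
elim: s t => [|x s IH] [|y t] //= [st] h; constructor; first exact: (h 0).
by apply: IH => // i; apply: (h i.+1).
Qed.

Lemma rules_comp_sub f gs k r i : i < size gs ->
  r \in rules (nth PZero gs i) k -> r \in rules (PComp f gs) k.
Proof.
move=> isz rr; rewrite /= inE mem_cat; apply/orP; right; apply/orP; right.
elim: gs i isz rr => // g gs IH [|i] /= isz rr; rewrite mem_cat ?rr //.
by rewrite (IH i) // orbT.
Qed.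

Lemma mem_comp_core gs k m at0 : m = size gs ->
  at0 \in [seq ratom (SE p.1) (V p.2 :: vars 1 k) | p <- zip gs (iota k.+1 m)] ->
  exists2 i, i < m & at0 = ratom (SE (nth PZero gs i)) (V (k.+1 + i) :: vars 1 k).
Proof.
move=> -> /(nthP (eqa c0 c0)) [i]; rewrite size_map size_zip size_iota minnn => im <-.
exists i => //; rewrite (nth_map (PZero, 0)) ?size_zip ?size_iota ?minnn //.
by rewrite nth_zip ?size_iota //= nth_iota.
Qed.

Lemma comp_core_mem gs k i : i < size gs ->
  ratom (SE (nth PZero gs i)) (V (k.+1 + i) :: vars 1 k) \in
    [seq ratom (SE p.1) (V p.2 :: vars 1 k) | p <- zip gs (iota k.+1 (size gs))].
Proof.
move=> im; apply/(nthP (eqa c0 c0)); exists i.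
  by rewrite size_map size_zip size_iota minnn.
rewrite (nth_map (PZero, 0)) ?size_zip ?size_iota ?minnn //.
by rewrite nth_zip ?size_iota //= nth_iota.
Qed.

(** * Bottom-up rules derive every value *)

Section Complete.
Variables (S : structure) (a : nat -> S).
Hypotheses (a0 : a 0 = sconst S 0) (aN : forall i, @srel S (code SN) [:: a i]).
Hypothesis aS : forall i, @srel S (code SS) [:: a i; a i.+1].

Let w (s : seq nat) (x : nat) : S := a (nth 0 s x).

Lemma teval_w_vars s i k : i + k <= size s ->
  [seq teval (w s) t | t <- vars i k] = [seq a n | n <- take k (drop i s)].
Proof.
move=> le; rewrite map_teval_vars /w (map_comp a (nth 0 s)) map_nth_iota //.
by rewrite leq_subRL; [|apply: leq_trans le; apply: leq_addr].
Qed.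

Lemma bottom_up_apply i r s :
  (forall d, d \in bottom_up r -> sat_ded S d) -> r.1.1.2 <= size s -> i < size r.2 ->
  (forall at0, at0 \in nth [::] r.2 i -> holds (w s) at0) ->
  @srel S r.1.1.1 [seq a n | n <- take r.1.1.2 s].
Proof.
move=> sat sz ir hc; have /bottom_upP H := sat.
have := H (w s) _ (mem_nth [::] ir) (fun x _ => aN _) hc.
by rewrite /w (map_comp a (nth 0 s)) map_nth_iota ?subn0 // drop0.
Qed.

Lemma bottom_up_complete g v z : peval g v z ->
  (forall r, r \in rules g (size v) -> forall d, d \in bottom_up r -> sat_ded S d) ->
  @srel S (code (SE g)) (a z :: map a v).
Proof.
move=> e; elim/peval_nested_ind: g v z / e => [v|v|i v|f gs v ys z es ef IHf|f g v y ef IH|f g n v y z e1 IH1 e2 IH2|f v n e0 IH0 eS] sat.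
(* In all cases [s] lists the values of the variables of the rule, the existential ones coming last,
   and [i] selects the core that matches the last step of the evaluation. *)
- have := bottom_up_apply (i := 0) (s := 0 :: v) (sat _ (mem_head _ _)) _ erefl.
  rewrite /= take_size; apply=> // _ /predU1P [->|//].
  by rewrite /= /w /= a0.
- have := bottom_up_apply (i := 0) (s := (head 0 v).+1 :: v) (sat _ (mem_head _ _)) _ erefl.
  rewrite /= take_size; apply=> // _ /predU1P [->|//] /=.
  suff -> : teval (w ((head 0 v).+1 :: v)) (head c0 (vars 1 (size v))) = a (head 0 v) by exact: aS.
  by case: (v).
- have := bottom_up_apply (i := 0) (s := nth 0 v i :: v) (sat _ (mem_head _ _)) _ erefl.
  rewrite /= take_size; apply=> // _ /predU1P [->|//] /=.
  case: (ltnP i (size v)) => [lt|ge]; last by rewrite !nth_default ?size_map ?size_iota //= /w /= a0.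
  by rewrite (nth_map 0) ?size_iota // nth_iota.
- have [sz esP] := Forall2_nth PZero 0 es.
  have := bottom_up_apply (i := 0) (s := z :: v ++ ys) (sat _ (mem_head _ _)) _ erefl.
  rewrite [(_, _).1]/= /= take_size_cat //; apply=> [|at0].
    by rewrite ltnS size_cat leq_addr.
  rewrite mem_rcons => /predU1P [->|/(mem_comp_core erefl) [i im ->]] /=.
    rewrite teval_w_vars /= ?size_cat ?sz // drop_size_cat // take_size.
    apply: IHf => r rf; apply: sat; rewrite /= sz inE mem_cat rf orbT //.
  rewrite teval_w_vars /= ?size_cat ?leq_addr // drop0 take_size_cat //.
  have -> : w (z :: v ++ ys) ((size v).+1 + i) = a (nth 0 ys i).
    by rewrite /w addSn /= nth_cat ltnNge leq_addr /= addKn.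
  by apply: (esP i im).2 => r ri; apply: sat; apply: rules_comp_sub ri.
- have := bottom_up_apply (i := 0) (s := [:: y, 0 & v]) (sat _ (mem_head _ _)) _ erefl.
  rewrite /= take_size; apply=> // at0; rewrite !inE => /orP [] /eqP -> /=.
    by rewrite /w /= a0.
  rewrite teval_w_vars //= drop0 take_size; apply: IH => r rf; apply: sat.
  by rewrite /= inE mem_cat rf orbT.
- have := bottom_up_apply (i := 1) (s := [:: z, n.+1 & v ++ [:: n; y]]) (sat _ (mem_head _ _)) _ erefl.
  rewrite /= take_size_cat //; apply=> [|at0]; first by rewrite !ltnS size_cat leq_addr.
  rewrite !inE => /or3P [] /eqP -> /=.
  + by rewrite /w /= nth_cat ltnn subnn /=; apply: aS.
  + rewrite teval_w_vars /= ?size_cat ?leq_addr // drop0 take_size_cat //.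
    rewrite /w /= !nth_cat ltnn subnn ltnNge leqnSn subSnn /=.
    exact: IH1.
  + rewrite teval_w_vars /= ?size_cat ?leq_addr // drop0 take_size_cat //.
    rewrite /w /= !nth_cat ltnn subnn ltnNge leqnSn subSnn /=; apply: IH2 => r rg.
    by apply: sat; rewrite /= inE mem_cat rg !orbT.
- have satf r : r \in rules f (size v).+1 -> forall d, d \in bottom_up r -> sat_ded S d.
    by move=> rf; apply: sat; rewrite /= !inE rf !orbT.
  (* The facts [SM] are derived up to the minimum [n], each from the preceding one and a positive
     value of [f]. *)
  have HM m : m <= n -> @srel S (code (SM f)) (a m :: map a v).
    have satM := sat _ (mem_nth (0, 0, 0, [::]) (isT : 1 < size (rules (PMu f) (size v)))).
    elim: m => [_|m IH mn].
      have := bottom_up_apply (i := 0) (s := 0 :: v) satM _ erefl.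
      rewrite /= take_size; apply=> // _ /predU1P [->|//] /=.
      by rewrite /w /= a0.
    have [k [ek IHk]] := eS m mn.
    have := bottom_up_apply (i := 1) (s := m.+1 :: v ++ [:: m; k.+1; k]) satM _ erefl.
    rewrite /= take_size_cat //; apply; first by rewrite ltnS size_cat leq_addr.
    move=> at0; rewrite !inE => /or4P [] /eqP -> /=.
    + by rewrite /w /= nth_cat ltnn subnn /=; apply: aS.
    + rewrite teval_w_vars /= ?size_cat ?leq_addr // drop0 take_size_cat //.
      by rewrite /w /= nth_cat ltnn subnn /=; apply/IH/ltnW.
    + rewrite teval_w_vars /= ?size_cat ?leq_addr // drop0 take_size_cat //.
      rewrite /w /= !nth_cat ltnn subnn ltnNge leqnSn subSnn /=.
      exact: IHk.
    + rewrite /w /= !nth_cat !ltnNge leqnSn (leqW (leqnSn _)) subSnn /=.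
      by rewrite -addn2 addKn /=; apply: aS.
  have := bottom_up_apply (i := 0) (s := n :: v) (sat _ (mem_head _ _)) _ erefl.
  rewrite /= take_size; apply=> // at0; rewrite !inE => /orP [] /eqP -> /=.
    rewrite teval_w_vars //= drop0 take_size -a0 /w /=; exact: IH0.
  by rewrite teval_w_vars //= drop0 take_size /w /=; apply: HM.
Qed.
End Complete.

(** * Standard models *)

Definition sem (ev : prf -> seq nat -> nat -> Prop) (b : bool) (y : sym) (s : seq nat) : Prop :=
  match y with
  | SN => True
  | SS => nth 0 s 1 = (nth 0 s 0).+1
  | SL => nth 0 s 0 < nth 0 s 1
  | SP => b
  | SQ => ~~ b
  | SE g => ev g (behead s) (head 0 s)
  | SM f => forall m, m < head 0 s -> exists k, ev f (m :: behead s) k.+1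
  end.

(** The parameter [ev] is [peval] on the natural numbers and [bpeval B] on [{0, .., B}]. The bit [b]
    tells which of [P] and [Q] holds, the only difference between the two factors used against
    preservation. *)
Definition std (X : Type) (x0 : X) (val : X -> nat) ev b : structure :=
  {| carrier := X; inhabitant := x0; sconst _ := x0;
     srel R s := exists2 y, code y = R & sem ev b y (map val s) |}.

Lemma std_rel (X : Type) (x0 : X) val ev b y s :
  @srel (std x0 val ev b) (code y) s <-> sem ev b y (map val s).
Proof. by split=> [[y' /code_inj ->]|h]; [|exists y]. Qed.

Lemma std_not_both (X : Type) (x0 : X) val ev b : ~ has_both (std x0 val ev b).
Proof. by case=> -[y /code_inj -> /= hP] [y' /code_inj -> /=]; rewrite hP. Qed.

Local Arguments srel : simpl never.

Definition stdN b : structure := std 0 id peval b.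

(** Each core states the premises of a constructor of [peval], or of the recursion on the bound in
    the case of [SM]. *)
Lemma stdN_bottom_up b g k r : r \in rules g k ->
  forall d, d \in bottom_up r -> sat_ded (stdN b) d.
Proof.
have tv (v : nat -> nat) i k' :
    @map term nat (@teval (stdN b) v) (vars i k') = @map nat nat v (iota i k').
  by rewrite /vars -map_comp.
have relE y (s : seq nat) : @srel (stdN b) (code y) s <-> sem peval b y s.
  by have := @std_rel nat 0 id peval b y s; rewrite map_id.
have holdsE (v : nat -> stdN b) y ts : holds v (ratom y ts) <-> sem peval b y (map (teval v) ts).
  exact: relE.
have one P (v : nat -> stdN b) a t :
    (forall at0, at0 \in a :: t -> holds v at0) -> (holds v a -> (forall at0, at0 \in t -> holds v at0) -> P) -> P.
  by move=> h; apply; [apply: h; apply: mem_head | move=> at0 at0t; apply: h; rewrite inE at0t orbT].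
move=> rr; apply/bottom_upP => v core cr _; move: rr cr.
elim/prf_nested_ind: g k => [||i|f gs IHf IHgs|f g IHf IHg|f IHf] k.
- move=> /predU1P [->|//] /predU1P [->|//] /one; apply=> /= e _.
  by apply/(relE (SE _)); rewrite /= e; constructor.
- move=> /predU1P [->|//] /predU1P [->|//] /one; apply=> /holdsE /= e _.
  apply/(relE (SE _)); rewrite /= e.
  suff -> : teval v (head c0 (vars 1 k)) = head 0 (map v (iota 1 k)) by constructor.
  by case: (k).
- move=> /predU1P [->|//] /predU1P [->|//] /one; apply=> /= e _.
  apply/(relE (SE _)); rewrite /= e.
  suff -> : teval v (nth c0 (vars 1 k) i) = nth 0 (map v (iota 1 k)) i by constructor.
  case: (ltnP i k) => [lt|ge]; last by rewrite !nth_default ?size_map ?size_iota.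
  by rewrite !(nth_map 0) ?size_iota.
- rewrite [rules _ _]/= inE mem_cat => /predU1P [->|/orP [rf|rg]]; last first.
  + elim: IHgs rg => // g gs' IHg _ IH; rewrite /= mem_cat => /orP [|]; last exact: IH.
    exact: IHg.
  + exact: IHf rf.
  move=> /predU1P [->|//] h; apply/(relE (SE _)); rewrite /=.
  apply: (@ev_comp _ _ _ (map v (iota k.+1 (size gs)))); last first.
    have /h /holdsE /= : ratom (SE f) (V 0 :: vars k.+1 (size gs)) \in rcons
        [seq ratom (SE p.1) (V p.2 :: vars 1 k) | p <- zip gs (iota k.+1 (size gs))]
        (ratom (SE f) (V 0 :: vars k.+1 (size gs))) by rewrite mem_rcons mem_head.
    by rewrite tv.
  apply: (nth_Forall2 (t0 := PZero) (u0 := 0)); first by rewrite size_map size_iota.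
  move=> i ig; rewrite (nth_map 0) ?size_iota // nth_iota //.
  have /h /holdsE /= : ratom (SE (nth PZero gs i)) (V (k.+1 + i) :: vars 1 k) \in rcons
        [seq ratom (SE p.1) (V p.2 :: vars 1 k) | p <- zip gs (iota k.+1 (size gs))]
        (ratom (SE f) (V 0 :: vars k.+1 (size gs))).
    by rewrite mem_rcons inE comp_core_mem ?orbT.
  by rewrite tv.
- case: k => [|k]; first by move=> /predU1P [->|//].
  rewrite [rules _ _]/= inE mem_cat => /predU1P [->|/orP [/IHf|/IHg]] //.
  rewrite !inE => /orP [] /eqP -> /one; apply=> /= e /one; apply=> /holdsE /=.
    rewrite tv => ef _; apply/(relE (SE _)); rewrite /= e.
    exact: ev_rec0.
  rewrite tv => e1 /one; apply=> /holdsE /=; rewrite tv => e2 _.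
  move: e => /(relE SS) /= e; apply/(relE (SE _)); rewrite /= e.
  exact: ev_recS e1 e2.
- rewrite [rules _ _]/= !inE => /predU1P [->|/predU1P [->|/IHf]] //.
    move=> /predU1P [->|//] /one; apply=> /holdsE /=; rewrite tv => e0.
    move=> /one; apply=> /holdsE /=; rewrite tv => eS _.
    apply/(relE (SE _)); exact: ev_mu.
  rewrite !inE => /orP [] /eqP -> /one; apply=> /= e.
    by move=> _; apply/(relE (SM _)); rewrite /= e.
  move=> /one; apply=> /holdsE /=; rewrite tv => eM.
  move=> /one; apply=> /holdsE /=; rewrite tv => eE.
  move=> /one; apply=> /holdsE /= ek _.
  move: e => /(relE SS) /= e; apply/(relE (SM _)); rewrite /= e => m.
  rewrite ltnS leq_eqVlt => /predU1P [->|/eM //]; exists (v k.+3).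
  by rewrite -ek.
Qed.

(** Evaluation with all values at most [B]. The top-down rules ask for witnesses inside the model,
    so the model on [{0, .., B}] must contain the intermediate values of a computation and not only
    its result. *)
Inductive bpeval (B : nat) : prf -> seq nat -> nat -> Prop :=
  | bev_zero v : bpeval B PZero v 0
  | bev_succ v : head 0 v < B -> bpeval B PSucc v (head 0 v).+1
  | bev_proj i v : nth 0 v i <= B -> bpeval B (PProj i) v (nth 0 v i)
  | bev_comp f gs v ys z :
      List.Forall2 (fun g y => bpeval B g v y) gs ys ->
      bpeval B f ys z -> bpeval B (PComp f gs) v z
  | bev_rec0 f g v y : bpeval B f v y -> bpeval B (PRec f g) (0 :: v) y
  | bev_recS f g n v y z :
      bpeval B (PRec f g) (n :: v) y -> bpeval B g (n :: y :: v) z ->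
      bpeval B (PRec f g) (n.+1 :: v) z
  | bev_mu f v n : n <= B ->
      bpeval B f (n :: v) 0 ->
      (forall m, m < n -> exists k, bpeval B f (m :: v) k.+1) ->
      bpeval B (PMu f) v n.

Lemma bpeval_le B g v z : bpeval B g v z -> z <= B.
Proof. by elim. Qed.

Lemma bpeval_comp_inv B f gs v z : bpeval B (PComp f gs) v z ->
  exists2 ys, List.Forall2 (fun g y => bpeval B g v y) gs ys & bpeval B f ys z.
Proof. by move=> e; inversion e; exists ys. Qed.

Lemma bpeval_rec_inv B f g n v z : bpeval B (PRec f g) (n :: v) z ->
  if n is m.+1 then exists2 y, bpeval B (PRec f g) (m :: v) y & bpeval B g [:: m, y & v] z
  else bpeval B f v z.
Proof. by move=> e; inversion e => //; exists y. Qed.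

(** As the claim covers every larger bound, the bounds of the subderivations combine through [maxn]
    with no separate monotonicity argument. *)
Lemma peval_bpeval g v z : peval g v z -> exists B0, forall B, B0 <= B -> bpeval B g v z.
Proof.
move=> e; elim/peval_nested_ind: g v z / e => [v|v|i v|f gs v ys z es _ [B1 h1]|f g v y _ [B1 h1]|f g n v y z _ [B1 h1] _ [B2 h2]|f v n _ [B1 h1] eS].
- by exists 0 => B _; constructor.
- by exists (head 0 v).+1 => B le; constructor.
- by exists (nth 0 v i) => B le; constructor.
- suff [B2 h2] : exists B2, forall B, B2 <= B -> List.Forall2 (fun g y => bpeval B g v y) gs ys.
    exists (maxn B1 B2) => B; rewrite geq_max => /andP [l1 l2].
    by apply: bev_comp (h2 B l2) (h1 B l1).
  elim: es => [|g y gs' ys' [_ [B3 h3]] _ [B4 h4]]; first by exists 0 => B _; constructor.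
  exists (maxn B3 B4) => B; rewrite geq_max => /andP [l3 l4].
  by constructor; [apply: h3 | apply: h4].
- by exists B1 => B le; apply/bev_rec0/h1.
- exists (maxn B1 B2) => B; rewrite geq_max => /andP [l1 l2].
  exact: bev_recS (h1 B l1) (h2 B l2).
- suff [B2 h2] : exists B2, forall B, B2 <= B -> forall m, m < n -> exists k, bpeval B f (m :: v) k.+1.
    exists (maxn n (maxn B1 B2)) => B; rewrite !geq_max => /and3P [l0 l1 l2].
    by apply: bev_mu l0 (h1 B l1) (h2 B l2).
  elim: n eS {h1 B1} => [|n IH] eS; first by exists 0.
  have [|B3 h3] := IH; first by move=> m mn; apply/eS/ltnW.
  have [k [_ [B4 h4]]] := eS n (ltnSn n).
  exists (maxn B3 B4) => B; rewrite geq_max => /andP [l3 l4] m.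
  rewrite ltnS leq_eqVlt => /predU1P [->|]; last exact: h3.
  by exists k; apply: h4.
Qed.

Definition ne (s : seq nat) (t : term) : nat := if t is inl x then nth 0 s x else 0.

Lemma ne_vars s i k : i + k <= size s -> [seq ne s t | t <- vars i k] = take k (drop i s).
Proof.
move=> le; rewrite -map_comp -(map_nth_iota 0); first by apply: eq_map.
by rewrite leq_subRL; [|apply: leq_trans le; apply: leq_addr].
Qed.

Lemma exists_nth (T : eqType) (P : T -> Prop) x0 (s : seq T) i :
  i < size s -> P (nth x0 s i) -> exists2 x, x \in s & P x.
Proof. by move=> lt Px; exists (nth x0 s i) => //; apply: mem_nth. Qed.

Section Bounded.
Variables (B : nat) (b : bool).

Definition stdF : structure := std (ord0 : 'I_B.+1) val (bpeval B) b.

Definition nsem R s := exists2 y, code y = R & sem (bpeval B) b y s.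

Definition nhold (s : seq nat) (a : atom) : Prop :=
  match a with
  | inl p => nsem p.1 [seq ne s t | t <- p.2]
  | inr p => ne s p.1 = ne s p.2
  end.

Lemma nsemE y s : nsem (code y) s <-> sem (bpeval B) b y s.
Proof. by split=> [[y' /code_inj ->]|h]; last exists y. Qed.

(** The witnesses are read off by inverting the last step of the bounded evaluation. Working with
    lists of numbers postpones the ordinals of [stdF] to a single transfer at the end. *)
Lemma top_down_numeric g k r s0 : r \in rules g k -> size s0 = r.1.1.2 ->
  all (fun n => n <= B) s0 -> nsem r.1.1.1 s0 ->
  exists e, [/\ size e = r.1.2, all (fun n => n <= B) e &
    exists2 core, core \in r.2 & forall a, a \in core -> nhold (s0 ++ e) a].
Proof.
elim/prf_nested_ind: g k r s0 => [||i|f gs IHf IHgs|f g IHf IHg|f IHf] k r s0.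
- move=> /predU1P [->|//] /=; case: s0 => // z v [sv] _ /nsemE /= e.
  exists [::]; split=> //; eexists; first exact: mem_head.
  by move=> _ /predU1P [->|//] /=; inversion e.
- move=> /predU1P [->|//] /=; case: s0 => // z v [sv] _ /nsemE /= e.
  exists [::]; split=> //; eexists; first exact: mem_head.
  move=> _ /predU1P [->|//] /=; apply/(nsemE SS) => /=; rewrite cats0.
  inversion e; subst; congr S; by case: (v).
- move=> /predU1P [->|//] /=; case: s0 => // z v [sv] _ /nsemE /= e.
  exists [::]; split=> //; eexists; first exact: mem_head.
  move=> _ /predU1P [->|//] /=; rewrite cats0; inversion e; subst.
  case: (ltnP i (size v)) => [lt|ge]; last by rewrite !nth_default ?size_map ?size_iota.
  by rewrite (nth_map 0) ?size_iota // nth_iota.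
- rewrite [rules _ _]/= inE mem_cat => /predU1P [->|/orP [rf|rg]]; last first.
  + elim: IHgs rg => // g gs' IHg _ IH; rewrite /= mem_cat => /orP [|]; last exact: IH.
    exact: IHg.
  + exact: IHf rf.
  case: s0 => // z v [sv] _ /(nsemE (SE _)) /= /bpeval_comp_inv [ys es ef]; subst.
  have [sz esP] := Forall2_nth PZero 0 es.
  exists ys; split; [by [] | | eexists; first exact: mem_head].
    apply/(all_nthP 0) => i; rewrite -sz => /esP; exact: bpeval_le.
  move=> at0; rewrite mem_rcons => /predU1P [->|/(mem_comp_core erefl) [i im ->]].
    apply/(nsemE (SE _)); rewrite /= ne_vars /= ?size_cat ?sz //.
    by rewrite drop_size_cat // take_size.
  apply/(nsemE (SE _)); rewrite /= ne_vars /= ?size_cat ?leq_addr //.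
  rewrite drop0 take_size_cat // nth_cat ltnNge leq_addr /= addKn.
  exact: esP.
- case: k => [|k] /=.
    move=> /predU1P [->|//]; case: s0 => // z [|//] _ _ /(nsemE (SE _)) /= e; inversion e.
  rewrite inE mem_cat => /predU1P [->|/orP [/IHf|/IHg]]; try by apply.
  case: s0 => // z [|x v] // [sv] /= /and3P [zB xB _] /(nsemE (SE _)) /= /bpeval_rec_inv; subst.
  case: x xB => [|n] xB => [ef|[y ey ez]].
    (* The base core mentions neither existential variable; both are set to [0]. *)
    exists [:: 0; 0]; split=> //; eexists; first exact: mem_head.
    move=> at0; rewrite !inE => /orP [] /eqP -> //.
    apply/(nsemE (SE _)); rewrite /= ne_vars /= ?size_cat ?leq_addr //.
    by rewrite drop0 take_size_cat.
  exists [:: n; y]; split=> //=; first by rewrite (bpeval_le ey) (ltnW xB).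
  apply: (@exists_nth _ _ [::] _ 1) => //=.
  move=> at0; rewrite !inE => /or3P [] /eqP ->.
  + by apply/(nsemE SS); rewrite /= nth_cat ltnn subnn.
  + apply/(nsemE (SE _)); rewrite /= ne_vars /= ?size_cat ?leq_addr //.
    by rewrite drop0 take_size_cat // !nth_cat ltnn subnn ltnNge leqnSn subSnn.
  + apply/(nsemE (SE _)); rewrite /= ne_vars /= ?size_cat ?leq_addr //.
    by rewrite drop0 take_size_cat // !nth_cat ltnn subnn ltnNge leqnSn subSnn.
- rewrite [rules _ _]/= !inE => /predU1P [->|/predU1P [->|/IHf]]; last by apply.
    case: s0 => // z v [sv] _ /(nsemE (SE _)) /= e; inversion e; subst.
    exists [::]; split=> //; eexists; first exact: mem_head.
    move=> at0; rewrite !inE => /orP [] /eqP ->.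
      apply/(nsemE (SE _)); rewrite /= ne_vars /= ?cats0 //.
      by rewrite drop0 take_size.
    apply/(nsemE (SM _)); rewrite /= ne_vars /= ?cats0 //.
    by rewrite drop0 take_size.
  case: s0 => // z v [sv] /= /andP [zB _] /(nsemE (SM _)) /= eM.
  case: z zB eM => [|m] zB eM.
    exists [:: 0; 0; 0]; split=> //; eexists; first exact: mem_head.
    by move=> at0; rewrite !inE => /eqP ->.
  (* The value [i.+1] is at most [B], so that its predecessor [i] is available as a witness too. *)
  have [i ei] := eM m (ltnSn m); have iB := bpeval_le ei.
  exists [:: m; i.+1; i]; split=> //=; first by rewrite iB (ltnW zB) (ltnW iB).
  apply: (@exists_nth _ _ [::] _ 1) => //=.
  move=> at0; rewrite !inE => /or4P [] /eqP ->.
  + by apply/(nsemE SS); rewrite /= -sv nth_cat ltnn subnn.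
  + apply/(nsemE (SM _)); rewrite /= ne_vars /= ?size_cat -?sv ?leq_addr //.
    rewrite drop0 take_size_cat // nth_cat ltnn subnn /= => j jm.
    by apply: eM; apply: ltnW.
  + apply/(nsemE (SE _)); rewrite /= ne_vars /= ?size_cat -?sv ?leq_addr //.
    by rewrite drop0 take_size_cat // !nth_cat ltnn subnn ltnNge leqnSn subSnn.
  + apply/(nsemE SS); rewrite /= -sv !nth_cat !ltnNge leqnSn (leqW (leqnSn _)) subSnn /=.
    by rewrite -addn2 addKn.
Qed.
End Bounded.

Lemma stdF_top_down B b g k r : r \in rules g k -> sat_ded (stdF B b) (top_down r).
Proof.
move=> rr; have rok := allP (rules_ok g k) _ rr.
apply: top_down_intro => v hv; set s0 := [seq val (v j) | j <- iota 0 r.1.1.2].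
have s0E : map val [seq v j | j <- iota 0 r.1.1.2] = s0 by rewrite -map_comp.
have sz0 : size s0 = r.1.1.2 by rewrite size_map size_iota.
have [||e [sze eB [core cr hc]]] := @top_down_numeric B b g k r s0 rr sz0.
- by apply/allP => _ /mapP [j _ ->]; rewrite -ltnS ltn_ord.
- by rewrite -s0E.
pose v' x : 'I_B.+1 := if x \in iota r.1.1.2 r.1.2 then inord (nth 0 e (x - r.1.1.2)) else v x.
have v'E x : x < r.1.1.2 + r.1.2 -> val (v' x) = nth 0 (s0 ++ e) x.
  move=> xm; rewrite /v' mem_iota xm andbT nth_cat sz0; case: ltnP => lt /=.
    by rewrite (nth_map 0) ?size_iota // nth_iota.
  by rewrite inordK // ltnS; apply/(allP eB)/mem_nth; rewrite sze ltn_subLR.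
exists v'; split=> [x /negbTE xn|x _|]; first by rewrite /v' xn.
  by apply/std_rel.
exists core => // a ac; have ab := allP (allP rok _ cr) _ ac.
have te t : tbound (r.1.1.2 + r.1.2) t -> val (teval (S := stdF B b) v' t) = ne (s0 ++ e) t.
  by case: t => [x|c] //= xm; apply: v'E.
have := hc a ac; case: (a) ab => [[R ts]|[s t]] /= => [/allP tsb|/and3P [sb tb _]] h.
  rewrite /srel /= -map_comp.
  by have -> : map (val \o teval (S := stdF B b) v') ts = map (ne (s0 ++ e)) ts
    by apply/eq_in_map => t /tsb /te.
by apply: val_inj; rewrite !te.
Qed.

(** * Top-down facts are genuine computations *)

Section Sound.
Variables (S : structure) (num : S -> nat).
Hypothesis N0 : @srel S (code SN) [:: sconst S 0].
Hypothesis num0 : num (sconst S 0) = 0.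
Hypothesis numS : forall x y, @srel S (code SN) [:: x] ->
  @srel S (code SS) [:: x; y] -> num y = (num x).+1.
Hypothesis not_both : ~ has_both S.

Lemma top_down_case (r : rule) s : sat_ded S (top_down r) -> @srel S r.1.1.1 s ->
  size s = r.1.1.2 -> exists v : nat -> S, [/\ [seq v j | j <- iota 0 r.1.1.2] = s,
    forall x, x < r.1.1.2 + r.1.2 -> @srel S (code SN) [:: v x] &
    exists2 core, core \in r.2 & forall a, a \in core -> holds v a].
Proof.
move=> sat rs sz; pose v j := nth (inhabitant S) s j.
have vs : [seq v j | j <- iota 0 r.1.1.2] = s.
  by rewrite /v map_nth_iota0 ?sz // -sz take_size.
have [|v' [agr vN hc]] := top_down_elim (v := v) sat not_both; first by rewrite vs.
exists v'; split=> //; rewrite -[RHS]vs; apply/eq_in_map => j; rewrite mem_iota => /andP [_].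
exact: agr.
Qed.

(** Induction on the program, with an inner induction on the number of the recursion argument,
    respectively of the bound in [SM]: the justification of such a fact refers to a predecessor,
    whose number is smaller by [numS]. The atoms [SN] in the heads make [numS] applicable to the
    witnesses. *)
Lemma top_down_sound g k z s : (forall r, r \in rules g k -> sat_ded S (top_down r)) ->
  size s = k -> @srel S (code (SE g)) (z :: s) -> peval g (map num s) (num z).
Proof.
have one P (v : nat -> S) a t :
    (forall at0, at0 \in a :: t -> holds v at0) -> (holds v a -> (forall at0, at0 \in t -> holds v at0) -> P) -> P.
  by move=> h; apply; [apply: h; apply: mem_head | move=> at0 at0t; apply: h; rewrite inE at0t orbT].
elim/prf_nested_ind: g k z s => [||i|f gs IHf IHgs|f g IHf IHg|f IHf] k z s sat sz.
- move=> /(top_down_case (sat _ (mem_head _ _))); rewrite /= sz => /(_ erefl).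
  case=> v [[<- <-] _ [_ /predU1P [->|//] /one]]; apply=> /= e _.
  by rewrite e num0; constructor.
- move=> /(top_down_case (sat _ (mem_head _ _))); rewrite /= sz => /(_ erefl).
  case=> v [[<- <-] vN [_ /predU1P [->|//] /one]]; apply=> /= e _.
  have -> : num (v 0) = (head 0 (map num [seq v j | j <- iota 1 k])).+1; last by constructor.
  case: k {sat sz} vN e => [|k] vN /= e; first by rewrite (numS N0 e) num0.
  by rewrite (numS (vN 1 _) e).
- move=> /(top_down_case (sat _ (mem_head _ _))); rewrite /= sz => /(_ erefl).
  case=> v [[<- <-] vN [_ /predU1P [->|//] /one]]; apply=> /= e _.
  have -> : num (v 0) = nth 0 (map num [seq v j | j <- iota 1 k]) i; last by constructor.
  rewrite e; case: (ltnP i k) => [lt|ge].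
    by rewrite /vars -map_comp !(nth_map 0) ?size_iota.
  by rewrite !nth_default ?size_map ?size_iota.
- move=> /(top_down_case (sat _ (mem_head _ _))); rewrite /= sz => /(_ erefl).
  case=> v [[<- <-] vN [_ /predU1P [->|//] h]].
  apply: (@ev_comp _ _ _ (map num [seq v j | j <- iota k.+1 (size gs)])).
    apply: (nth_Forall2 (t0 := PZero) (u0 := 0)); first by rewrite !size_map size_iota.
    move=> i ig; rewrite (nth_map (inhabitant S)) ?size_map ?size_iota //.
    rewrite (nth_map 0) ?size_iota // nth_iota //=.
    have /h /= : ratom (SE (nth PZero gs i)) (V (k.+1 + i) :: vars 1 k) \in rcons
        [seq ratom (SE p.1) (V p.2 :: vars 1 k) | p <- zip gs (iota k.+1 (size gs))]
        (ratom (SE f) (V 0 :: vars k.+1 (size gs))).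
      by rewrite mem_rcons inE comp_core_mem ?orbT.
    rewrite map_teval_vars; set s' := map v _ => hi.
    have {}sat r : r \in rules (nth PZero gs i) k -> sat_ded S (top_down r).
      by move=> rr; apply: sat; apply: rules_comp_sub rr.
    have sz' : size s' = k by rewrite size_map size_iota.
    move: (v _) hi => z' hi.
    elim: (IHgs) i ig sat hi => // g gs' Pg _ IH [|i] /= ig sat hi; last exact: IH i ig sat hi.
    exact: Pg sat sz' hi.
  have /h /= : ratom (SE f) (V 0 :: vars k.+1 (size gs)) \in rcons
        [seq ratom (SE p.1) (V p.2 :: vars 1 k) | p <- zip gs (iota k.+1 (size gs))]
        (ratom (SE f) (V 0 :: vars k.+1 (size gs))) by rewrite mem_rcons mem_head.
  rewrite map_teval_vars; apply: IHf; last by rewrite size_map size_iota.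
  by move=> r rf; apply: sat; rewrite /= inE mem_cat rf orbT.
- case: k sz sat => [|k] sz sat.
    move=> /(top_down_case (sat _ (mem_head _ _))); rewrite /= sz => /(_ erefl).
    by case=> v [_ _ [core]].
  have satf r : r \in rules f k -> sat_ded S (top_down r).
    by move=> rf; apply: sat; rewrite /= inE mem_cat rf orbT.
  have satg r : r \in rules g k.+2 -> sat_ded S (top_down r).
    by move=> rg; apply: sat; rewrite /= inE mem_cat rg !orbT.
  have [n] : exists n, num (head z s) = n by eexists.
  elim: n z s sz => [|n IH] z s sz en.
    move=> /(top_down_case (sat _ (mem_head _ _))); rewrite /= sz => /(_ erefl).
    case=> v [[ez es] vN [core]]; move: en; rewrite -es -ez /= => en.
    rewrite !inE => /orP [] /eqP -> /one; apply=> /= e /one; apply=> /= e1.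
      move=> _; rewrite en; apply: ev_rec0; move: e1; rewrite map_teval_vars.
      by apply: IHf => //; rewrite size_map size_iota.
    by move: en; rewrite (numS (vN _ _) e) // addn2.
  move=> /(top_down_case (sat _ (mem_head _ _))); rewrite /= sz => /(_ erefl).
  case=> v [[ez es] vN [core]]; move: en; rewrite -es -ez /= => en.
  rewrite !inE => /orP [] /eqP -> /one; apply=> /= e /one; apply=> /= e1.
    by move: en; rewrite e num0.
  move=> /one; apply=> /= e2 _; move: e1 e2; rewrite map_teval_vars => e1 e2.
  have eS : num (v 1) = (num (v k.+2)).+1 by apply: numS e; apply: vN; rewrite addn2.
  rewrite eS; apply: (@ev_recS _ _ _ _ (num (v k.+3))).
    by apply: (IH _ (v k.+2 :: _)) e1; [rewrite /= size_map size_iota | move: en; rewrite eS; case].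
  by apply: (IHg k.+2 (v 0) [:: v k.+2, v k.+3 & _]) e2; rewrite //= size_map size_iota.
- have satf r : r \in rules f k.+1 -> sat_ded S (top_down r).
    by move=> rf; apply: sat; rewrite /= !inE rf !orbT.
  have satM := sat _ (mem_nth (0, 0, 0, [::]) (isT : 1 < size (rules (PMu f) k))).
  have HM n m t : size t = k -> num m = n -> @srel S (code (SM f)) (m :: t) ->
      forall i, i < n -> exists j, peval f (i :: map num t) j.+1.
    elim: n m t => // n IH m t st en.
    move=> /(top_down_case satM); rewrite /= st => /(_ erefl).
    case=> v [[em et] vN [core]]; move: en; rewrite -em -et => en.
    rewrite !inE => /orP [] /eqP -> /one; apply=> /= e.
      by move: en; rewrite e num0.
    move=> /one; apply=> /= e1 /one; apply=> /= e2 /one; apply=> /= e3 _.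
    move: e1 e2; rewrite map_teval_vars => e1 e2 i.
    have e4 : num (v k.+1) = n.
      have N1 : @srel S (code SN) [:: v k.+1] by apply: vN; rewrite addn3 !ltnS (leqW (leqnSn k)).
      by move: en; rewrite (numS N1 e); case.
    rewrite ltnS leq_eqVlt => /predU1P [->|]; last first.
      by apply: (IH _ _ _ e4 e1); rewrite size_map size_iota.
    exists (num (v k.+3)); rewrite -(numS _ e3); last by apply: vN; rewrite addn3.
    rewrite -{1}e4; apply: (IHf k.+1 (v k.+2) (v k.+1 :: _)) e2 => //=.
    by rewrite size_map size_iota.
  move=> /(top_down_case (sat _ (mem_head _ _))); rewrite /= sz => /(_ erefl).
  case=> v [[<- <-] vN [_ /predU1P [->|//] /one]]; apply=> /= e /one; apply=> /= e1 _.
  move: e e1; rewrite map_teval_vars => e e1; have szv : size [seq v j | j <- iota 1 k] = k.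
    by rewrite size_map size_iota.
  apply: ev_mu; last exact: (HM _ _ _ szv erefl e1).
  by have := IHf k.+1 _ (v 0 :: _) satf _ e; rewrite num0 /= szv; apply.
Qed.
End Sound.

(** * Collapse *)

Definition pq : ded := ([::], [::], [:: [:: ratom SP [::]]; [:: ratom SQ [::]]]).

Definition collapse_to (q : nat * nat) : ded :=
  ([::], inl (q.1, vars 0 q.2) :: both, [:: [seq eqa (V i) c0 | i <- iota 0 q.2]]).

Definition collapse_from (q : nat * nat) : ded :=
  ([::], both, [:: [:: inl (q.1, nseq q.2 c0)]]).

Definition collapse (L : seq (nat * nat)) : seq ded :=
  map collapse_to L ++ map collapse_from L.

Definition asyms (a : atom) : seq (nat * nat) :=
  if a is inl p then [:: (p.1, size p.2)] else [::].

Definition syms (Sigma : seq ded) : seq (nat * nat) :=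
  flatten [seq flatten [seq asyms a | a <- ded_atoms d] | d <- Sigma].

(** The collapse determines the value of no other constant, on which an atom of a head could
    depend. *)
Definition const0 (d : ded) : bool :=
  all (fun a => all (fun t => if t is inr c then c == 0 else true) (aterms a)) (ded_atoms d).

Lemma sat_full (S : structure) body head (v : nat -> S) : sat_ded S ([::], body, [:: head]) ->
  (forall a, a \in body -> holds v a) -> forall a, a \in head -> holds v a.
Proof.
move=> sat hb; have [_ /predU1P [->|//] [v' [agr]]] := sat v hb.
by have -> : v' = v by apply: functional_extensionality => x; apply: agr.
Qed.

Lemma collapsed (S : structure) q (s : seq S) : sat_ded S (collapse_to q) -> sat_ded S (collapse_from q) ->
  has_both S -> size s = q.2 -> @srel S q.1 s <-> s = nseq q.2 (sconst S 0).
Proof.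
move=> st sf hb sz; split=> [rs|->].
- pose v := nth (sconst S 0) s.
  have hs : [seq teval v t | t <- vars 0 q.2] = s.
    by rewrite map_teval_vars /v map_nth_iota0 ?sz // -sz take_size.
  have H := sat_full (v := v) st.
  apply: (@eq_from_nth _ (sconst S 0)); first by rewrite size_nseq.
  move=> i; rewrite sz nth_nseq => iq; rewrite iq.
  apply: (H _ (eqa (V i) c0)); last by apply: (map_f (fun i => eqa (V i) c0)); rewrite mem_iota.
  move=> a; rewrite inE => /predU1P [->|]; first by rewrite /= hs.
  by apply: (holds_both v).2 hb _.
- have /= := sat_full (v := fun _ => sconst S 0) sf ((holds_both _).2 hb) (mem_head _ _).
  by rewrite map_nseq.
Qed.

Lemma map_eq_nseq (T : eqType) (U : Type) (f : T -> U) c s n :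
  map f s = nseq n c <-> size s = n /\ forall t, t \in s -> f t = c.
Proof.
elim: s n => [|x s IH] [|n] /=; try by split=> // -[].
split=> [[e /IH [-> h]]|[[sn] h]].
  by split=> // t /predU1P [-> //|/h].
rewrite h ?mem_head //; congr cons; apply/IH; split=> // t ts.
by apply: h; rewrite inE ts orbT.
Qed.

(** In the product every relation of [L] consists of the one tuple whose entries are all [p0]. A
    true body sends its relational variables to [p0]; once the existential variables are sent there
    too, all terms of a head have value [p0], since the dependency is well-formed, and the first
    disjunct is true. *)
Lemma collapsed_preserved (Sigma : seq ded) L :
  (forall d, d \in Sigma -> wf_ded d) -> {subset collapse L <= Sigma} ->
  all const0 Sigma -> {subset syms Sigma <= L} ->
  forall A B, models A Sigma -> models B Sigma -> has_both A -> has_both B ->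
  models (prod_structure A B) Sigma.
Proof.
move=> wS cS /allP c0S sS A B mA mB bA bB d dS v body.
have inL q : q \in L -> (collapse_to q \in Sigma) /\ (collapse_from q \in Sigma).
  by move=> qL; split; apply: cS; rewrite mem_cat map_f ?orbT.
have relP q s : q \in L -> size s = q.2 ->
    @srel (prod_structure A B) q.1 s <-> s = nseq q.2 (sconst A 0, sconst B 0).
  move=> /inL [ct cf] sz.
  have hA := collapsed (s := map fst s) (mA _ ct) (mA _ cf) bA.
  have hB := collapsed (s := map snd s) (mB _ ct) (mB _ cf) bB.
  rewrite /srel /= hA ?size_map // hB ?size_map //; split=> [[e1 e2]|->]; last by rewrite !map_nseq.
  by rewrite -[s]zip_unzip [unzip1 s]e1 [unzip2 s]e2; elim: (q.2) => //= k ->.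
have wd := wS d dS; case: (wd) => hd _ exd.
have symL a : a \in ded_atoms d -> {subset asyms a <= L}.
  move=> ad q qa; apply: sS; apply/flatten_mapP; exists d => //.
  by apply/flatten_mapP; exists a.
pose p0 : prod_structure A B := (sconst A 0, sconst B 0).
have vbody x : x \in relvars (ded_body d) -> v x = p0.
  case/flatten_mapP => -[[R ts]|//] ab /flatten_mapP [[y|//] ty]; rewrite inE => /eqP ->.
  have RL : (R, size ts) \in L by apply: (symL _ (body_ded_atoms ab)); rewrite inE.
  have := body _ ab; rewrite /= (relP (R, size ts)) ?size_map //= => e.
  by case/map_eq_nseq: e => _ /(_ _ ty).
case: d dS v body wd hd exd symL vbody => [[exs bd] [|psi hs]] //=.
rewrite /ded_exvars /ded_body /ded_heads /= => dS v body wd _ exd symL vbody.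
exists psi; first exact: mem_head.
exists (fun z => if z \in exs then p0 else v z); split=> [z /negbTE -> //|a ap].
have ad : a \in ded_atoms (exs, bd, psi :: hs) by apply: head_ded_atoms ap; apply: mem_head.
have te t : t \in aterms a ->
    teval (fun z => if z \in exs then p0 else v z) t = p0.
  case: t => [x|c] ta /=; last first.
    have := allP (allP (c0S _ dS) a ad) _ ta => /= /eqP ->; reflexivity.
  case: ifP => // /negbT xe; apply: vbody.
  by apply: (exd psi a x (mem_head _ _) ap _ xe); rewrite mem_avars.
have := symL a ad; case: (a) te => [[R ts]|[s t]] /= te sub.
  apply/(relP (R, size ts)); rewrite ?size_map //; first by apply: sub; rewrite inE.
  by apply/map_eq_nseq.
by rewrite !te ?inE ?eqxx ?orbT.
Qed.

Lemma collapse_vacuous (S : structure) L d : ~ has_both S -> d \in collapse L -> sat_ded S d.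
Proof.
move=> nb; rewrite mem_cat => /orP [] /mapP [q _ ->] v body; case: nb.
  by apply/(holds_both v) => a ab; apply: body; rewrite inE ab orbT.
exact/(holds_both v).
Qed.

(** Only [r] depends on the input. The symbols to be collapsed are taken from a fixed instance [d0]
    whose symbols include those of [r], so that everything else is a constant of the reduction. *)
Definition gadget (d0 : ded) (T : seq ded) (r : ded) : seq ded :=
  r :: pq :: T ++ collapse (syms (d0 :: pq :: T)).

Lemma const0_collapse q L : q \in collapse L -> const0 q.
Proof.
rewrite mem_cat => /orP [] /mapP [[R k] _ ->]; rewrite /const0 /ded_atoms /= ?cats0.
  by rewrite !all_map; apply/andP; split; apply/allP.
by rewrite andbT; apply/allP => _ /nseqP [-> _].
Qed.

Lemma wf_collapse q L : q \in collapse L -> wf_ded q.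
Proof.
rewrite mem_cat => /orP [] /mapP [[R k] _ ->]; split=> //=.
- move=> psi a x; rewrite inE => /eqP -> /mapP [i ik ->] /=; rewrite inE => /eqP -> _.
  rewrite mem_cat; apply/orP; left; apply/flatten_mapP; exists (V i); last exact: mem_head.
  exact: map_f.
- move=> psi a x; rewrite inE => /eqP ->; rewrite inE => /eqP -> /flatten_mapP [t /nseqP [-> _]] //.
Qed.

(** The collapsing dependencies mention [P] and [Q] besides their own symbol, so these two must be
    collapsed as well for all symbols to be covered. *)
Lemma syms_collapse L : (code SP, 0) \in L -> (code SQ, 0) \in L ->
  {subset syms (collapse L) <= L}.
Proof.
move=> LP LQ q /flatten_mapP [d]; rewrite mem_cat => /orP [] /mapP [[R k] RL ->].
  move=> /flatten_mapP [a]; rewrite /ded_atoms /= cats0.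
  rewrite !inE => /or4P [/eqP ->|/eqP ->|/eqP ->|/mapP [i _ ->]] //=; rewrite inE => /eqP -> //.
  by rewrite size_map size_iota.
move=> /flatten_mapP [a]; rewrite !inE => /or3P [] /eqP -> /=; rewrite inE => /eqP -> //.
by rewrite size_nseq.
Qed.

Lemma syms_cat Sigma Sigma' : syms (Sigma ++ Sigma') = syms Sigma ++ syms Sigma'.
Proof. by rewrite /syms map_cat flatten_cat. Qed.

Lemma mem_syms (Sigma : seq ded) d a q : d \in Sigma -> a \in ded_atoms d ->
  q \in asyms a -> q \in syms Sigma.
Proof.
by move=> dS ad qa; apply/flatten_mapP; exists d => //; apply/flatten_mapP; exists a.
Qed.

Section Gadget.
Variables (d0 : ded) (T : seq ded) (r : ded).
Hypothesis wfT : forall d, d \in T -> wf_ded d.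
Hypotheses (wfr : wf_ded r) (cT : all const0 T) (cr : const0 r).
Hypothesis sr : {subset syms [:: r] <= syms [:: d0]}.

Lemma mem_gadget d : d \in T -> d \in gadget d0 T r.
Proof. by move=> dT; rewrite !inE mem_cat dT !orbT. Qed.

Lemma wf_gadget d : d \in gadget d0 T r -> wf_ded d.
Proof.
rewrite !inE mem_cat => /or4P [/eqP ->|/eqP ->|/wfT|/wf_collapse] //.
by apply/wfP.
Qed.

Lemma gadget_preserved A B : models A (gadget d0 T r) -> models B (gadget d0 T r) ->
  has_both A -> has_both B -> models (prod_structure A B) (gadget d0 T r).
Proof.
set L := syms (d0 :: pq :: T).
have LP : (code SP, 0) \in L by apply: (@mem_syms _ pq (ratom SP [::])); rewrite !inE eqxx ?orbT.
have LQ : (code SQ, 0) \in L by apply: (@mem_syms _ pq (ratom SQ [::])); rewrite !inE eqxx ?orbT.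
apply: (@collapsed_preserved _ L).
- exact: wf_gadget.
- by move=> d dc; rewrite !inE mem_cat dc !orbT.
- rewrite /= cr all_cat cT /=; apply/allP => d; exact: const0_collapse.
- have LE : L = syms [:: d0] ++ syms (pq :: T) by rewrite -syms_cat.
  have -> : gadget d0 T r = [:: r] ++ (pq :: T) ++ collapse L by [].
  move=> q; rewrite 2!syms_cat mem_cat [q \in syms (pq :: T) ++ _]mem_cat => /or3P [qr|qT|qc].
  + by rewrite LE mem_cat sr.
  + by rewrite LE mem_cat qT orbT.
  + exact: syms_collapse qc.
Qed.

Lemma gadget_std (X : Type) (x0 : X) val ev b :
  models (std x0 val ev b) T -> sat_ded (std x0 val ev b) r ->
  models (std x0 val ev b) (gadget d0 T r).
Proof.
move=> mT mr d; rewrite !inE mem_cat => /or4P [/eqP ->|/eqP ->|/mT|] //; last first.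
  exact: collapse_vacuous (@std_not_both _ _ _ _ _).
move=> v _; case: (b).
  exists [:: ratom SP [::]]; first exact: mem_head.
  by exists v; split=> // _ /predU1P [->|//]; apply/std_rel.
exists [:: ratom SQ [::]]; first by rewrite !inE eqxx orbT.
by exists v; split=> // _ /predU1P [->|//]; apply/std_rel.
Qed.

(** Each of [P] and [Q] is missing from one factor, hence from the product, where [pq] fails. *)
Lemma gadget_not_preserved (X : Type) (x0 : X) val ev :
  ~ models (prod_structure (std x0 val ev true) (std x0 val ev false)) (gadget d0 T r).
Proof.
move=> m; have pin : pq \in gadget d0 T r by rewrite !inE eqxx orbT.
have [//|psi pd [v' [_ hv]]] := m pq pin (fun _ => (x0, x0)).
move: pd hv; rewrite !inE => /orP [] /eqP -> /(_ _ (mem_head _ _)) [].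
  by move=> _ /std_rel.
by move=> /std_rel.
Qed.
End Gadget.

(** * Well-formedness and constants of the dependencies *)

Lemma mem_relvars_nats m x s : x < m -> x \in relvars (nats m ++ s).
Proof.
move=> xm; rewrite /relvars map_cat flatten_cat mem_cat; apply/orP; left.
apply/flatten_mapP; exists (ratom SN [:: V x]); last exact: mem_head.
by apply: (map_f (fun i => ratom SN [:: V i])); rewrite mem_iota.
Qed.

Lemma abound_var m a x : abound m a -> x \in avars a -> x < m.
Proof. by rewrite mem_avars => /allP ab /ab. Qed.

Lemma abound_head r : abound r.1.1.2 (head_atom r).
Proof. by apply: tbound_vars; rewrite add0n. Qed.

Lemma abound_nats m : all (abound m) (nats m).
Proof.
by rewrite all_map; apply/allP => i; rewrite mem_iota => /andP [_ im]; rewrite /abound /= im.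
Qed.

Lemma wf_bottom_up r d : rule_ok r -> d \in bottom_up r -> wf_ded d.
Proof.
move=> rok /mapP [core cr ->]; split=> //= psi a x; rewrite inE => /eqP ->.
rewrite inE => /eqP -> /(abound_var (abound_head r)) xr _.
by apply: mem_relvars_nats; apply: ltn_addr.
Qed.

Lemma wf_top_down r : rule_ok r -> wf_ded (top_down r).
Proof.
move=> /allP rok; split=> /=.
- by rewrite -size_eq0 size_rcons.
- move=> a x; rewrite inE => /eqP -> /(abound_var (abound_head r)) xr.
  by rewrite mem_iota leqNgt xr.
- move=> psi a x; rewrite mem_rcons => /predU1P [->|/mapP [core cr ->]] ap xa xn.
    by move: ap xa; rewrite !inE => /orP [] /eqP ->.
  have ab : abound (r.1.1.2 + r.1.2) a.
    move: ap; rewrite mem_cat => /orP [/(allP (abound_nats _)) //|ac].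
    exact: (allP (rok _ cr)).
  have := abound_var ab xa => xm; move: xn; rewrite mem_iota xm andbT -ltnNge => xr.
  rewrite /relvars /= cats0; apply/flatten_mapP; exists (V x); last exact: mem_head.
  by apply: map_f; rewrite mem_iota.
Qed.

Lemma const0_abound m (d : ded) : all (abound m) (ded_atoms d) -> const0 d.
Proof. by apply: sub_all => a; apply: sub_all => -[]. Qed.

Lemma abound_weak m n a : m <= n -> abound m a -> abound n a.
Proof. by move=> mn; apply: sub_all => -[x|c] //= /leq_trans; apply. Qed.

Lemma const0_bottom_up r d : rule_ok r -> d \in bottom_up r -> const0 d.
Proof.
move=> /allP rok /mapP [core cr ->]; apply: (@const0_abound (r.1.1.2 + r.1.2)).
rewrite /ded_atoms /= all_cat all_cat abound_nats (rok _ cr) /= andbT.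
exact: abound_weak (leq_addr _ _) (abound_head r).
Qed.

Lemma const0_top_down r : rule_ok r -> const0 (top_down r).
Proof.
move=> /allP rok; apply: (@const0_abound (r.1.1.2 + r.1.2)).
rewrite /ded_atoms /= (abound_weak (leq_addr _ _) (abound_head r)) /=.
apply/allP => a /flattenP [psi]; rewrite mem_rcons => /predU1P [->|/mapP [core cr ->]].
  by rewrite !inE => /orP [] /eqP ->.
rewrite mem_cat => /orP [/(allP (abound_nats _)) //|ac].
exact: (allP (rok _ cr)).
Qed.

(* [chain c n] says that [x_0, .., x_n] are the numerals [0, .., n], and that [c]
   evaluates to [x_(n+1)] on [x_n]. *)
Definition chain (c : prf) (n : nat) : seq atom :=
  eqa (V 0) c0 :: [seq ratom SS [:: V i; V i.+1] | i <- iota 0 n] ++ [:: ratom (SE c) [:: V n.+1; V n]].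

Lemma abound_chain c n : all (abound n.+2) (chain c n).
Proof.
rewrite /= all_cat all_map /abound /= !ltnS leqnn leqnSn !andbT.
apply/allP => i; rewrite mem_iota add0n => /andP [_ ii].
by rewrite /= !ltnS (ltnW ii) leqW ?(ltnW ii).
Qed.

Lemma holds_chain (S : structure) (v : nat -> S) c n :
  (forall a, a \in chain c n -> holds v a) <->
  [/\ v 0 = sconst S 0, forall i, i < n -> @srel S (code SS) [:: v i; v i.+1] &
      @srel S (code (SE c)) [:: v n.+1; v n]].
Proof.
split=> [h|[h0 hS hE] a].
  split.
  - by apply: (h (eqa (V 0) c0)); apply: mem_head.
  - move=> i ii; apply: (h (ratom SS [:: V i; V i.+1])).
    rewrite inE mem_cat; apply/orP; right; apply/orP; left.
    by apply: (map_f (fun i => ratom SS [:: V i; V i.+1])); rewrite mem_iota.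
  - by apply: (h (ratom (SE c) [:: V n.+1; V n])); rewrite inE mem_cat mem_head !orbT.
rewrite inE mem_cat => /or3P [/eqP ->|/mapP [i ii ->]|] //.
  by apply: hS; move: ii; rewrite mem_iota.
by rewrite inE => /eqP ->.
Qed.

Definition query (c : prf) (n : nat) : ded := ([::], chain c n, [:: both]).
Definition assertion (c : prf) (n : nat) : ded := (iota 0 n.+2, [::], [:: chain c n]).

Lemma wf_query c n : wf_ded (query c n).
Proof.
split=> // psi a x; rewrite inE => /eqP ->.
by rewrite !inE => /orP [] /eqP ->.
Qed.

Lemma wf_assertion c n : wf_ded (assertion c n).
Proof.
split=> // psi a x; rewrite inE => /eqP -> ac xa.
by rewrite mem_iota /= (abound_var (allP (abound_chain c n) _ ac) xa).
Qed.

Lemma const0_query c n : const0 (query c n).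
Proof.
apply: (@const0_abound n.+2); apply/allP => a; rewrite mem_cat => /orP [].
  exact: (allP (abound_chain c n)).
by rewrite !inE => /orP [] /eqP ->.
Qed.

Lemma const0_assertion c n : const0 (assertion c n).
Proof.
apply: (@const0_abound n.+2); apply/allP => a; rewrite mem_cat => /orP [//|].
rewrite [flatten _]cats0; exact: (allP (abound_chain c n)).
Qed.

(** A longer chain has no new symbol once there is a successor atom in it. The chain of length [0]
    has none, hence the instance [1] as the fixed one. *)
Lemma asyms_chain c n : {subset flatten [seq asyms a | a <- chain c n] <= flatten [seq asyms a | a <- chain c 1]}.
Proof.
move=> q /flatten_mapP [a]; rewrite inE mem_cat => /or3P [/eqP ->|/mapP [i _ ->]|] //.
  by rewrite inE => /eqP ->; apply/flatten_mapP; exists (ratom SS [:: V 0; V 1]); rewrite !inE eqxx ?orbT.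
rewrite inE => /eqP ->; rewrite inE => /eqP ->; apply/flatten_mapP.
by exists (ratom (SE c) [:: V 2; V 1]); rewrite !inE eqxx ?orbT.
Qed.

Lemma syms_query c n : {subset syms [:: query c n] <= syms [:: query c 1]}.
Proof.
move=> q /flatten_mapP [d]; rewrite inE => /eqP -> /flatten_mapP [a].
rewrite mem_cat => /orP [ac|ab] qa; last first.
  by apply: (mem_syms (mem_head _ _) _ qa); rewrite mem_cat ab orbT.
have /asyms_chain /flatten_mapP [a' a'c qa'] : q \in flatten [seq asyms a | a <- chain c n].
  by apply/flatten_mapP; exists a.
by apply: (mem_syms (mem_head _ _) _ qa'); rewrite mem_cat a'c.
Qed.

Lemma syms_assertion c n : {subset syms [:: assertion c n] <= syms [:: assertion c 1]}.
Proof.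
move=> q /flatten_mapP [d]; rewrite inE => /eqP -> /flatten_mapP [a].
rewrite mem_cat => /orP [//|]; rewrite [flatten _]cats0 => ac qa.
have /asyms_chain /flatten_mapP [a' a'c qa'] : q \in flatten [seq asyms a | a <- chain c n].
  by apply/flatten_mapP; exists a.
by apply: (mem_syms (mem_head _ _) _ qa'); rewrite mem_cat [flatten _]cats0 a'c orbT.
Qed.

(** * The theories of the two reductions *)

Definition zero_is_number : ded := ([::], [::], [:: [:: ratom SN [:: c0]]]).

Definition infinite_theory (c : prf) : seq ded :=
  [:: zero_is_number;
      ([:: 1], [:: ratom SN [:: V 0]], [:: [:: ratom SN [:: V 1]; ratom SS [:: V 0; V 1]]])]
  ++ flatten [seq bottom_up r | r <- rules c 1].

(** Here too [both] stands for falsity. In a finite model the strict order excludes infinite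
    descent, so that every number reaches [c0] through finitely many predecessors. That [c0] has no
    predecessor and that predecessors are unique makes the number of steps well defined. *)
Definition finite_theory (c : prf) : seq ded :=
  [:: zero_is_number;
      ([::], [:: ratom SS [:: V 0; V 1]], [:: [:: ratom SL [:: V 0; V 1]]]);
      ([::], [:: ratom SL [:: V 0; V 1]; ratom SL [:: V 1; V 2]],
         [:: [:: ratom SL [:: V 0; V 2]]]);
      ([::], [:: ratom SL [:: V 0; V 0]], [:: both]);
      ([:: 1], [:: ratom SN [:: V 0]],
         [:: [:: eqa (V 0) c0]; [:: ratom SN [:: V 1]; ratom SS [:: V 1; V 0]]]);
      ([::], [:: ratom SS [:: V 0; c0]], [:: both]);
      ([::], [:: ratom SS [:: V 0; V 2]; ratom SS [:: V 1; V 2]], [:: [:: eqa (V 0) (V 1)]])]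
  ++ [seq top_down r | r <- rules c 1].

Lemma wf_infinite_theory c d : d \in infinite_theory c -> wf_ded d.
Proof.
rewrite mem_cat => /orP [|/flatten_mapP [r rr]].
  by rewrite !inE => /orP [] /eqP ->; apply/wfP.
exact/wf_bottom_up/(allP (rules_ok c 1)).
Qed.

Lemma const0_infinite_theory c : all const0 (infinite_theory c).
Proof.
apply/allP => d; rewrite mem_cat => /orP [|/flatten_mapP [r rr]].
  by rewrite !inE => /orP [] /eqP ->.
exact/const0_bottom_up/(allP (rules_ok c 1)).
Qed.

Lemma wf_finite_theory c d : d \in finite_theory c -> wf_ded d.
Proof.
rewrite mem_cat => /orP [|/mapP [r rr ->]].
  by rewrite !inE => H; apply/wfP; move: H; do ![case/orP => [/eqP -> //|]]; move/eqP => ->.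
exact/wf_top_down/(allP (rules_ok c 1)).
Qed.

Lemma const0_finite_theory c : all const0 (finite_theory c).
Proof.
apply/allP => d; rewrite mem_cat => /orP [|/mapP [r rr ->]].
  by rewrite !inE; do ![case/orP => [/eqP -> //|]]; move/eqP => ->.
exact/const0_top_down/(allP (rules_ok c 1)).
Qed.

Lemma serial_choice (T : Type) (P : T -> Prop) (R : T -> T -> Prop) x0 :
  P x0 -> (forall x, P x -> exists y, P y /\ R x y) ->
  exists f : nat -> T, [/\ f 0 = x0, forall i, P (f i) & forall i, R (f i) (f i.+1)].
Proof.
move=> P0 ser.
pose step (u : {x | P x}) : {x | P x} :=
  let: exist y Py := constructive_indefinite_description _ (ser _ (proj2_sig u)) in
  exist P y Py.1.
exists (fun i => sval (iter i step (exist P x0 P0))); split=> // [i|i]; first exact: svalP.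
rewrite iterS {2}/step; case: constructive_indefinite_description => y [Py Ry] /=.
exact: Ry.
Qed.

Lemma zero_number (S : structure) :
  sat_ded S zero_is_number -> @srel S (code SN) [:: sconst S 0].
Proof.
move=> sat; have H := sat_full (v := fun _ => inhabitant S) sat.
by apply: (H _ (ratom SN [:: c0])) => //; apply: mem_head.
Qed.

Lemma infinite_theory_complete c n y (S : structure) : peval c [:: n] y ->
  models S (infinite_theory c) -> sat_ded S (query c n) -> has_both S.
Proof.
move=> ev mS sq.
have N0 := zero_number (mS _ (mem_head _ _)).
have [|a [a0 aN aS]] := @serial_choice S (fun x => @srel S (code SN) [:: x])
    (fun x y => @srel S (code SS) [:: x; y]) _ N0.
  move=> x Nx; have sat := mS _ (mem_nth zero_is_number (isT : 1 < size (infinite_theory c))).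
  have [|psi] := sat (fun _ => x).
    by move=> _ /predU1P [->|//].
  rewrite inE => /eqP -> [v' [agr h]]; exists (v' 1); split.
    by apply: (h (ratom SN [:: V 1])); apply: mem_head.
  have <- : v' 0 = x by apply: agr.
  by apply: (h (ratom SS [:: V 0; V 1])); rewrite !inE eqxx orbT.
have bu r : r \in rules c (size [:: n]) -> forall d, d \in bottom_up r -> sat_ded S d.
  by move=> rr d dr; apply: mS; rewrite mem_cat; apply/orP; right; apply/flatten_mapP; exists r.
have := bottom_up_complete a0 aN aS ev bu => /= E.
(* The last variable of the chain, [x_(n+1)], carries the value of [c]. *)
pose v i := if i == n.+1 then a y else a i.
apply/(holds_both v); apply: (sat_full sq); rewrite {}/v.
apply/holds_chain; split=> [|i ii|]; rewrite ?eqxx //.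
  by rewrite !ltn_eqF // ltnS ltnW.
by rewrite ltn_eqF.
Qed.

Lemma stdN_infinite_theory b c : models (stdN b) (infinite_theory c).
Proof.
move=> d; rewrite mem_cat => /orP [|/flatten_mapP [r rr]]; last exact: stdN_bottom_up rr d.
rewrite !inE => /orP [] /eqP -> v _; (eexists; first exact: mem_head).
  by exists v; split=> // _ /predU1P [->|//]; apply/std_rel.
exists (fun x => if x == 1 then (v 0).+1 else v x); split=> [z|a].
  by rewrite inE => /negbTE ->.
by rewrite !inE => /orP [] /eqP ->; apply/std_rel.
Qed.

(** It holds vacuously: in the standard model the chain consists of the genuine numerals, so that a
    true body would exhibit a value of [c] on [n]. *)
Lemma stdN_query b c n : ~ (exists y, peval c [:: n] y) -> sat_ded (stdN b) (query c n).
Proof.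
move=> nh v /holds_chain [v0 vS /std_rel /= vE]; case: nh; exists (v n.+1).
have vi i : i <= n -> v i = i.
  elim: i => // i IH ii.
  by have /std_rel /= := vS i ii; rewrite (IH (ltnW ii)).
by move: vE; rewrite (vi n).
Qed.

(** * Heights of numbers in finite models *)

Section Finite.
Variables (S : structure) (c : prf) (n : nat).
Hypotheses (finS : finite_structure S) (mS : models S (finite_theory c)).
Hypotheses (aS : sat_ded S (assertion c n)) (nb : ~ has_both S).

Let NN x := @srel S (code SN) [:: x].
Let SS' x y := @srel S (code SS) [:: x; y].
Let LL x y := @srel S (code SL) [:: x; y].
Let z0 := sconst S 0.

Let axiom i : i < size (finite_theory c) -> sat_ded S (nth zero_is_number (finite_theory c) i).
Proof. by move=> ii; apply/mS/mem_nth. Qed.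

Let v3 (x y z : S) i := nth x [:: x; y; z] i.

Lemma fin_N0 : NN z0.
Proof. exact: zero_number (@axiom 0 isT). Qed.

Lemma fin_SL x y : SS' x y -> LL x y.
Proof.
move=> xy; have := sat_full (v := v3 x y y) (@axiom 1 isT).
by move=> H; apply: (H _ (ratom SL [:: V 0; V 1])); [move=> _ /predU1P [->|//] | apply: mem_head].
Qed.

Lemma fin_Ltrans x y z : LL x y -> LL y z -> LL x z.
Proof.
move=> xy yz; have := sat_full (v := v3 x y z) (@axiom 2 isT).
move=> H; apply: (H _ (ratom SL [:: V 0; V 2])); last exact: mem_head.
by move=> a; rewrite !inE => /orP [] /eqP ->.
Qed.

Lemma fin_Lirr x : ~ LL x x.
Proof.
move=> xx; apply: nb; apply/(holds_both (v3 x x x)).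
by apply: (sat_full (v := v3 x x x) (@axiom 3 isT)) => _ /predU1P [->|//].
Qed.

Lemma fin_pred x : NN x -> x = z0 \/ exists y, NN y /\ SS' y x.
Proof.
move=> Nx; have [|psi] := @axiom 4 isT (v3 x x x); first by move=> _ /predU1P [->|//].
rewrite !inE => /orP [] /eqP -> [v' [agr h]]; have v0 : v' 0 = x by apply: agr.
  by left; rewrite -v0; apply: (h (eqa (V 0) c0)); apply: mem_head.
right; exists (v' 1); split; first by apply: (h (ratom SN [:: V 1])); apply: mem_head.
by rewrite -v0; apply: (h (ratom SS [:: V 1; V 0])); rewrite !inE eqxx orbT.
Qed.

Lemma fin_S0 x : ~ SS' x z0.
Proof.
move=> xx; apply: nb; apply/(holds_both (v3 x x x)).
by apply: (sat_full (v := v3 x x x) (@axiom 5 isT)) => _ /predU1P [->|//].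
Qed.

Lemma fin_Sinj x y z : SS' x z -> SS' y z -> x = y.
Proof.
move=> xz yz; have := sat_full (v := v3 x y z) (@axiom 6 isT).
move=> H; apply: (H _ (eqa (V 0) (V 1))); last exact: mem_head.
by move=> a; rewrite !inE => /orP [] /eqP ->.
Qed.

(** The height above [z0], kept as a relation because an arbitrary element need not have one. *)
Inductive isnum : S -> nat -> Prop :=
  | isnum0 : isnum z0 0
  | isnumS x y i : SS' x y -> isnum x i -> isnum y i.+1.

Lemma isnum_inv x i : isnum x i ->
  if i is j.+1 then exists2 y, SS' y x & isnum y j else x = z0.
Proof. by case=> // {}x y j xy xj; exists x. Qed.

Lemma isnum_fun x i j : isnum x i -> isnum x j -> i = j.
Proof.
elim: i x j => [|i IH] x [|j] //.
- by move=> /isnum_inv -> /isnum_inv [y /fin_S0].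
- by move=> /isnum_inv [y yx _] /isnum_inv e; move: yx; rewrite e => /fin_S0.
- move=> /isnum_inv [y yx yi] /isnum_inv [z zx zj]; congr (_.+1).
  by apply: IH yi _; rewrite (fin_Sinj yx zx).
Qed.

(** A number without a height has a predecessor without a height, so dependent choice yields an
    infinite descent, whose members are distinct by the strict order. The pigeonhole principle
    excludes it. *)
Lemma number_isnum x : NN x -> exists i, isnum x i.
Proof.
move=> Nx; apply: NNPP => nx.
have [||f [_ fP fS]] := @serial_choice S (fun x => NN x /\ ~ exists i, isnum x i)
    (fun x y => SS' y x) x.
- by [].
- move=> y [Ny ny]; have [y0|[z [Nz zy]]] := fin_pred Ny.
    by case: ny; exists 0; rewrite y0; constructor.
  exists z; do !split=> //; move=> [i zi]; apply: ny; exists i.+1; exact: isnumS zy zi.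
have fL i j : i < j -> LL (f j) (f i).
  elim: j => // j IH; rewrite ltnS leq_eqVlt => /predU1P [->|/IH ji].
    exact/fin_SL/fS.
  exact: fin_Ltrans (fin_SL (fS j)) ji.
have [k [g gs]] := finS.
(* A section of the enumeration embeds [S] into ['I_k], where [k.+1] distinct members of the descent
   do not fit. *)
have [h hP] : exists h : S -> 'I_k, forall x, g (h x) = x.
  exists (fun x => sval (constructive_indefinite_description _ (gs x))) => u.
  by case: constructive_indefinite_description.
have ninj : ~ injective (fun i : 'I_k.+1 => h (f i)).
  by move=> /leq_card; rewrite !card_ord ltnn.
apply: ninj => i j /(congr1 g); rewrite !hP => e; apply: val_inj.
case: (ltngtP (val i) (val j)) => // /fL; rewrite e; by move/fin_Lirr.
Qed.

Lemma finite_theory_sound : exists y, peval c [:: n] y.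
Proof.
(* Elements without a height get the arbitrary number [0]; the condition on successors only concerns
   numbers. *)
pose num x := if excluded_middle_informative (exists i, isnum x i) is left e
  then sval (constructive_indefinite_description _ e) else 0.
have numE x i : isnum x i -> num x = i.
  move=> xi; rewrite /num; case: excluded_middle_informative => [e|[]]; last by exists i.
  by case: constructive_indefinite_description => j /= xj; apply: isnum_fun xj xi.
have td r : r \in rules c 1 -> sat_ded S (top_down r).
  by move=> rr; apply: mS; rewrite mem_cat map_f ?orbT.
have [//|psi] := @aS (fun _ => z0); rewrite inE => /eqP -> [w [_ /holds_chain [w0 wS wE]]].
have wn i : i <= n -> isnum (w i) i.
  elim: i => [_|i IH ii]; first by rewrite w0; constructor.
  exact: isnumS (wS i ii) (IH (ltnW ii)).
exists (num (w n.+1)).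
have := @top_down_sound S num fin_N0 (numE _ _ isnum0) _ nb c 1 (w n.+1) [:: w n] td erefl wE.
rewrite /= (numE _ _ (wn n (leqnn n))); apply=> x y Nx xy.
have [i xi] := number_isnum Nx.
by rewrite (numE _ _ xi) (numE _ _ (isnumS xy xi)).
Qed.
End Finite.

Lemma stdF_finite_theory B b c : models (stdF B b) (finite_theory c).
Proof.
move=> d; rewrite mem_cat => /orP [|/mapP [r rr ->]]; last exact: stdF_top_down rr.
rewrite !inE => /orP [/eqP ->|/orP [/eqP ->|/orP [/eqP ->|/orP [/eqP ->|/orP [/eqP ->|/orP [/eqP ->|/eqP ->]]]]]] v body.
- eexists; first exact: mem_head.
  by exists v; split=> // _ /predU1P [->|//]; apply/std_rel.
- eexists; first exact: mem_head.
  exists v; split=> // _ /predU1P [->|//]; apply/std_rel.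
  by have /std_rel /= := body _ (mem_head _ _) => ->.
- eexists; first exact: mem_head.
  exists v; split=> // _ /predU1P [->|//]; apply/std_rel.
  have /std_rel /= l1 := body _ (mem_head _ _).
  have /body /std_rel /= l2 : ratom SL [:: V 1; V 2] \in [:: ratom SL [:: V 0; V 1]; ratom SL [:: V 1; V 2]].
    by rewrite !inE eqxx orbT.
  exact: ltn_trans l1 l2.
- by have /std_rel /= := body _ (mem_head _ _); rewrite ltnn.
- case E: (val (v 0)) => [|m].
    eexists; first exact: mem_head.
    by exists v; split=> // _ /predU1P [->|//]; apply: val_inj.
  exists [:: ratom SN [:: V 1]; ratom SS [:: V 1; V 0]]; first by rewrite !inE eqxx orbT.
  exists (fun x => if x == 1 then inord m else v x); split=> [z|a].
    by rewrite inE => /negbTE ->.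
  rewrite !inE => /orP [] /eqP ->; apply/std_rel => //=.
  by rewrite inordK //; have := ltn_ord (v 0); rewrite -[nat_of_ord _]/(val _) E => /ltnW.
- by have /std_rel /= := body _ (mem_head _ _).
- eexists; first exact: mem_head.
  exists v; split=> // _ /predU1P [->|//]; apply: val_inj => /=.
  have /std_rel /= e1 := body _ (mem_head _ _).
  have /body /std_rel /= : ratom SS [:: V 1; V 2] \in [:: ratom SS [:: V 0; V 2]; ratom SS [:: V 1; V 2]].
    by rewrite !inE eqxx orbT.
  by rewrite e1 => -[].
Qed.

Lemma stdF_assertion B b c n y : bpeval B c [:: n] y -> n <= B -> sat_ded (stdF B b) (assertion c n).
Proof.
move=> ev nB v _; exists (chain c n); first exact: mem_head.
exists (fun i => if i <= n then inord i else if i == n.+1 then inord y else v i); split=> [z|].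
  by rewrite mem_iota -leqNgt => zn; rewrite leqNgt (ltnW zn) gtn_eqF.
apply/holds_chain; split=> [|i ii|].
- by apply: val_inj; rewrite /= inordK.
- have iB : i < B by apply: leq_trans ii nB.
  by apply/std_rel; rewrite /= ii (ltnW ii) /= !inordK // ltnS ltnW.
- apply/std_rel; rewrite /= leqnn ltnn eqxx !inordK //; exact: bpeval_le ev.
Qed.

(** * The reductions *)

Lemma computable_Cmp (f : nat -> nat) : Cmp f -> computable f.
Proof.
move=> [g [[c cP] gE]]; exists c => n.
by have := cP [:: n] erefl; rewrite /= (gE n : g n = f n).
Qed.

Lemma Cmp_chain (X : countType) (c : prf) (n : X -> nat) :
  Cmp n -> Cmp (fun x => chain c (n x)).
Proof.
by apply: Cmp_comp; rewrite /chain /ratom /eqa /V; apply: Cmp_cons; cmp.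
Qed.
#[local] Hint Extern 1 (Cmp (fun x => chain _ _)) => apply: Cmp_chain : cmp.

Lemma problem_pickle Pres (Sigma : seq ded) : (forall d, d \in Sigma -> wf_ded d) ->
  problem Pres (pickle Sigma) <-> Pres Sigma.
Proof.
move=> wS; split=> [[Sigma' [/(pcan_inj pickleK) -> [_ //]]]|PS].
by exists Sigma.
Qed.

Lemma PRESERVATION_hard P : RE P -> m_reduces P PRESERVATION.
Proof.
move=> [c cP]; pose T := infinite_theory c.
exists (fun n => pickle (gadget (query c 1) T (query c n))); split.
  apply: computable_Cmp; apply: Cmp_pickle; apply: Cmp_cons; last exact: Cmp_const.
  apply: Cmp_pair; last exact: Cmp_const.
  by apply: Cmp_pair; [apply: Cmp_const | apply: Cmp_chain; apply: Cmp_id].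
move=> n; have wfT : forall d, d \in T -> wf_ded d by exact: wf_infinite_theory.
rewrite /PRESERVATION problem_pickle; last exact: wf_gadget wfT (wf_query c n).
rewrite cP; split=> [[y ev] A B mA mB|pres].
  have hb S : models S (gadget (query c 1) T (query c n)) -> has_both S.
    move=> mS; apply: (infinite_theory_complete ev).
      by move=> d dT; apply: mS; apply: mem_gadget.
    exact: mS (mem_head _ _).
  exact: (gadget_preserved wfT (wf_query c n) (const0_infinite_theory c)
    (const0_query c n) (@syms_query c n) mA mB (hb A mA) (hb B mB)).
apply: NNPP => nh.
have mN b : models (stdN b) (gadget (query c 1) T (query c n)).
  by apply: gadget_std; [exact: stdN_infinite_theory | exact: stdN_query].
exact: gadget_not_preserved (pres _ _ (mN true) (mN false)).
Qed.

Lemma FIN_PRESERVATION_hard P : coRE P -> m_reduces P FIN_PRESERVATION.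
Proof.
move=> [c cP]; pose T := finite_theory c.
exists (fun n => pickle (gadget (assertion c 1) T (assertion c n))); split.
  apply: computable_Cmp; apply: Cmp_pickle; apply: Cmp_cons; last exact: Cmp_const.
  apply: Cmp_pair; first by cmp.
  by apply: Cmp_cons; [apply: Cmp_chain; apply: Cmp_id | apply: Cmp_const].
move=> n; have wfT : forall d, d \in T -> wf_ded d by exact: wf_finite_theory.
rewrite /FIN_PRESERVATION problem_pickle; last exact: wf_gadget wfT (wf_assertion c n).
split=> [Pn A B fA fB mA mB|pres].
  have hb S : finite_structure S -> models S (gadget (assertion c 1) T (assertion c n)) -> has_both S.
    (* Without [both] the asserted value would be genuine, against [P n]. *)
    move=> fS mS; apply: NNPP => nb; have /cP : exists y, peval c [:: n] y; last by [].
    apply: (finite_theory_sound fS _ (mS _ (mem_head _ _)) nb).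
    by move=> d dT; apply: mS; apply: mem_gadget.
  exact: (gadget_preserved wfT (wf_assertion c n) (const0_finite_theory c)
    (const0_assertion c n) (@syms_assertion c n) mA mB (hb A fA mA) (hb B fB mB)).
apply: NNPP => /cP [y /peval_bpeval [B0 ev]].
(* The model must contain the numerals of the chain as well as the values of the computation. *)
pose B := maxn n B0.
have mF b : models (stdF B b) (gadget (assertion c 1) T (assertion c n)).
  apply: gadget_std; first exact: stdF_finite_theory.
  by apply: (stdF_assertion (y := y)); [apply: ev; apply: leq_maxr | apply: leq_maxl].
have fF b : finite_structure (stdF B b) by exists B.+1, id => x; exists x.
exact: gadget_not_preserved (pres _ _ (fF true) (fF false) (mF true) (mF false)).
Qed.

Theorem theorem11 :
  RE_complete PRESERVATION /\ coRE_complete FIN_PRESERVATION.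
Proof.
split; split.
- exact: RE_PRESERVATION.
- exact: PRESERVATION_hard.
- exact: coRE_FIN_PRESERVATION.
- exact: FIN_PRESERVATION_hard.
Qed.
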